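(* Let $D\ge 4$. Let $X_{ij}$, $1\le i,j\le D$, $X_{ij}=-X_{ji}$, be the standard basis of the Lie algebra $\mathfrak{so}(D)$, satisfying $[X_{ij},X_{kl}]=\delta_{ik}X_{jl}-\delta_{il}X_{jk}-\delta_{jk}X_{il}+\delta_{jl}X_{ik}$. Call a finite-dimensional complex representation $V$ of $\mathrm{SO}(D)$ simple if $X_{[ij}X_{kl]}$ acts as zero on $V$ for all $i,j,k,l\in\{1,\dots,D\}$, where $[ijkl]$ denotes total antisymmetrization over the four indices. Then an irreducible representation $V$ of $\mathrm{SO}(D)$ is simple if and only if $V$ is equivalent to $\mathcal{H}^{(D)}_N$ for some integer $N\ge 0$.
   Context: $\mathcal{H}^{(D)}_N$ denotes the space of complex-valued harmonic homogeneous polynomials of degree $N$ on $\mathbb{R}^D$, with $\mathrm{SO}(D)$ acting by $(g\cdot P)(x)=P(g^{-1}x)$; the induced Lie algebra action is $X_{ij}\cdot P=x_i\,\partial P/\partial x_j-x_j\,\partial P/\partial x_i$. It is the irreducible representation of highest weight $Ne_1$. *)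

(* Defs.v *)
From HB Require Import structures.
From mathcomp Require Import all_boot all_order all_algebra all_fingroup.
From mathcomp Require Import mpoly.
From mathcomp Require Import all_classical all_reals all_analysis.
From mathcomp.real_closed Require Import complex.
Set Implicit Arguments. Unset Strict Implicit. Unset Printing Implicit Defensive.
Import Order.TTheory GRing.Theory Num.Theory numFieldNormedType.Exports.
Local Open Scope ring_scope.
Local Open Scope classical_set_scope.

Definition SO (R : realType) (D : nat) : set 'M[R]_D :=
  [set g | g *m g^T = 1%:M /\ \det g = 1].

(* The one-parameter subgroup t |-> exp(t (E_ij - E_ji)) (rotation in the
   (i,j)-plane); for i = j it is constantly the identity (X_ii = 0). *)
Definition rot (R : realType) (D : nat) (i j : 'I_D) (t : R) : 'M[R]_D :=
  \matrix_(k, l)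
    if i == j then (k == l)%:R
    else if ((k == i) && (l == i)) || ((k == j) && (l == j)) then cos t
    else if (k == i) && (l == j) then sin t
    else if (k == j) && (l == i) then - sin t
    else (k == l)%:R.

(* A finite-dimensional complex (continuous) representation of SO(D) on
   C^n (column vectors): rho is a continuous group homomorphism on SO(D)
   (its values outside SO(D) are irrelevant). *)
Definition is_rep (R : realType) (D n : nat)
    (rho : 'M[R]_D -> 'M[complex R]_n) : Prop :=
  rho 1%:M = 1%:M /\
  (forall g h, SO g -> SO h -> rho (g *m h) = rho g *m rho h) /\
  (forall a b : 'I_n,
     {within @SO R D, continuous (fun g => complex.Re (rho g a b))} /\
     {within @SO R D, continuous (fun g => complex.Im (rho g a b))}).

(* Induced action of the basis element X_ij of so(D):
   X_ij = d/dt|_{t=0} rho(exp(t(E_ij - E_ji))). *)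
Definition lie_act (R : realType) (D n : nat)
    (rho : 'M[R]_D -> 'M[complex R]_n) (i j : 'I_D) : 'M[complex R]_n :=
  \matrix_(a, b)
    Complex ((fun t : R => complex.Re (rho (rot i j t) a b))^`() 0)
            ((fun t : R => complex.Im (rho (rot i j t) a b))^`() 0).

(* "simple": X_[ij X_kl] acts as zero for all i,j,k,l
   (total antisymmetrization over the four indices; the normalising
   factor 1/24 is irrelevant for vanishing). *)
Definition simple_rep (R : realType) (D n : nat)
    (rho : 'M[R]_D -> 'M[complex R]_n) : Prop :=
  forall i j k l : 'I_D,
    let idx (m : 'I_4) : 'I_D := nth i [:: i; j; k; l] m in
    \sum_(s : 'S_4)
       ((-1) ^+ s) *: (lie_act rho (idx (s ord0)) (idx (s (inord 1)))
                       *m lie_act rho (idx (s (inord 2))) (idx (s (inord 3))))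
    = 0.

Definition invariant_subspace (R : realType) (D n : nat)
    (rho : 'M[R]_D -> 'M[complex R]_n) (P : set 'cV[complex R]_n) : Prop :=
  P 0 /\
  (forall u v, P u -> P v -> P (u + v)) /\
  (forall (c : complex R) v, P v -> P (c *: v)) /\
  (forall g v, SO g -> P v -> P (rho g *m v)).

Definition irreducible_rep (R : realType) (D n : nat)
    (rho : 'M[R]_D -> 'M[complex R]_n) : Prop :=
  (0 < n)%N /\
  forall P, invariant_subspace rho P -> P = [set 0] \/ P = setT.

Definition laplacian (R : realType) (D : nat) (p : mpoly.mpoly D (complex R))
  : mpoly.mpoly D (complex R) :=
  \sum_(k < D) mpoly.mderiv k (mpoly.mderiv k p).

Definition harmonic_homog (R : realType) (D N : nat)
  : set (mpoly.mpoly D (complex R)) :=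
  [set p : mpoly.mpoly D (complex R) | p \in @mpoly.ishomog1 D (complex R) N mpoly.mdeg /\ laplacian p = 0].

Definition peval (R : realType) (D : nat) (p : mpoly.mpoly D (complex R))
    (x : 'cV[R]_D) : complex R :=
  mpoly.meval (fun k : 'I_D => Complex (x k 0) 0) p.

Definition equiv_to_harmonic (R : realType) (D n : nat)
    (rho : 'M[R]_D -> 'M[complex R]_n) (N : nat) : Prop :=
  exists T : 'cV[complex R]_n -> mpoly.mpoly D (complex R),
    (forall (c : complex R) u v, T (c *: u + v) = c *: T u + T v) /\
    injective T /\
    range T = @harmonic_homog R D N /\
    (forall g v x, SO g ->
       peval (T (rho g *m v)) x = peval (T v) (invmx g *m x)).

(* Main.v *)
Require Import Defs.
From HB Require Import structures.
From mathcomp Require Import all_boot all_order all_algebra all_fingroup.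
From mathcomp Require Import mpoly.
From mathcomp Require Import all_classical all_reals all_analysis.
From mathcomp.real_closed Require Import complex.
From mathcomp Require Import ring lra zify.
Import Order.TTheory GRing.Theory Num.Theory numFieldNormedType.Exports.
Local Open Scope ring_scope.

(** Highest weight theory for the line spanned by [H = - i X_01], which acts on
    the ladder operators [E_a = X_0a + i X_1a] and [F_a = X_0a - i X_1a] with
    weights 1 and -1.  On an [H]-eigenvector of weight [mu] killed by all [E_a],
    simplicity says that [(mu + 1) X_ab] vanishes, while [2 mu] is a natural
    number; so all [X_ab] with [a, b >= 2] kill it, and then [mu] itself is a
    natural number [N] because [D >= 4].  These data agree with those of the
    harmonic polynomial [(x_0 + i x_1) ^ N], and the module generated by the pair
    of the two vectors is the graph of the isomorphism; irreducibility of the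
    harmonics comes from the Fischer product.
    A continuous [rho] is Lipschitz at 1, since the average of the powers
    [rho (g ^ k)] stays close to 1; this makes the derivatives of [rho] along
    different curves with the same velocity agree, whence the bracket relations.
    Conversely the antisymmetrisation of [(x_i d_j - x_j d_i) (x_k d_l - x_l d_k)]
    vanishes by the symmetry of products of coordinates and of derivatives. *)

Set Implicit Arguments.
Unset Strict Implicit.
Unset Printing Implicit Defensive.

(** * Modules over so(D) *)

(** Weights are taken for the line of [H] only, not for a full Cartan subalgebra, so one argument
    covers even and odd [D]. Two sl2-triples do the arithmetic: one attached to a single index [a]
    gives only that [2 mu] is natural; once the [X_ab] are known to kill the vector, a second one,
    mixing [a] and [b], removes the factor 2. Column vectors, polynomials and pairs of them all have
    to be so(D)-modules, hence the abstract [so_module], with subspaces as bare predicates and no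
    bases. Two gaps separate this algebra from the statement. [lie_act] differentiates functions
    that are only assumed continuous, and such a derivative is a junk value unless it exists, so
    differentiability has to come before any algebra. Irreducibility speaks of subspaces invariant
    under the group: stability under the Lie algebra is carried to the plane rotations by uniqueness
    for linear differential equations, and from these to [SO] by Givens elimination. *)

Section Modules.
Variables (C : numClosedFieldType) (D : nat).
Implicit Types (M : lmodType C).

(* [so_sep] makes every linear identity in [M] checkable by scalar [ring]
   computations; it holds for column vectors, polynomials and their products. *)
Record so_module M (X : 'I_D -> 'I_D -> M -> M) : Prop := SoModule {
  so_sep : forall u v : M,
    (forall f : M -> C, (forall x y, f (x + y) = f x + f y) ->
       (forall t x, f (t *: x) = t * f x) -> f u = f v) -> u = v;
  so_linD : forall i j u v, X i j (u + v) = X i j u + X i j v;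
  so_linZ : forall i j t u, X i j (t *: u) = t *: X i j u;
  so_antisym : forall i j u, X j i u = - X i j u;
  so_bracket : forall i j k l u, X i j (X k l u) =
    X k l (X i j u) + ((j == k)%:R *: X i l u - (i == k)%:R *: X j l u
                       - (j == l)%:R *: X i k u + (i == l)%:R *: X j k u) }.

Record submodule M (X : 'I_D -> 'I_D -> M -> M) (P : M -> Prop) : Prop :=
  Submodule {
    sub0 : P 0;
    subD : forall u v, P u -> P v -> P (u + v);
    subZ : forall t u, P u -> P (t *: u);
    subX : forall i j u, P u -> P (X i j u) }.

Definition so_simple M (X : 'I_D -> 'I_D -> M -> M) : Prop :=
  forall i j k l, i != j -> i != k -> i != l -> j != k -> j != l -> k != l ->
    forall u, X i j (X k l u) - X i k (X j l u) + X i l (X j k u) = 0.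

(** A linear map on all of [M] that is injective on [P], rather than a basis of [P]: any smaller
    predicate inherits finite dimension through the same map. *)
Definition finite_dim M (P : M -> Prop) : Prop :=
  exists n (f : M -> 'rV[C]_n),
    [/\ forall x y, f (x + y) = f x + f y, forall t x, f (t *: x) = t *: f x &
        forall x, P x -> f x = 0 -> x = 0].

(** The coordinates of the vectors form a matrix with more rows than columns, and a nonzero row of
    its left kernel is the relation. *)
Lemma finite_dim_dep M (P : M -> Prop) : P 0 ->
  (forall u v, P u -> P v -> P (u + v)) -> (forall t u, P u -> P (t *: u)) ->
  finite_dim P -> exists n, forall F : 'I_n -> M, (forall i, P (F i)) ->
    exists2 c : 'I_n -> C, exists i, c i != 0 & \sum_i c i *: F i = 0.
Proof.
move=> P0 PD PZ [n [f [fD fZ finj]]]; exists n.+1 => F PF.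
pose A := \matrix_(i < n.+1) f (F i).
have : kermx A != 0.
  rewrite kermx_eq0 /row_free neq_ltn; apply/orP; left.
  by rewrite ltnS rank_leq_col.
case/rowV0Pn => r /sub_kermxP rA r0.
exists (fun i => r 0 i).
  by case/rV0Pn: r0 => i ri; exists i.
have Psum : forall s : seq 'I_n.+1, P (\sum_(i <- s) r 0 i *: F i).
  elim=> [|i s IH]; first by rewrite big_nil.
  by rewrite big_cons; apply: PD => //; apply: PZ.
have f0 : f 0 = 0 by rewrite -[X in f X](scale0r (0 : M)) fZ scale0r.
apply: finj => //.
rewrite (big_morph f (id1 := 0) (op1 := +%R)) // -[RHS]rA.
rewrite mulmx_sum_row; apply: eq_bigr => i _.
by rewrite fZ rowK.
Qed.

(** Applying [T - mu n] to the relation removes its last term and multiplies the others by the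
    nonzero [mu k - mu n], so induction applies. *)
Lemma eigen_indep M (T : M -> M) (mu : nat -> C) (n : nat) (f : nat -> M) :
  (forall x y, T (x + y) = T x + T y) -> (forall t x, T (t *: x) = t *: T x) ->
  injective mu -> (forall k, T (f k) = mu k *: f k) ->
  \sum_(k < n) f k = 0 -> forall k, (k < n)%N -> f k = 0.
Proof.
move=> TD TZ mu_inj.
have T0 : T 0 = 0 by rewrite -[X in T X](scale0r (0 : M)) TZ scale0r.
elim: n f => [//|n IH] f Tf; rewrite big_ord_recr /= => S0.
have fn_ k : (k < n)%N -> f k = 0.
  move=> kn; suff /eqP : (mu k - mu n) *: f k = 0.
    rewrite scaler_eq0 subr_eq0 => /orP[/eqP/mu_inj kE|/eqP //].
    by rewrite kE ltnn in kn.
  apply: (IH (fun k => (mu k - mu n) *: f k)) => // [l|].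
    by rewrite TZ Tf !scalerA mulrC.
  have : T (\sum_(i < n) f i + f n) - mu n *: (\sum_(i < n) f i + f n) = 0.
    by rewrite S0 T0 scaler0 subrr.
  rewrite TD (big_morph T (id1 := 0) (op1 := +%R)) // Tf scalerDr.
  rewrite opprD addrACA subrr addr0 scaler_sumr -sumrB => e; rewrite -[RHS]e.
  by apply: eq_bigr => i _; rewrite Tf scalerBl.
move=> k; rewrite ltnS leq_eqVlt => /orP[/eqP ->|/fn_ //].
by move: S0; rewrite big1 ?add0r // => i _; apply: fn_.
Qed.

(** Makes ladder arguments terminate: enough of the [f k] satisfy a linear relation, whose terms are
    eigenvectors for distinct eigenvalues, so a term with nonzero coefficient has [f k = 0]. *)
Lemma eigen_chain_stops M (P : M -> Prop) (T : M -> M) (mu : nat -> C)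
    (f : nat -> M) : P 0 ->
  (forall u v, P u -> P v -> P (u + v)) -> (forall t u, P u -> P (t *: u)) ->
  finite_dim P ->
  (forall x y, T (x + y) = T x + T y) -> (forall t x, T (t *: x) = t *: T x) ->
  injective mu -> (forall k, T (f k) = mu k *: f k) ->
  (forall k, P (f k)) -> exists k, f k = 0.
Proof.
move=> P0 PD PZ Pfin TD TZ mu_inj Tf Pf.
have [n depn] := finite_dim_dep P0 PD PZ Pfin.
have [c [i ci] S0] := depn (fun i => f i) (fun i => Pf i).
exists i; pose cc k := oapp c 0 (insub k : option 'I_n).
have ccE (j : 'I_n) : cc j = c j by rewrite /cc insubT //= => jn; congr c; apply: val_inj.
have := @eigen_indep M T mu n (fun k => cc k *: f k) TD TZ mu_inj.
have H1 k : T (cc k *: f k) = mu k *: (cc k *: f k) by rewrite TZ Tf !scalerA mulrC.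
have H2 : \sum_(k < n) cc k *: f k = 0.
  by rewrite -[RHS]S0; apply: eq_bigr => j _; rewrite ccE.
move=> /(_ H1 H2 i (ltn_ord i)) /eqP.
by rewrite scaler_eq0 ccE (negbTE ci) => /eqP.
Qed.

Definition poly_act M (T : M -> M) (q : {poly C}) (v : M) : M :=
  \sum_(i < size q) q`_i *: iter i T v.

Lemma poly_actE M (T : M -> M) (q : {poly C}) v n : (size q <= n)%N ->
  poly_act T q v = \sum_(i < n) q`_i *: iter i T v.
Proof.
move=> qn; rewrite /poly_act (big_ord_widen n (fun i => q`_i *: iter i T v) qn).
rewrite big_mkcond; apply: eq_bigr => i _; case: ltnP => // qi.
by rewrite nth_default // scale0r.
Qed.

Lemma poly_actXsubC M (T : M -> M) (q : {poly C}) r v :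
  (forall x y, T (x + y) = T x + T y) -> (forall t x, T (t *: x) = t *: T x) ->
  poly_act T (('X - r%:P) * q) v = T (poly_act T q v) - r *: poly_act T q v.
Proof.
move=> TD TZ.
have T0 : T 0 = 0 by rewrite -[X in T X](scale0r (0 : M)) TZ scale0r.
rewrite (@poly_actE _ _ (('X - r%:P) * q) _ (size q).+1); last first.
  by apply: leq_trans (size_polyMleq _ _) _; rewrite size_XsubC.
rewrite (@poly_actE _ _ q _ (size q)) // (big_morph T (id1 := 0) (op1 := +%R)) //.
rewrite [LHS](_ : _ = \sum_(i < (size q).+1)
    ((if i == 0%N :> nat then 0 else q`_i.-1) *: iter i T v - (r * q`_i) *: iter i T v)); last first.
  by apply: eq_bigr => i _; rewrite mulrBl coefB coefXM coefCM scalerBl.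
rewrite sumrB big_ord_recl /= scale0r add0r; congr (_ - _).
  by apply: eq_bigr => i _; rewrite TZ.
rewrite big_ord_recr /= nth_default // mulr0 scale0r addr0 scaler_sumr.
by apply: eq_bigr => i _; rewrite scalerA.
Qed.

(** A relation between the iterates of [v] is a nonzero polynomial [q] with [q(T) v = 0]. Splitting
    off a root [r], either the cofactor still kills [v] and the degree has dropped, or the cofactor
    sends [v] to an eigenvector for [r]. *)
Lemma eigenvector_exists M (P : M -> Prop) (T : M -> M) : P 0 ->
  (forall u v, P u -> P v -> P (u + v)) -> (forall t u, P u -> P (t *: u)) ->
  finite_dim P ->
  (forall x y, T (x + y) = T x + T y) -> (forall t x, T (t *: x) = t *: T x) ->
  (forall u, P u -> P (T u)) -> forall v, P v -> v != 0 ->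
  exists r w, [/\ P w, w != 0 & T w = r *: w].
Proof.
move=> P0 PD PZ Pfin TD TZ PT v Pv v0.
have [n depn] := finite_dim_dep P0 PD PZ Pfin.
have Piter i : P (iter i T v) by elim: i => //= i; apply: PT.
have [c [i ci] S0] := depn (fun i => iter i T v) (fun i => Piter i).
pose cc k := oapp c 0 (insub k : option 'I_n).
have ccE (j : 'I_n) : cc j = c j by rewrite /cc insubT //= => jn; congr c; apply: val_inj.
pose q := \poly_(k < n) cc k.
have qv : poly_act T q v = 0.
  rewrite (@poly_actE _ _ _ _ n) ?size_poly // -[RHS]S0.
  by apply: eq_bigr => j _; rewrite coef_poly ltn_ord ccE.
have q0 : q != 0.
  apply/eqP => /(congr1 (fun p : {poly C} => p`_i)).
  by rewrite coef_poly ltn_ord ccE coef0 => /eqP; rewrite (negbTE ci).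
move: q qv q0 => {c ci i S0 cc ccE} q qv q0.
have Pact p : P (poly_act T p v).
  rewrite /poly_act; elim/big_ind: _ => // j _; exact: PZ.
move: (leqnn (size q)) q0 qv; move: {2}(size q) => m; elim: m q {depn} => [|m IH] q.
  by rewrite leqn0 size_poly_eq0 => ->.
move=> sq q0 qv.
have [s1|/closed_rootP[r rq]] := eqVneq (size q) 1%N.
  move: qv; rewrite /poly_act s1 big_ord1 /= => /eqP.
  rewrite scaler_eq0 (negbTE v0) orbF => q00.
  by move: q0; rewrite -lead_coef_eq0 lead_coefE s1 q00.
case/factor_theorem: rq => q' qE.
have q'0 : q' != 0 by apply: contraNneq q0 => q'0; rewrite qE q'0 mul0r.
have [q'v|q'v] := eqVneq (poly_act T q' v) 0.
  apply: (IH q') => //.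
  by move: sq; rewrite qE size_Mmonic ?monicXsubC // size_XsubC addn2.
exists r, (poly_act T q' v); split => //.
apply/eqP; rewrite -subr_eq0 -poly_actXsubC //; apply/eqP.
by rewrite mulrC -qE.
Qed.

End Modules.

(** * Commutation relations of the ladder operators *)

Section LadderOperators.
Variables (C : numClosedFieldType) (D : nat) (M : lmodType C).
Variables (X : 'I_D -> 'I_D -> M -> M) (o0 o1 : 'I_D).
Hypotheses (XM : so_module X) (o01 : o0 != o1).

Definition cartan (v : M) : M := - 'i *: X o0 o1 v.
Definition raising a (v : M) : M := X o0 a v + 'i *: X o1 a v.
Definition lowering a (v : M) : M := X o0 a v - 'i *: X o1 a v.

Lemma so_lin0 i j : X i j 0 = 0.
Proof. by rewrite -{1}(scale0r (0 : M)) (so_linZ XM) scale0r. Qed.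

Lemma so_linN i j u : X i j (- u) = - X i j u.
Proof. by rewrite -scaleN1r (so_linZ XM) scaleN1r. Qed.

Lemma so_diag i u : X i i u = 0.
Proof.
apply: (so_sep XM) => f fD fZ.
have /(congr1 f) := so_antisym XM i i u.
have -> : f (- X i i u) = - f (X i i u) by rewrite -scaleN1r fZ mulN1r.
have -> : f 0 = 0 by rewrite -(scale0r (0 : M)) fZ mul0r.
by move/eqP; rewrite eq_sym eqNr => /eqP.
Qed.

Let linE := (so_linD XM, so_linZ XM, so_linN, so_lin0).

Lemma so_ext u v :
  (forall f : M -> C, (forall x y, f (x + y) = f x + f y) ->
     (forall t x, f (t *: x) = t * f x) -> (forall x, f (- x) = - f x) ->
     f 0 = 0 -> f u = f v) -> u = v.
Proof.
move=> uv; apply: (so_sep XM) => f fD fZ; apply: uv => // [x|].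
  by rewrite -scaleN1r fZ mulN1r.
by rewrite -(scale0r (0 : M)) fZ mul0r.
Qed.

(** After [so_ext], an identity in [M] becomes one between scalars [f (...)], which [ring] decides
    modulo ['i ^+ 2 = -1]. *)
Local Ltac so_ring :=
  let f := fresh in let fD := fresh in let fZ := fresh in
  let fN := fresh in let f0 := fresh in
  apply: so_ext; intros f fD fZ fN f0;
  rewrite !(fD, fZ, fN, f0); ring: (sqrCi C).

Lemma cartanD u v : cartan (u + v) = cartan u + cartan v.
Proof. by rewrite /cartan linE scalerDr. Qed.

Lemma cartanZ t u : cartan (t *: u) = t *: cartan u.
Proof. by rewrite /cartan linE !scalerA mulrC. Qed.

Lemma raisingD a u v : raising a (u + v) = raising a u + raising a v.
Proof. by rewrite /raising !linE scalerDr addrACA. Qed.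

Lemma raisingZ a t u : raising a (t *: u) = t *: raising a u.
Proof. by rewrite /raising !linE scalerDr !scalerA mulrC. Qed.

Lemma loweringD a u v : lowering a (u + v) = lowering a u + lowering a v.
Proof. by rewrite /lowering !linE scalerDr opprD addrACA. Qed.

Lemma loweringZ a t u : lowering a (t *: u) = t *: lowering a u.
Proof. by rewrite /lowering !linE scalerBr !scalerA mulrC. Qed.

Section Commutators.
Variables (a b : 'I_D).
Hypotheses (a0 : a != o0) (a1 : a != o1) (b0 : b != o0) (b1 : b != o1).

Let deltaE := (negbTE o01, eq_sym o1 o0, negbTE a0, negbTE a1, negbTE b0,
  negbTE b1, eq_sym o0 a, eq_sym o1 a, eq_sym o0 b, eq_sym o1 b, eqxx,
  @scale0r C M, @scale1r C M, @subr0 M, @sub0r M, @addr0 M, @add0r M).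

Lemma cartan_raising v : cartan (raising a v) = raising a (cartan v) + raising a v.
Proof.
rewrite /cartan /raising !linE.
rewrite (so_bracket XM o0 o1 o0 a) (so_bracket XM o0 o1 o1 a) !deltaE.
so_ring.
Qed.

Lemma cartan_lowering v : cartan (lowering a v) = lowering a (cartan v) - lowering a v.
Proof.
rewrite /cartan /lowering !linE.
rewrite (so_bracket XM o0 o1 o0 a) (so_bracket XM o0 o1 o1 a) !deltaE.
so_ring.
Qed.

(** For [a = b] this makes [2 H], [E_a], [- F_a] an sl2-triple; for [a != b] it brings in the
    rotation [X a b]. *)
Lemma raising_lowering v : raising a (lowering b v) =
  lowering b (raising a v) - 2 *: X a b v - (2 * (a == b)%:R) *: cartan v.
Proof.
rewrite /cartan /lowering /raising !linE.
rewrite (so_bracket XM o0 a o0 b) (so_bracket XM o0 a o1 b).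
rewrite (so_bracket XM o1 a o0 b) (so_bracket XM o1 a o1 b) !deltaE.
rewrite ?(so_antisym XM o1 o0) ?so_diag.
so_ring.
Qed.

Lemma perp_lowering c v : c != o0 -> c != o1 -> X a b (lowering c v) =
  lowering c (X a b v) + (b == c)%:R *: lowering a v - (a == c)%:R *: lowering b v.
Proof.
move=> c0 c1; rewrite /lowering !linE.
rewrite (so_bracket XM a b o0 c) (so_bracket XM a b o1 c) !deltaE.
rewrite ?(so_antisym XM o0 a) ?(so_antisym XM o0 b) ?(so_antisym XM o1 a) ?(so_antisym XM o1 b).
so_ring.
Qed.

Lemma perp_cartan v : X a b (cartan v) = cartan (X a b v).
Proof. by rewrite /cartan !linE (so_bracket XM a b o0 o1) !deltaE. Qed.

(** The left side contains [X0a X1b - X0b X1a] and [X1a X0b - X1b X0a]; simplicity for the indices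
    [0, 1, a, b] turns each into [X01 Xab] up to sign, which gives [2 H Xab]. The brackets
    [[X0a, X0b]] and [[X1a, X1b]] give the remaining [- 2 Xab]. *)
Lemma simple_raising_lowering v : so_simple X -> a != b ->
  raising a (lowering b v) - raising b (lowering a v) =
  2 *: cartan (X a b v) - 2 *: X a b v.
Proof.
move=> Xs ab; have ba : b != a by rewrite eq_sym.
have := Xs o0 o1 a b o01.
have s : (o0 != a) && (o1 != a) && (o0 != b) && (o1 != b) by rewrite !deltaE.
case/andP: s => /andP[/andP[s1 s2] s3] s4.
move=> /(_ s1 s3 s2 s4 ab v)/(congr1 (fun u => (2 * 'i) *: u)); rewrite scaler0 => e.
rewrite /cartan /lowering /raising !linE.
rewrite (so_bracket XM o0 a o0 b) (so_bracket XM o1 a o1 b).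
rewrite (so_bracket XM o1 a o0 b) (so_bracket XM o1 b o0 a) !deltaE.
rewrite (negbTE ab) (negbTE ba) !deltaE ?oppr0 ?deltaE.
rewrite -[RHS]addr0 -e.
so_ring.
Qed.

Lemma from_ladder0 v : X o0 a v = 2^-1 *: (raising a v + lowering a v).
Proof.
rewrite /raising /lowering addrACA subrr addr0 -mulr2n -(@scaler_nat C M) scalerA.
by rewrite mulVf ?scale1r // pnatr_eq0.
Qed.

Lemma from_ladder1 v : X o1 a v = (- 'i / 2) *: (raising a v - lowering a v).
Proof.
rewrite /raising /lowering opprB addrC addrA subrK -mulr2n -(@scaler_nat C M) !scalerA.
rewrite -[LHS]scale1r; congr (_ *: _).
by field: (sqrCi C).
Qed.

End Commutators.
End LadderOperators.

(** * Top vectors *)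

Section TopVectors.
Variables (C : numClosedFieldType) (D : nat) (M : lmodType C).

(** The string [iter k f w] has weights [nu - 2 k], so it stops. At its first zero, of index [n.+1],
    applying [e] gives [n.+1 * (nu - n)] times the nonzero [iter n f w], which forces [nu = n]. *)
Lemma sl2_weight (P : M -> Prop) (h e f : M -> M) (nu : C) (w : M) :
  P 0 -> (forall u v, P u -> P v -> P (u + v)) ->
  (forall t u, P u -> P (t *: u)) -> finite_dim P -> (forall u, P u -> P (f u)) ->
  (forall x y, h (x + y) = h x + h y) -> (forall t x, h (t *: x) = t *: h x) ->
  (forall t x, f (t *: x) = t *: f x) -> e 0 = 0 ->
  (forall v, h (f v) = f (h v) - 2 *: f v) ->
  (forall v, e (f v) = f (e v) + h v) ->
  P w -> w != 0 -> e w = 0 -> h w = nu *: w -> exists n : nat, nu = n%:R.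
Proof.
move=> P0 PD PZ Pfin Pf hD hZ fZ e0 hf ef Pw w0 ew hw.
have f0 : f 0 = 0 by rewrite -(scale0r (0 : M)) fZ !scale0r.
have hk k : h (iter k f w) = (nu - 2 * k%:R) *: iter k f w.
  elim: k => [|k IH]; first by rewrite mulr0 subr0.
  rewrite iterS hf IH fZ -scalerBl; congr (_ *: _).
  by rewrite -natr1; ring.
have ek k : e (iter k.+1 f w) = (k.+1%:R * (nu - k%:R)) *: iter k f w.
  elim: k => [|k IH]; first by rewrite /= ef ew f0 add0r hw mul1r subr0.
  rewrite iterS ef IH fZ -iterS hk -scalerDl; congr (_ *: _).
  by rewrite -!natr1; ring.
have inj : injective (fun k : nat => nu - 2 * k%:R : C).
  move=> i j /addrI /oppr_inj /mulfI; rewrite pnatr_eq0 => /(_ isT) /eqP.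
  by rewrite eqr_nat => /eqP.
have Pk k : P (iter k f w) by elim: k => //= k; apply: Pf.
have [k0 k0P] := eigen_chain_stops P0 PD PZ Pfin hD hZ inj hk Pk.
have exk : exists k, iter k f w == 0 by exists k0; rewrite k0P.
case: (ex_minnP exk) => -[|n] /eqP zn minn; first by rewrite -[w]/(iter 0 f w) zn eqxx in w0.
exists n; move: (ek n); rewrite zn e0 => /esym/eqP.
rewrite scaler_eq0 mulf_eq0 pnatr_eq0 subr_eq0 /= => /orP[/eqP //|/minn].
by rewrite ltnn.
Qed.

Variables (X : 'I_D -> 'I_D -> M -> M) (o0 o1 : 'I_D).
Hypotheses (XM : so_module X) (o01 : o0 != o1).

Local Ltac module_scalars :=
  let f := fresh in let fD := fresh in let fZ := fresh in
  let fN := fresh in let f0 := fresh in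
  apply: (so_ext XM); intros f fD fZ fN f0;
  rewrite ?(fD, fZ, fN, f0) ?mulr1 ?mulr0.
Local Ltac module_ring := module_scalars; ring: (sqrCi C).
Local Ltac module_field := module_scalars; by field: (sqrCi C).

Local Notation H := (cartan X o0 o1).
Local Notation E := (raising X o0 o1).
Local Notation F := (lowering X o0 o1).

Definition top_vector (mu : C) (w : M) : Prop :=
  [/\ w != 0, H w = mu *: w & forall a, a != o0 -> a != o1 -> E a w = 0].

Lemma submoduleB P u v : submodule X P -> P u -> P v -> P (u - v).
Proof.
by move=> PX Pu Pv; apply: (subD PX) => //; rewrite -scaleN1r; apply: (subZ PX).
Qed.

Lemma submodule_cartan P u : submodule X P -> P u -> P (H u).
Proof. by move=> PX Pu; apply: (subZ PX); apply: (subX PX). Qed.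

Lemma submodule_raising P a u : submodule X P -> P u -> P (E a u).
Proof.
by move=> PX Pu; apply: (subD PX); [|apply: (subZ PX)]; apply: (subX PX).
Qed.

Lemma submodule_lowering P a u : submodule X P -> P u -> P (F a u).
Proof.
by move=> PX Pu; apply: submoduleB => //; [|apply: (subZ PX)]; apply: (subX PX).
Qed.

(** From any eigenvector of [H], raising operators are applied as long as one of them acts
    nontrivially. The weights [r + k] are distinct, so this stops, and the last nonzero vector is a
    top vector. *)
Lemma top_vector_exists P v : submodule X P -> finite_dim P -> P v -> v != 0 ->
  exists mu w, P w /\ top_vector mu w.
Proof.
move=> PX Pfin Pv v0.
have [r [w [Pw w0 Hw]]] := eigenvector_exists (sub0 PX) (subD PX) (subZ PX) Pfin
  (cartanD o0 o1 XM) (cartanZ o0 o1 XM) (fun u => submodule_cartan PX (u := u)) Pv v0.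
pose Q u a := [&& a != o0, a != o1 & E a u != 0].
(* [up u] is 0 exactly when every raising operator with index outside [o0], [o1] kills [u]; this is
   how the chain ends. *)
pose up u := oapp (fun a => E a u) 0 [pick a | Q u a].
have E0 a : E a 0 = 0 by rewrite -(scale0r (0 : M)) raisingZ // !scale0r.
have Hup u s : H u = s *: u -> H (up u) = (s + 1) *: up u.
  rewrite /up; case: pickP => /= [a /and3P[a0 a1 _] Hu|_ _].
    by rewrite cartan_raising // Hu raisingZ // scalerDl scale1r.
  by rewrite scaler0 -(scale0r (0 : M)) cartanZ // !scale0r.
have Pup u : P u -> P (up u).
  rewrite /up; case: pickP => /= [a _|_ _]; last exact: (sub0 PX).
  exact: submodule_raising.
have Hk k : H (iter k up w) = (r + k%:R) *: iter k up w.
  elim: k => [|k IH]; first by rewrite addr0.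
  by rewrite iterS (Hup _ _ IH) -addrA natr1.
have Pk k : P (iter k up w) by elim: k => //= k; apply: Pup.
have inj : injective (fun k : nat => r + k%:R : C).
  by move=> i j /addrI /eqP; rewrite eqr_nat => /eqP.
have [k0 k0P] := eigen_chain_stops (sub0 PX) (subD PX) (subZ PX) Pfin
  (cartanD o0 o1 XM) (cartanZ o0 o1 XM) inj Hk Pk.
have exk : exists k, iter k up w == 0 by exists k0; rewrite k0P.
case: (ex_minnP exk) => -[|n] /eqP zn minn; first by rewrite -[w]/(iter 0 up w) zn eqxx in w0.
have nz : iter n up w != 0 by apply/negP => /minn; rewrite ltnn.
exists (r + n%:R), (iter n up w); split => //; split => // a a0 a1.
move: zn; rewrite iterS {1}/up; case: pickP => /= [b /and3P[_ _ /negP nb] /eqP //|nQ _].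
by have := nQ a; rewrite /Q a0 a1 /= => /negbFE/eqP.
Qed.

Section Weight.
Variables (P : M -> Prop) (mu : C) (w : M).
Hypotheses (PX : submodule X P) (Pfin : finite_dim P) (Pw : P w).
Hypothesis (wtop : top_vector mu w).

(** For the triple [2 H], [E a], [- F a] the vector [w] is primitive of weight [2 mu]. *)
Lemma top_weight_half_nat a : a != o0 -> a != o1 -> exists n : nat, 2 * mu = n%:R.
Proof.
case: wtop => w0 Hw Ew a0 a1.
apply: (@sl2_weight P (fun v => 2 *: H v) (E a) (fun v => - F a v) _ w) => //.
- exact: (sub0 PX).
- exact: (subD PX).
- exact: (subZ PX).
- by move=> u Pu; rewrite -scaleN1r; apply: (subZ PX); apply: submodule_lowering.
- by move=> x y; rewrite cartanD // scalerDr.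
- move=> t x; rewrite cartanZ // !scalerA. by rewrite [2 * t]mulrC.
- by move=> t x; rewrite loweringZ // scalerN.
- by rewrite -(scale0r (0 : M)) raisingZ // !scale0r.
- move=> v; rewrite -[- F a v]scaleN1r cartanZ // cartan_lowering // loweringZ //.
  module_ring.
- move=> v; rewrite -[- F a v]scaleN1r raisingZ // raising_lowering // so_diag //.
  rewrite eqxx mulr1; module_ring.
- exact: Ew.
- by rewrite Hw scalerA.
Qed.

Hypothesis (Xs : so_simple X).

(** On a vector killed by all [E], the two sides of [simple_raising_lowering] are [- 4 X_ab w] and
    [(2 mu - 2) X_ab w], whence [(mu + 1) X_ab w = 0]; as [2 mu] is natural, [mu + 1] is not 0. *)
Lemma top_perp a b : a != o0 -> a != o1 -> b != o0 -> b != o1 -> X a b w = 0.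
Proof.
move=> a0 a1 b0 b1; have [<-|ab] := eqVneq a b; first exact: so_diag.
case: (wtop) => w0 Hw Ew.
have := simple_raising_lowering XM o01 a0 a1 b0 b1 w Xs ab.
have F0 c : F c 0 = 0 by rewrite -(scale0r (0 : M)) loweringZ // !scale0r.
rewrite !raising_lowering // !Ew // !F0 (negbTE ab) eq_sym (negbTE ab) !mulr0 !scale0r.
rewrite -perp_cartan // Hw (so_linZ XM) (so_antisym XM a b).
move/eqP; rewrite -subr_eq0 => /eqP e0.
have : (- (2 * (mu + 1))) *: X a b w = 0.
  by rewrite -[RHS]e0; module_ring.
move/eqP; rewrite scaler_eq0 oppr_eq0 mulf_eq0 pnatr_eq0 /= => /orP[|/eqP //].
have [n mun] := top_weight_half_nat a0 a1.
have : 2 * (mu + 1) != 0 by rewrite mulrDr mun mulr1 -natrD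
pnatr_eq0 addn2.
by rewrite mulf_eq0 pnatr_eq0 /= => /negbTE ->.
Qed.

(** The triple of the root that is the sum of the weights dual to [H] and [- 'i X_ab]:
    [h = H - 'i X_ab], [e = E_a + 'i E_b], and the factor [- 1/4] normalises [F_a - 'i F_b] so that
    [[e, f] = h]. Since [X_ab w = 0], the weight of [w] for [h] is [mu] itself. *)
Lemma top_weight_nat a b : a != o0 -> a != o1 -> b != o0 -> b != o1 -> a != b ->
  exists n : nat, mu = n%:R.
Proof.
move=> a0 a1 b0 b1 ab; case: (wtop) => w0 Hw Ew.
have ba : b == a = false by rewrite eq_sym (negbTE ab).
apply: (@sl2_weight P (fun v => H v - 'i *: X a b v) (fun v => E a v + 'i *: E b v)
  (fun v => (- 4^-1) *: (F a v - 'i *: F b v)) _ w) => //.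
- exact: (sub0 PX).
- exact: (subD PX).
- exact: (subZ PX).
- move=> u Pu; apply: (subZ PX); apply: submoduleB => //; last apply: (subZ PX);
    exact: submodule_lowering.
- by move=> x y; rewrite cartanD // (so_linD XM) scalerDr opprD addrACA.
- move=> t x; rewrite cartanZ // (so_linZ XM); module_ring.
- move=> t x; rewrite !loweringZ //.
  module_ring.
- by rewrite -(scale0r (0 : M)) !raisingZ // !scale0r scaler0 addr0.
- move=> v; set ff := (_ *: (F a v - _)).
  have ffE : ff = (- 4^-1) *: F a v + (4^-1 * 'i) *: F b v.
    module_ring.
  have -> : H ff = (- 4^-1) *: (F a (H v) - F a v) + (4^-1 * 'i) *: (F b (H v) - F b v).
    by rewrite ffE cartanD // !cartanZ // !cartan_lowering.
  have -> : X a b ff = (- 4^-1) *: (F a (X a b v) - F b v) + (4^-1 * 'i) *: (F b (X a b v) + F a v).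
    rewrite ffE (so_linD XM) !(so_linZ XM) !perp_lowering // !eqxx ba (negbTE ab) /=.
    module_ring.
  have lN c u x t : F c (u - t *: x) = F c u - t *: F c x.
    by rewrite loweringD // -[- (t *: x)]scaleNr loweringZ // [- t *: _]scaleNr.
  rewrite ffE !lN; module_field.
- move=> v.
  have eD c u x t : E c (t *: (u - 'i *: x)) = t *: E c u - (t * 'i) *: E c x.
    rewrite raisingZ // raisingD // -[- ('i *: x)]scaleNr raisingZ //.
  module_ring.
  have lD c u x : F c (u + 'i *: x) = F c u + 'i *: F c x.
    by rewrite loweringD // loweringZ.
  rewrite !eD !raising_lowering // !lD !eqxx ba (negbTE ab) !so_diag // (so_antisym XM a b) /=.
  module_field.
- by rewrite !Ew // scaler0 addr0.
- by rewrite Hw top_perp // scaler0 subr0.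
Qed.
End Weight.
End TopVectors.

(** * The module generated by a highest vector *)

Section CyclicModule.
Variables (C : numClosedFieldType) (D : nat) (M : lmodType C).
Variables (X : 'I_D -> 'I_D -> M -> M) (o0 o1 : 'I_D).
Hypotheses (XM : so_module X) (o01 : o0 != o1).

Local Notation H := (cartan X o0 o1).
Local Notation E := (raising X o0 o1).
Local Notation F := (lowering X o0 o1).

(** The second clause is what simplicity provides; thanks to it, lowering operators alone generate
    the module. *)
Definition highest_vector (mu : C) (w : M) : Prop :=
  top_vector X o0 o1 mu w /\
  forall a b, a != o0 -> a != o1 -> b != o0 -> b != o1 -> X a b w = 0.

Variables (mu : C) (w : M).
Hypothesis hw : highest_vector mu w.

(** Level [k] is spanned by the words of [k] lowering operators applied to [w]. Every level has its
    own zero, sums and multiples, so that [H] has a single eigenvalue on it. *)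
Inductive word_span : nat -> M -> Prop :=
| word_gen c : word_span 0 (c *: w)
| word_zero k : word_span k 0
| word_lower k a v : a != o0 -> a != o1 -> word_span k v -> word_span k.+1 (F a v)
| word_add k u v : word_span k u -> word_span k v -> word_span k (u + v)
| word_scale k t v : word_span k v -> word_span k (t *: v).

Inductive cyclic_module : M -> Prop :=
| cyclic_word k v : word_span k v -> cyclic_module v
| cyclic_add u v : cyclic_module u -> cyclic_module v -> cyclic_module (u + v).

Lemma submodule_of_ladder (P : M -> Prop) : P 0 ->
  (forall u v, P u -> P v -> P (u + v)) -> (forall t u, P u -> P (t *: u)) ->
  (forall u, P u -> P (H u)) ->
  (forall a u, a != o0 -> a != o1 -> P u -> P (E a u)) ->
  (forall a u, a != o0 -> a != o1 -> P u -> P (F a u)) ->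
  (forall a b u, a != o0 -> a != o1 -> b != o0 -> b != o1 -> P u -> P (X a b u)) ->
  submodule X P.
Proof.
move=> P0 PD PZ PH PE PF PX.
have PN u : P u -> P (- u) by rewrite -scaleN1r; apply: PZ.
have P01 u : P u -> P (X o0 o1 u).
  move=> Pu; have -> : X o0 o1 u = 'i *: H u; last by apply/PZ/PH.
  by rewrite /cartan scalerA mulrN -expr2 sqrCi opprK scale1r.
have P0a a u : a != o0 -> P u -> P (X o0 a u).
  move=> a0 Pu; have [->|a1] := eqVneq a o1; first exact: P01.
  by rewrite (from_ladder0 X o0 o1) //; apply: PZ; apply: PD; [apply: PE|apply: PF].
have P1a a u : a != o1 -> P u -> P (X o1 a u).
  move=> a1 Pu; have [->|a0] := eqVneq a o0.
    by rewrite (so_antisym XM); apply/PN/P01.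
  rewrite (from_ladder1 X o0 o1) //; apply: PZ; apply: PD; first exact: PE.
  by apply/PN/PF.
split=> // i j u Pu.
have [->|ij] := eqVneq i j; first by rewrite so_diag.
have [i0|i0] := eqVneq i o0; first by rewrite i0; apply: P0a; rewrite // -i0 eq_sym.
have [i1|i1] := eqVneq i o1; first by rewrite i1; apply: P1a; rewrite // -i1 eq_sym.
have [j0|j0] := eqVneq j o0; first by rewrite j0 (so_antisym XM); apply/PN/P0a.
have [j1|j1] := eqVneq j o1; first by rewrite j1 (so_antisym XM); apply/PN/P1a.
exact: PX.
Qed.

Lemma word_cartan k v : word_span k v -> H v = (mu - k%:R) *: v.
Proof.
have [[_ Hw _] _] := hw.
elim=> {k v} [c|k|k a v a0 a1 _ IH|k u v _ IHu _ IHv|k t v _ IH].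
- by rewrite cartanZ // Hw; apply: (so_ext XM) => f fD fZ fN f0; rewrite !fZ; ring.
- by rewrite scaler0 -(scale0r (0 : M)) cartanZ // !scale0r.
- rewrite cartan_lowering // IH loweringZ // -natr1.
  by apply: (so_ext XM) => f fD fZ fN f0; rewrite !(fD, fZ, fN); ring.
- by rewrite cartanD // IHu IHv scalerDr.
- by rewrite cartanZ // IH; apply: (so_ext XM) => f fD fZ fN f0; rewrite !fZ; ring.
Qed.

Lemma word_perp a b k v : a != o0 -> a != o1 -> b != o0 -> b != o1 ->
  word_span k v -> word_span k (X a b v).
Proof.
move=> a0 a1 b0 b1; have [_ Xw] := hw.
elim=> {k v} [c|k|k c v c0 c1 wv IH|k u v _ IHu _ IHv|k t v _ IH].
- by rewrite (so_linZ XM) Xw // scaler0; apply: word_zero.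
- by rewrite so_lin0 //; apply: word_zero.
- rewrite perp_lowering // -[- (_ *: _)]scaleNr.
  by apply: word_add; [apply: word_add|apply: word_scale]; 
    [apply: word_lower|apply: word_scale; apply: word_lower|apply: word_lower].
- by rewrite (so_linD XM); apply: word_add.
- by rewrite (so_linZ XM); apply: word_scale.
Qed.

(** Moving [E_a] to the right past an [F_b] costs only [X_ab] and [H], which preserve levels; at
    level 0 it meets [w] and gives 0. *)
Lemma word_raising a k v : a != o0 -> a != o1 -> word_span k v ->
  if k is k'.+1 then word_span k' (E a v) else E a v = 0.
Proof.
move=> a0 a1; have [[_ Hw Ew] _] := hw.
have E0 : E a 0 = 0 by rewrite -(scale0r (0 : M)) raisingZ // !scale0r.
elim=> {k v} [c|k|k b v b0 b1 wv IH|k u v wu IHu wv IHv|k t v wv IH].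
- by rewrite raisingZ // Ew // scaler0.
- by rewrite E0; case: k => // k; apply: word_zero.
- rewrite raising_lowering // -[- (2 *: _)]scaleNr -[- (_ *: H v)]scaleNr.
  rewrite (word_cartan wv); apply: word_add; last by do 2![apply: word_scale].
  apply: word_add; last by apply: word_scale; apply: word_perp.
  case: k wv IH => [|k] wv IH; last exact: word_lower.
  by rewrite IH -(scale0r (0 : M)) loweringZ // scale0r; apply: word_zero.
- rewrite raisingD //; case: k wu wv IHu IHv => [|k] _ _ IHu IHv.
    by rewrite IHu IHv addr0.
  exact: word_add.
- rewrite raisingZ //; case: k wv IH => [|k] _ IH; first by rewrite IH scaler0.
  exact: word_scale.
Qed.

Lemma cyclic_submodule : submodule X cyclic_module.
Proof.
apply: submodule_of_ladder.
- apply: (@cyclic_word 0); apply: word_zero.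
- exact: cyclic_add.
- move=> t u; elim=> {u} [k v wv|u v _ IHu _ IHv].
    by apply: (@cyclic_word k); apply: word_scale.
  by rewrite scalerDr; apply: cyclic_add.
- move=> u; elim=> {u} [k v wv|u v _ IHu _ IHv].
    by apply: (@cyclic_word k); rewrite (word_cartan wv); apply: word_scale.
  by rewrite cartanD //; apply: cyclic_add.
- move=> a u a0 a1; elim=> {u} [k v wv|u v _ IHu _ IHv].
    have := word_raising a0 a1 wv; case: k wv => [|k] _ => [->|].
      apply: (@cyclic_word 0); apply: word_zero.
    exact: cyclic_word.
  by rewrite raisingD //; apply: cyclic_add.
- move=> a u a0 a1; elim=> {u} [k v wv|u v _ IHu _ IHv].
    by apply: (@cyclic_word k.+1); apply: word_lower.
  by rewrite loweringD //; apply: cyclic_add.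
- move=> a b u a0 a1 b0 b1; elim=> {u} [k v wv|u v _ IHu _ IHv].
    by apply: (@cyclic_word k); apply: word_perp.
  by rewrite (so_linD XM); apply: cyclic_add.
Qed.

Lemma cyclic_gen : cyclic_module w.
Proof. by apply: (@cyclic_word 0); rewrite -[w]scale1r; apply: word_gen. Qed.

Lemma cyclic_min P v : submodule X P -> P w -> cyclic_module v -> P v.
Proof.
move=> PX Pw; elim=> {v} [k v|u v _ IHu _ IHv]; last exact: (subD PX).
elim=> {k v} [c|k|k a v a0 a1 _ IH|k u v _ IHu _ IHv|k t v _ IH].
- exact: (subZ PX).
- exact: (sub0 PX).
- exact: submodule_lowering.
- exact: (subD PX).
- exact: (subZ PX).
Qed.

(** [v] is a sum of its level parts, whose weights [mu - k] are distinct, so a vector of weight [mu]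
    equals its part at level 0, a multiple of [w]. *)
Lemma cyclic_top_line v : cyclic_module v -> H v = mu *: v -> exists c, v = c *: w.
Proof.
move=> Wv Hv.
have [n [f [wf vE]]] : exists n (f : nat -> M), (forall k, word_span k (f k)) /\
    v = \sum_(k < n) f k.
  elim: Wv {Hv} => {v} [k v wv|u v _ [n [f [wf ->]]] _ [m [g [wg ->]]]].
    exists k.+1, (fun i => if i == k then v else 0); split.
      by move=> i; case: eqP => [->|_] //; apply: word_zero.
    rewrite big_ord_recr /= eqxx big1 ?add0r // => i _.
    by rewrite ltn_eqF.
  exists (maxn n m), (fun i => (if (i < n)%N then f i else 0) + if (i < m)%N then g i else 0).
  split=> [i|]; first by apply: word_add; case: ifP => _ //; apply: word_zero.
  rewrite big_split /=; congr (_ + _).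
    by rewrite (big_ord_widen _ f (leq_maxl n m)) big_mkcond.
  by rewrite (big_ord_widen _ g (leq_maxr n m)) big_mkcond.
case: n vE => [|n] vE; first by exists 0; rewrite vE big_ord0 scale0r.
(* Subtracting [v] from the part at level 0 keeps that part of weight [mu] and makes the whole sum
   0, so [eigen_indep] applies. *)
pose g k := if k == 0%N then f 0%N - v else f k.
have inj : injective (fun k : nat => mu - k%:R).
  by move=> i j /addrI /oppr_inj /eqP; rewrite eqr_nat => /eqP.
have Hg k : H (g k) = (mu - k%:R) *: g k.
  rewrite /g; case: eqP => [->|_]; last exact: word_cartan.
  by rewrite -[- v]scaleN1r cartanD // cartanZ // (word_cartan (wf 0%N)) Hv subr0 scalerDr
    !scalerA mulrC.
have S0 : \sum_(k < n.+1) g k = 0.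
  rewrite big_ord_recl /= /g /= addrAC; apply/eqP; rewrite subr_eq0; apply/eqP.
  by rewrite vE big_ord_recl.
have /eqP := eigen_indep (cartanD o0 o1 XM) (cartanZ o0 o1 XM) inj Hg S0 (ltn0Sn n).
rewrite /g /= subr_eq0 => /eqP <-.
(* The level is generalised together with an equation identifying it with 0, so that the induction
   discards the lowering words. *)
move: (wf 0%N) (erefl 0%N); move: {1 3}0%N (f 0%N) => k u.
elim=> {k u} [c|k|k a u a0 a1 _ _|k u u1 _ IHu _ IHu1|k t u _ IH] // k0.
- by exists c.
- by exists 0; rewrite scale0r.
- by have [c ->] := IHu k0; have [c1 ->] := IHu1 k0; exists (c + c1); rewrite scalerDl.
- by have [c ->] := IH k0; exists (t * c); rewrite scalerA.
Qed.

End CyclicModule.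

(** * The isomorphism as a graph *)

Section Intertwiner.
Variables (C : numClosedFieldType) (D : nat) (M1 M2 : lmodType C).
Variables (X1 : 'I_D -> 'I_D -> M1 -> M1) (X2 : 'I_D -> 'I_D -> M2 -> M2).
Hypotheses (XM1 : so_module X1) (XM2 : so_module X2).

Definition irreducible_submodule (M : lmodType C) (X : 'I_D -> 'I_D -> M -> M)
    (P : M -> Prop) : Prop :=
  forall Q, submodule X Q -> (forall v, Q v -> P v) -> (exists2 v, Q v & v != 0) ->
  forall v, P v -> Q v.

Definition pair_act i j (u : M1 * M2) : M1 * M2 := (X1 i j u.1, X2 i j u.2).

Lemma pair_so_module : so_module pair_act.
Proof.
split.
- move=> [u1 u2] [v1 v2] uv; congr (_, _).
    apply: (so_sep XM1) => f fD fZ; apply: (uv (fun u => f u.1)).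
      by move=> x y; apply: fD.
    by move=> x y; apply: fZ.
  apply: (so_sep XM2) => f fD fZ; apply: (uv (fun u => f u.2)).
    by move=> x y; apply: fD.
  by move=> x y; apply: fZ.
- by move=> i j u v; rewrite /pair_act /= (so_linD XM1) (so_linD XM2).
- by move=> i j t u; rewrite /pair_act /= (so_linZ XM1) (so_linZ XM2).
- by move=> i j u; rewrite /pair_act /= (so_antisym XM1) (so_antisym XM2).
- by move=> i j k l u; rewrite /pair_act /= (so_bracket XM1) (so_bracket XM2).
Qed.

Variables (o0 o1 : 'I_D) (mu : C) (w1 : M1) (w2 : M2) (P2 : M2 -> Prop).
Hypotheses (o01 : o0 != o1).
Hypothesis hw1 : highest_vector X1 o0 o1 mu w1.
Hypothesis hw2 : highest_vector X2 o0 o1 mu w2.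
Hypotheses (irr1 : irreducible_submodule X1 (fun _ => True)).
Hypotheses (PX2 : submodule X2 P2) (P2w : P2 w2).
Hypotheses (irr2 : irreducible_submodule X2 P2).

(* The submodule of [M1 * M2] generated by [(w1, w2)] is the graph of the
   isomorphism, since its vectors of weight [mu] are the multiples of [(w1, w2)]. *)
Theorem so_intertwiner : exists T : M1 -> M2,
  [/\ forall c u v, T (c *: u + v) = c *: T u + T v, injective T,
      forall v, P2 (T v), forall q, P2 q -> exists v, T v = q &
      forall i j v, T (X1 i j v) = X2 i j (T v)].
Proof.
have XM := pair_so_module.
have [[w10 Hw1 Ew1] Xw1] := hw1; have [[w20 Hw2 Ew2] Xw2] := hw2.
have hw : highest_vector pair_act o0 o1 mu (w1, w2).
  split; first split.
  - by apply: contra w10 => /eqP[-> _].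
  - by congr (_, _).
  - by move=> a a0 a1; congr (_, _); [apply: Ew1|apply: Ew2].
  - by move=> a b a0 a1 b0 b1; congr (_, _); [apply: Xw1|apply: Xw2].
pose W := cyclic_module pair_act o0 o1 (w1, w2).
have WX : submodule pair_act W by apply: (cyclic_submodule XM o01 hw).
have Wline u : W u -> cartan pair_act o0 o1 u = mu *: u -> exists c, u = c *: (w1, w2).
  exact: (cyclic_top_line XM o01 hw).
have Ww : W (w1, w2) by apply: cyclic_gen.
have WP2 u : W u -> P2 u.2.
  apply: (@cyclic_min _ _ _ _ _ _ (w1, w2) (fun u => P2 u.2)) => //; split=> /=.
  - exact: (sub0 PX2).
  - by move=> x y; apply: (subD PX2).
  - by move=> t x; apply: (subZ PX2).
  - by move=> i j x; apply: (subX PX2).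
(* By irreducibility a nonzero [u] would put [(w1, 0)] in [W]; it has weight [mu], so it would be a
   multiple of [(w1, w2)], which is impossible as neither component is 0. *)
have K1 u : W (u, 0) -> u = 0.
  move=> Wu; apply/eqP/negPn/negP => u0.
  have : W (w1, 0).
    apply: (irr1 (Q := fun u => W (u, 0))) => //; last by exists u.
    split=> [|x y Wx Wy|t x Wx|i j x Wx].
    - exact: (sub0 WX).
    - have -> : (x + y, 0) = (x, 0) + (y, 0) :> M1 * M2.
        by apply: injective_projections; rewrite /= ?addr0.
      exact: (subD WX).
    - have -> : (t *: x, 0) = t *: (x, 0) :> M1 * M2.
        by apply: injective_projections; rewrite /= ?scaler0.
      exact: (subZ WX).
    - by have := subX WX i j Wx; rewrite /pair_act /= so_lin0.
  move=> /Wline[|c [e1 /esym/eqP]].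
    congr (_, _); first exact: Hw1.
    by rewrite /= /pair_act /= so_lin0 // !scaler0.
  rewrite scaler_eq0 (negbTE w20) orbF => /eqP c0.
  by move: w10; rewrite e1 c0 scale0r eqxx.
have K2 q : W (0, q) -> q = 0.
  move=> Wq; apply/eqP/negPn/negP => q0.
  have : W (0, w2).
    apply: (irr2 (Q := fun u => W (0, u))) => //.
    - split=> [|x y Wx Wy|t x Wx|i j x Wx].
      + exact: (sub0 WX).
      + have -> : (0, x + y) = (0, x) + (0, y) :> M1 * M2.
          by apply: injective_projections; rewrite /= ?addr0.
      exact: (subD WX).
      + have -> : (0, t *: x) = t *: (0, x) :> M1 * M2.
          by apply: injective_projections; rewrite /= ?scaler0.
      exact: (subZ WX).
      + by have := subX WX i j Wx; rewrite /pair_act /= so_lin0.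
    - by move=> v /WP2.
    - by exists q.
  move=> /Wline[|c [/esym/eqP e1 e2]].
    congr (_, _); last exact: Hw2.
    by rewrite /= /pair_act /= so_lin0 // !scaler0.
  move: e1; rewrite scaler_eq0 (negbTE w10) orbF => /eqP c0.
  by move: w20; rewrite e2 c0 scale0r eqxx.
(* The two projections of [W] are nonzero submodules, hence all of [M1] and all of [P2]. *)
have onto1 u : exists q, W (u, q).
  apply: (irr1 (Q := fun u => exists q, W (u, q))) => //; last by exists w1 => //; exists w2.
  split=> [|x y [q Wx] [r Wy]|t x [q Wx]|i j x [q Wx]].
  - by exists 0; apply: (sub0 WX).
  - by exists (q + r); apply: (subD WX Wx Wy).
  - by exists (t *: q); apply: (subZ WX t Wx).
  - by exists (X2 i j q); apply: (subX WX i j Wx).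
have onto2 q : P2 q -> exists u, W (u, q).
  apply: (irr2 (Q := fun q => exists u, W (u, q))).
  - split=> [|x y [u Wx] [v Wy]|t x [u Wx]|i j x [u Wx]].
    + by exists 0; apply: (sub0 WX).
    + by exists (u + v); apply: (subD WX Wx Wy).
    + by exists (t *: u); apply: (subZ WX t Wx).
    + by exists (X1 i j u); apply: (subX WX i j Wx).
  - by move=> v [u /WP2].
  - by exists w2 => //; exists w1.
have Wuniq u q r : W (u, q) -> W (u, r) -> q = r.
  move=> Wq Wr; apply/eqP; rewrite -subr_eq0; apply/eqP/K2.
  have -> : (0, q - r) = (u, q) - (u, r) :> M1 * M2.
    by apply: injective_projections; rewrite /= ?subrr.
  by apply: (submoduleB WX).
have [T WT] := choice onto1.
exists T; split=> [c u v|u v Tuv|v|q /onto2[u Wu]|i j v].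
- apply: (Wuniq (c *: u + v)) => //.
  exact: (subD WX (subZ WX c (WT u)) (WT v)).
- apply/eqP; rewrite -subr_eq0; apply/eqP/K1.
  have -> : (u - v, 0) = (u, T u) - (v, T v) :> M1 * M2.
    by apply: injective_projections; rewrite /= ?Tuv ?subrr.
  by apply: (submoduleB WX).
- exact: (WP2 _ (WT v)).
- by exists u; apply: (Wuniq u).
- by apply: (Wuniq (X1 i j v)) => //; apply: (subX WX i j (WT v)).
Qed.

End Intertwiner.

(** * Harmonic polynomials *)

Section RotationFields.
Variables (C : numClosedFieldType) (D : nat).
Local Notation P := {mpoly C[D]}.
Implicit Types (p q r : P) (i j k l a : 'I_D).

(** A Kronecker delta living in the polynomial ring instead of among the scalars, so that [ring]
    sees it as a factor. *)
Definition kron (b : bool) : P := if b then 1 else 0.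

Lemma kronZ (b : bool) p : b%:R *: p = kron b * p.
Proof. by case: b; rewrite ?scale1r ?mul1r ?scale0r ?mul0r. Qed.

Lemma mderiv_var i j : ('X_i : P)^`M(j) = kron (i == j).
Proof.
rewrite mderivX mnm1E kronZ; case: eqP => [->|_]; last by rewrite mul0r.
by rewrite -[X in (X - _)%MM]add0m addmK mpolyX0 mulr1.
Qed.

Lemma mderiv_kron b j : (kron b)^`M(j) = 0.
Proof. by case: b; rewrite /kron ?mderiv0 // -mpolyC1 mderivC. Qed.

Definition dE := (mderivD, mderivB, mderivN, mderivM, mderivZ, mderiv_var, mderiv_kron).

Definition rot_field i j p : P := 'X_i * p^`M(j) - 'X_j * p^`M(i).

Lemma rot_fieldD i j p q : rot_field i j (p + q) = rot_field i j p + rot_field i j q.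
Proof. by rewrite /rot_field !mderivD; ring. Qed.

Lemma rot_fieldZ i j (t : C) p : rot_field i j (t *: p) = t *: rot_field i j p.
Proof. by rewrite /rot_field !mderivZ -!scalerAr scalerBr. Qed.

Lemma rot_field_so_module : so_module rot_field.
Proof.
split.
- move=> u v uv; apply/mpolyP => m; apply: (uv (fun p => p@_m)).
    by move=> x y; rewrite mcoeffD.
  by move=> t x; rewrite mcoeffZ.
- exact: rot_fieldD.
- exact: rot_fieldZ.
- by move=> i j u; rewrite /rot_field opprB.
- move=> i j k l u; rewrite !kronZ /rot_field !dE.
  rewrite (eq_sym k i) (eq_sym k j) (eq_sym l i) (eq_sym l j).
  rewrite (mderiv_comm k j) (mderiv_comm k i) (mderiv_comm l j) (mderiv_comm l i).
  ring.
Qed.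

Definition euler p : P := \sum_k 'X_k * p^`M(k).
Definition laplace p : P := \sum_k p^`M(k)^`M(k).

Lemma sum_kron (F : 'I_D -> P) i : \sum_k kron (k == i) * F k = F i.
Proof.
rewrite (bigD1 i) //= eqxx /kron mul1r big1 ?addr0 // => k /negbTE ->.
by rewrite mul0r.
Qed.

Lemma mderiv_euler i p : (euler p)^`M(i) = p^`M(i) + euler p^`M(i).
Proof.
rewrite /euler raddf_sum /= -[X in _ = X + _](sum_kron (fun k => p^`M(k))) -big_split /=.
apply: eq_bigr => k _; rewrite !dE. congr (_ + _ * _); exact: mderiv_comm.
Qed.

Lemma mderiv_laplace i p : (laplace p)^`M(i) = laplace p^`M(i).
Proof.
rewrite /laplace raddf_sum /=; apply: eq_bigr => k _.
by rewrite !(mderiv_comm k i).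
Qed.

Lemma eulerM p q : euler (p * q) = euler p * q + p * euler q.
Proof.
rewrite /euler mulr_suml mulr_sumr -big_split; apply: eq_bigr => k _ /=.
by rewrite !dE; ring.
Qed.

Lemma eulerB p q : euler (p - q) = euler p - euler q.
Proof. by rewrite /euler -sumrB; apply: eq_bigr => k _; rewrite !dE mulrBr. Qed.

Lemma eulerD p q : euler (p + q) = euler p + euler q.
Proof. by rewrite /euler -big_split; apply: eq_bigr => k _; rewrite !dE mulrDr. Qed.

Lemma eulerZ t p : euler (t *: p) = t *: euler p.
Proof. by rewrite /euler scaler_sumr; apply: eq_bigr => k _; rewrite !dE -scalerAr. Qed.

Lemma euler_var i : euler 'X_i = 'X_i.
Proof.
rewrite /euler -[RHS](sum_kron (fun k => 'X_k)); apply: eq_bigr => k _.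
by rewrite !dE mulrC eq_sym.
Qed.

Lemma laplaceD p q : laplace (p + q) = laplace p + laplace q.
Proof. by rewrite /laplace -big_split; apply: eq_bigr => k _; rewrite !dE. Qed.

Lemma laplaceB p q : laplace (p - q) = laplace p - laplace q.
Proof. by rewrite /laplace -sumrB; apply: eq_bigr => k _; rewrite !dE. Qed.

Lemma laplaceZ t p : laplace (t *: p) = t *: laplace p.
Proof. by rewrite /laplace scaler_sumr; apply: eq_bigr => k _; rewrite !dE. Qed.

Lemma laplace_var_mul i p : laplace ('X_i * p) = 'X_i * laplace p + (p^`M(i) + p^`M(i)).
Proof.
rewrite /laplace mulr_sumr -[p^`M(i)](sum_kron (fun k => p^`M(k))) -!big_split /=.
by apply: eq_bigr => k _; rewrite !dE eq_sym; ring.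
Qed.

Lemma laplace_rot_field i j p : laplace (rot_field i j p) = rot_field i j (laplace p).
Proof.
rewrite /rot_field laplaceB !laplace_var_mul !mderiv_laplace (mderiv_comm i j); ring.
Qed.

Lemma euler_rot_field i j p : euler (rot_field i j p) = rot_field i j (euler p).
Proof.
by rewrite /rot_field eulerB !eulerM !euler_var !mderiv_euler; ring.
Qed.

Lemma mcoeff_euler p m : (euler p)@_m = (mdeg m)%:R * p@_m.
Proof.
suff e : euler p = \sum_(m <- msupp p) ((mdeg m)%:R * p@_m) *: 'X_[m].
  rewrite e raddf_sum /=.
  under eq_bigr do rewrite mcoeffZ mcoeffX.
  have [mp|mp] := boolP (m \in msupp p).
    rewrite (bigD1_seq m) ?msupp_uniq //= eqxx mulr1 big1 ?addr0 // => k /negbTE ->.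
    by rewrite mulr0.
  rewrite (memN_msupp_eq0 mp) mulr0 big_seq big1 // => k kp.
  by case: eqP => [km|_]; rewrite ?mulr0 //; rewrite km (negbTE mp) in kp.
rewrite {1}[p]mpolyE /euler.
under eq_bigr do rewrite raddf_sum /= mulr_sumr.
rewrite exchange_big /=; apply: eq_bigr => k _.
rewrite mdegE natr_sum mulr_suml scaler_suml; apply: eq_bigr => i _.
rewrite mderivZ mderivX -!scalerAr scalerA -mpolyXD mulrC.
(* The exponent [k - U_(i)] is truncated, so multiplying by ['X_i] restores the monomial only for
   positive [k i]; otherwise the coefficient vanishes. *)
have [->|ki] := eqVneq (k i) 0%N; first by rewrite !mul0r !scale0r.
congr (_ *: 'X_[_]); rewrite addmC submK //.
by apply/mnm_lepP => l; rewrite mnm1E; case: eqP => // <-; rewrite lt0n.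
Qed.

(** Turns homogeneity into an eigenvalue equation for an operator commuting with [rot_field]; at the
    coefficient of [m] it reads [mdeg m = N] unless that coefficient is 0. *)
Lemma homog_euler N p : (p \is N.-homog) = (euler p == N%:R *: p).
Proof.
apply/dhomogP/eqP => [hp|ep m mp].
  apply/mpolyP => m; rewrite mcoeff_euler mcoeffZ.
  have [/hp ->//|/memN_msupp_eq0 ->] := boolP (m \in msupp p).
  by rewrite !mulr0.
have := congr1 (fun q => q@_m) ep; rewrite mcoeff_euler mcoeffZ => /mulIf.
by rewrite -mcoeff_msupp => /(_ mp)/eqP; rewrite eqr_nat => /eqP.
Qed.

Definition harmonic N p : Prop := euler p = N%:R *: p /\ laplace p = 0.

Lemma harmonic_submodule N : submodule rot_field (harmonic N).
Proof.
have L0 : laplace 0 = 0 by rewrite -(scale0r (0 : P)) laplaceZ !scale0r.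
split.
- by split=> //; rewrite -(scale0r (0 : P)) eulerZ !scale0r scaler0.
- move=> u v [eu lu] [ev lv]; split; first by rewrite eulerD eu ev scalerDr.
  by rewrite laplaceD lu lv addr0.
- move=> t u [eu lu]; split; rewrite ?eulerZ ?laplaceZ ?eu ?lu ?scaler0 //.
  by rewrite !scalerA mulrC.
- move=> i j u [eu lu]; split; first by rewrite euler_rot_field eu rot_fieldZ.
  by rewrite laplace_rot_field lu /rot_field !mderiv0 !mulr0 subr0.
Qed.

Lemma harmonic_finite_dim N : finite_dim (harmonic N).
Proof.
exists #|{: 'X_{1..D < N.+1}}|,
  (fun p => \row_(i < #|{: 'X_{1..D < N.+1}}|) p@_(enum_val i : 'X_{1..D < N.+1})); split.
- by move=> x y; apply/rowP => i; rewrite !mxE mcoeffD.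
- by move=> t x; apply/rowP => i; rewrite !mxE mcoeffZ.
- move=> p [/eqP]; rewrite -homog_euler => hp _ p0; apply/mpolyP => m; rewrite mcoeff0.
  have [mN|mN] := eqVneq (mdeg m) N; last exact: (dhomog_nemf_coeff hp).
  have mlt : (mdeg m < N.+1)%N by rewrite mN.
  by move/rowP/(_ (enum_rank (BMultinom mlt))): p0; rewrite !mxE enum_rankK.
Qed.

End RotationFields.

(** Among the matrices whose row space lies in [P], one of maximal rank works: adjoining a row [v]
    in [P] cannot raise the rank, so [v] was already in the row space. *)
Lemma subspace_rowspace (F : fieldType) n (P : 'rV[F]_n -> Prop) : P 0 ->
  (forall u v, P u -> P v -> P (u + v)) -> (forall t u, P u -> P (t *: u)) ->
  exists A : 'M[F]_n, forall v, P v <-> (v <= A)%MS.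
Proof.
move=> P0 PD PZ.
pose good (r : nat) := `[< exists2 A : 'M[F]_n, \rank A = r & forall v, (v <= A)%MS -> P v >].
have ex : exists r, good r.
  exists 0%N; apply/asboolP; exists 0; first exact: mxrank0.
  by move=> v; rewrite submx0 => /eqP ->.
have bd r : good r -> (r <= n)%N by move=> /asboolP[A <- _]; exact: rank_leq_row.
case: (ex_maxnP ex bd) => r /asboolP[A rA AP] rmax.
exists A => v; split=> [Pv|]; last exact: AP.
have le : (\rank (A + v)%MS <= \rank A)%N.
  rewrite rA; apply: rmax; apply/asboolP; exists (A + v)%MS => // u.
  case/sub_addsmxP => -[x y] /= ->; apply: PD; first by apply: AP; exact: submxMl.
  by rewrite [y]mx11_scalar mul_scalar_mx; apply: PZ.
have sA : (A <= A + v)%MS := addsmxSl A v.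
have /eqmxP eA : (A == A + v)%MS.
  rewrite sA /=; have := mxrank_leqif_sup sA => /leqifP.
  by case: ifP => // _; rewrite ltnNge le.
by rewrite eA addsmxSr.
Qed.

(** * Orthogonality for the Fischer product *)

Section Fischer.
Variables (C : numClosedFieldType) (D : nat).
Local Notation P := {mpoly C[D]}.
Implicit Types (p q r : P) (i j : 'I_D) (m : 'X_{1..D}).

Definition mfact m : nat := \prod_i (m i)`!.

Lemma mfactS m i : mfact (m + U_(i)) = ((m i).+1 * mfact m)%N.
Proof.
rewrite /mfact (bigD1 i) //= [in RHS](bigD1 i) //= mulnA -factS.
congr (_ * _)%N; first by rewrite mnmDE mnm1E eqxx addn1.
by apply: eq_bigr => j ji; rewrite mnmDE mnm1E eq_sym (negbTE ji) addn0.
Qed.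

Lemma mfact_gt0 m : (0 < mfact m)%N.
Proof. by apply: prodn_gt0 => i; apply: fact_gt0. Qed.

(* The Fischer product, for which ['X_i] is adjoint to [mderiv i], truncated
   to degrees below [K]. *)
Definition fischer (K : nat) p q : C :=
  \sum_(m : 'X_{1..D < K}) p@_m * (q@_m)^* * (mfact m)%:R.

Lemma fischerDl K p q r : fischer K (p + q) r = fischer K p r + fischer K q r.
Proof.
by rewrite -big_split; apply: eq_bigr => m _ /=; rewrite mcoeffD !mulrDl.
Qed.

Lemma fischerZl K t p r : fischer K (t *: p) r = t * fischer K p r.
Proof.
by rewrite mulr_sumr; apply: eq_bigr => m _ /=; rewrite mcoeffZ !mulrA.
Qed.

Lemma fischerBl K p q r : fischer K (p - q) r = fischer K p r - fischer K q r.
Proof. by rewrite fischerDl -scaleN1r fischerZl mulN1r. Qed.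

Lemma fischer_conj K p q : (fischer K p q)^* = fischer K q p.
Proof.
rewrite rmorph_sum; apply: eq_bigr => m _ /=.
by rewrite !rmorphM /= conjCK rmorph_nat [_^* * _]mulrC.
Qed.

Lemma fischerBr K p q r : fischer K r (p - q) = fischer K r p - fischer K r q.
Proof. by rewrite -fischer_conj fischerBl rmorphB /= !fischer_conj. Qed.

(** On monomials this is [mfactS]: [(m i).+1] is both the ratio of the two factorials and the factor
    produced by derivation. The degree bound keeps ['X_i * p] below the truncation. *)
Lemma fischer_var_adj K i p q : (forall m, m \in msupp p -> (mdeg m).+1 < K)%N ->
  fischer K ('X_i * p) q = fischer K p q^`M(i).
Proof.
have mono a : (mdeg a < K)%N -> forall s, fischer K 'X_[a] s = (s@_a)^* * (mfact a)%:R.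
  move=> aK s; rewrite /fischer (bigD1 (BMultinom aK)) //= mcoeffX eqxx mul1r.
  rewrite big1 ?addr0 // => m ma; rewrite mcoeffX.
  have -> : (a == m) = false by apply: contraNF ma => /eqP e; apply/eqP/val_inj.
  by rewrite !mul0r.
move=> pK; have -> : 'X_i * p = \sum_(m <- msupp p) p@_m *: 'X_[m + U_(i)].
  rewrite {1}[p]mpolyE mulr_sumr; apply: eq_bigr => m _.
  by rewrite -scalerAr -mpolyXD addmC.
rewrite {3}[p]mpolyE.
have sumE (F : 'X_{1..D} -> P) s : fischer K (\sum_(m <- msupp p) F m) s =
    \sum_(m <- msupp p) fischer K (F m) s.
  apply: (big_morph (fischer K ^~ s)) => [x y|]; first exact: fischerDl.
  by rewrite -(scale0r (0 : P)) fischerZl mul0r.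
rewrite !sumE big_seq [RHS]big_seq; apply: eq_bigr => m /pK mK.
rewrite !fischerZl !mono ?mdegD ?mdeg1 ?addn1 //; last exact: ltnW.
rewrite mfactS mcoeff_deriv rmorphMn /= -mulr_natr natrM; ring.
Qed.

Lemma msupp_mderiv_lt N i p : p \is N.-homog ->
  forall m, m \in msupp p^`M(i) -> ((mdeg m).+1 < N.+1)%N.
Proof.
move=> hp m; rewrite mcoeff_msupp mcoeff_deriv => nz.
have : (m + U_(i))%MM \in msupp p.
  by rewrite mcoeff_msupp; apply: contraNneq nz => ->; rewrite mul0rn.
by move/(dhomog_mf hp); rewrite /= mdegD mdeg1 addn1 => ->.
Qed.

(** The adjoint of [x_i d_j] is [x_j d_i], so the difference changes sign. Derivatives of an
    [N]-homogeneous polynomial have degree below [N], which leaves room for one more variable under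
    the truncation at [N.+1]. *)
Lemma fischer_rot_field N i j p q : p \is N.-homog -> q \is N.-homog ->
  fischer N.+1 (rot_field i j p) q = - fischer N.+1 p (rot_field i j q).
Proof.
move=> hp hq; rewrite /rot_field fischerBl fischerBr.
rewrite !fischer_var_adj; try exact: msupp_mderiv_lt.
rewrite -(fischer_conj _ ('X_i * _)) -(fischer_conj _ ('X_j * _)).
rewrite !fischer_var_adj; try exact: msupp_mderiv_lt.
by rewrite !fischer_conj opprB.
Qed.

Lemma fischer_eq0 N p : p \is N.-homog -> fischer N.+1 p p = 0 -> p = 0.
Proof.
move=> hp /eqP; rewrite psumr_eq0 => [/allP p0|m _]; last first.
  by rewrite mulr_ge0 ?ler0n // -normCK exprn_ge0.
apply/mpolyP => m; rewrite mcoeff0.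
have [mN|] := eqVneq (mdeg m) N; last exact: dhomog_nemf_coeff.
have mlt : (mdeg m < N.+1)%N by rewrite mN.
have /(_ (mem_index_enum _)) := p0 (BMultinom mlt); rewrite /= mulf_eq0 pnatr_eq0.
by rewrite (gtn_eqF (mfact_gt0 m)) orbF -normCK expf_eq0 normr_eq0 => /andP[_ /eqP].
Qed.

(** Scaling the coefficient at [m] by the square root of [mfact m] turns the Fischer product into
    the standard Hermitian form on rows, where every row space has an orthogonal complement. *)
Lemma fischer_proj N (Q : P -> Prop) p : Q 0 ->
  (forall u v, Q u -> Q v -> Q (u + v)) -> (forall t u, Q u -> Q (t *: u)) ->
  exists2 u, Q u & forall v, Q v -> fischer N.+1 (p - u) v = 0.
Proof.
move=> Q0 QD QZ; pose k := #|{: 'X_{1..D < N.+1}}|.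
pose mi (i : 'I_k) : 'X_{1..D < N.+1} := enum_val i.
pose f p := \row_(i < k) (p@_(mi i) * sqrtC (mfact (mi i))%:R).
have fD x y : f (x + y) = f x + f y.
  by apply/rowP => i; rewrite !mxE mcoeffD mulrDl.
have fZ t x : f (t *: x) = t *: f x by apply/rowP => i; rewrite !mxE mcoeffZ mulrA.
have fB x y : f (x - y) = f x - f y by rewrite fD -scaleN1r fZ scaleN1r.
have fdot x y : fischer N.+1 x y = (f x *m map_mx Num.conj (f y)^T) 0 0.
  rewrite mxE /fischer (reindex (@enum_val _ (mem {: 'X_{1..D < N.+1}}))) /=; last first.
    exact: (onW_bij _ (@enum_val_bij _)).
  apply: eq_bigr => i _; rewrite !mxE rmorphM /=.
  have -> : (sqrtC (mfact (mi i))%:R : C)^* = sqrtC (mfact (mi i))%:R.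
    by apply: conj_Creal; rewrite ger0_real // sqrtC_ge0 ler0n.
  rewrite mulrACA -expr2 sqrtCK //.
have [] := @subspace_rowspace C k (fun v => exists2 u, Q u & f u = v).
- by exists 0 => //; rewrite -(scale0r (0 : P)) fZ !scale0r.
- by move=> _ _ [u Qu <-] [v Qv <-]; exists (u + v); [exact: QD|exact: fD].
- by move=> t _ [u Qu <-]; exists (t *: u); [exact: QZ|exact: fZ].
move=> A PA.
have : (f p <= A + orthomx Num.Def.conjC (hermitian1mx k) A)%MS.
  by rewrite addsmx_ortho submx1.
case/sub_addsmxP => -[x y] /= fp.
have [|u Qu fu] := proj2 (PA (x *m A)); first exact: submxMl.
exists u => // v Qv; have /proj1 := PA (f v) => /(_ _)/submxP[|z fv]; first by exists v.
rewrite fdot fB fp fu addrAC subrr add0r fv trmx_mul map_mxM mulmxA -(mulmxA y).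
have := submx_refl (orthomx Num.Def.conjC (hermitian1mx k) A).
move/orthomx1P => ->.
by rewrite mulmx0 mul0mx mxE.
Qed.

End Fischer.

(** * Irreducibility of the harmonic polynomials *)

Section HarmonicIrreducible.
Variables (C : numClosedFieldType) (D : nat) (o0 o1 : 'I_D).
Hypothesis o01 : o0 != o1.
Local Notation P := {mpoly C[D]}.
Local Notation ii := (('i : C)%:MP : P).
Implicit Types (p q r : P) (i j a b : 'I_D).

Definition null_form : P := 'X_o0 + ii * 'X_o1.

Lemma ii2 : ii ^+ 2 = -1.
Proof. by rewrite -rmorphXn /= sqrCi rmorphN rmorph1. Qed.

Lemma iiZ p : 'i *: p = ii * p.
Proof. by rewrite mul_mpolyC. Qed.

Lemma mderiv_ii i : ii^`M(i) = 0.
Proof. exact: mderivC. Qed.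

Lemma mderiv_null a : null_form^`M(a) = kron C D (o0 == a) + ii * kron C D (o1 == a).
Proof. by rewrite /null_form !dE mderiv_ii; ring. Qed.

Lemma mderiv_null_exp a n :
  (null_form ^+ n)^`M(a) = n%:R * null_form ^+ n.-1 * null_form^`M(a).
Proof.
elim: n => [|n IH]; first by rewrite -mpolyC1 mderivC !mul0r.
rewrite exprS mderivM IH -natr1 /=; case: n {IH} => [|n] /=; first by ring.
by rewrite exprS; ring.
Qed.

Lemma null_form_neq0 : null_form != 0.
Proof.
apply/eqP => /(congr1 (fun p => p^`M(o0)@_0)).
rewrite mderiv_null eqxx (eq_sym o1) (negbTE o01) /kron mulr0 addr0 mderiv0 mcoeff0.
by rewrite mcoeff1 eqxx => /eqP; rewrite oner_eq0.
Qed.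

Lemma euler_null_exp n : euler (null_form ^+ n) = n%:R *: null_form ^+ n.
Proof.
have e1 : euler null_form = null_form.
  have ei : euler ii = 0 by rewrite /euler big1 // => k _; rewrite mderivC mulr0.
  by rewrite {1}/null_form eulerD eulerM !euler_var ei /null_form mul0r add0r.
elim: n => [|n IH].
  by rewrite scale0r /euler big1 // => k _; rewrite expr0 -mpolyC1 mderivC mulr0.
rewrite exprS eulerM e1 IH -scalerAr -exprS -natr1 scalerDl scale1r addrC.
by [].
Qed.

(** The Laplacian is [n (n - 1) null_form ^ (n - 2)] times the sum of the squared partial
    derivatives of [null_form], which is [1 + 'i ^ 2 = 0]. *)
Lemma laplace_null_exp n : laplace (null_form ^+ n) = 0.
Proof.
have z1 k : null_form^`M(k)^`M(k) = 0.
  by rewrite mderiv_null !dE mderiv_ii; ring.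
have z0 m k : (m%:R : P)^`M(k) = 0 by rewrite -mpolyC_nat mderivC.
have z2 k : null_form^`M(k) ^+ 2 = kron C D (k == o0) * 1 - kron C D (k == o1) * 1.
  rewrite mderiv_null (eq_sym o0) (eq_sym o1).
  have [->|_] := eqVneq k o0; first by rewrite (negbTE o01) /kron; ring.
  by case: eqP => _; rewrite /kron; ring: ii2.
(* For [n < 2] the truncated exponents are harmless, since the coefficient is 0. *)
pose c : P := n%:R * n.-1%:R * null_form ^+ n.-2.
have -> : laplace (null_form ^+ n) = \sum_k c * null_form^`M(k) ^+ 2.
  apply: eq_bigr => k _; rewrite mderiv_null_exp mderivM z1 mulr0 addr0.
  by rewrite mderivM z0 mul0r add0r mderiv_null_exp /c; ring.
rewrite -mulr_sumr; under eq_bigr do rewrite z2.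
by rewrite sumrB !(sum_kron (fun=> 1)) subrr mulr0.
Qed.

Lemma null_exp_harmonic n : harmonic n (null_form ^+ n).
Proof. by split; [apply: euler_null_exp|apply: laplace_null_exp]. Qed.

Lemma null_exp_highest n :
  highest_vector (@rot_field C D) o0 o1 n%:R (null_form ^+ n).
Proof.
have o10 : (o1 == o0) = false by rewrite eq_sym (negbTE o01).
split; first split.
- exact: expf_neq0 null_form_neq0.
- rewrite /cartan /rot_field !mderiv_null_exp !mderiv_null !eqxx o10 (negbTE o01) /kron.
  rewrite scaleNr iiZ -mul_mpolyC rmorph_nat.
  case: n => [|n]; first by rewrite !mul0r; ring.
  rewrite /= exprS; move: (null_form ^+ n) => w; rewrite /null_form; ring: ii2.
- move=> a a0 a1; rewrite /raising /rot_field !mderiv_null_exp !mderiv_null iiZ.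
  rewrite !eqxx o10 (negbTE o01) (eq_sym o0) (eq_sym o1) (negbTE a0) (negbTE a1) /kron.
  ring: ii2.
- move=> a b a0 a1 b0 b1; rewrite /rot_field !mderiv_null_exp !mderiv_null.
  rewrite !(eq_sym o0) !(eq_sym o1) (negbTE a0) (negbTE a1) (negbTE b0) (negbTE b1) /kron.
  by ring.
Qed.

Lemma mderiv_eq0_const p : (forall i, p^`M(i) = 0) -> exists c : C, p = c%:MP.
Proof.
move=> dp; exists p@_0; apply/mpolyP => m; rewrite mcoeffC.
have ep : euler p = 0 by rewrite /euler big1 // => k _; rewrite dp mulr0.
have := congr1 (fun q => q@_m) ep; rewrite mcoeff_euler mcoeff0 => /eqP.
have [->|m0] := eqVneq m 0%MM; first by rewrite mulr1.
by rewrite mulf_eq0 pnatr_eq0 mdeg_eq0 (negbTE m0) mulr0 => /eqP.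
Qed.

(** The hypotheses say that [p] is a function of [null_form] alone, of degree [n] in it. They pass
    to the derivative in [o0] with [n] lowered by one, and the last of them recovers [p] from that
    derivative. *)
Lemma null_exp_unique n p : (forall a, a != o0 -> a != o1 -> p^`M(a) = 0) ->
  p^`M(o1) = ii * p^`M(o0) -> null_form * p^`M(o0) = n%:R * p ->
  exists c : C, p = c *: null_form ^+ n.
Proof.
elim: n p => [|n IH] p pa p1 p0.
  have d0 : p^`M(o0) = 0.
    by move/eqP: p0; rewrite mul0r mulf_eq0 (negbTE null_form_neq0) => /eqP.
  have [|c ->] := @mderiv_eq0_const p; last by exists c; rewrite expr0 -mul_mpolyC mulr1.
  move=> i; have [->//|i0] := eqVneq i o0.
  have [->|i1] := eqVneq i o1; last exact: pa.
  by rewrite p1 d0 mulr0.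
have d00 : null_form^`M(o0) = 1.
  by rewrite mderiv_null eqxx (eq_sym o1) (negbTE o01) /kron; ring.
have zn m k : (m%:R : P)^`M(k) = 0 by rewrite -mpolyC_nat mderivC.
have [a a0 a1||| c pc] := IH p^`M(o0).
- by rewrite mderiv_comm pa // mderiv0.
- by rewrite mderiv_comm p1 mderivM mderiv_ii mul0r add0r.
- have := congr1 (mderiv o0) p0; rewrite !mderivM d00 zn -natr1 mul0r add0r mul1r => e.
  by apply: (addrI p^`M(o0)); rewrite e; ring.
exists (n.+1%:R^-1 * c); have n0 : n.+1%:R != 0 :> C by rewrite pnatr_eq0.
apply: (scalerI n0); rewrite !scalerA mulrA divff // mul1r exprS.
by rewrite -mul_mpolyC rmorph_nat -p0 pc -scalerAr.
Qed.

(** With [q = d_0 p + 'i d_1 p], the raising conditions read [null_form * d_a p = x_a q].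
    Differentiating in [a], summing over [a] and using [laplace p = 0] gives
    [- H q - euler q = (D - 2) q]. As [q] has degree [N - 1] and weight [mu + 1], this is
    [(N + mu + D - 2) q = 0]. So [q = 0], [p] involves only the coordinates [o0] and [o1], and
    [null_exp_unique] concludes. *)
Lemma harmonic_top N p (mu : C) : 0 <= mu -> (2 < D)%N -> harmonic N p ->
  top_vector (@rot_field C D) o0 o1 mu p -> exists c : C, p = c *: null_form ^+ N.
Proof.
move=> mu0 D2 [ep lp] [_ Hp Ep].
have o10 : (o1 == o0) = false by rewrite eq_sym (negbTE o01).
set q := p^`M(o0) + ii * p^`M(o1).
have E1 a : a != o0 -> a != o1 -> null_form * p^`M(a) = 'X_a * q.
  move=> a0 a1; apply/eqP; rewrite -subr_eq0; apply/eqP.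
  by rewrite -[RHS](Ep a a0 a1) /raising /rot_field iiZ /q /null_form; ring.
have E2 a : a != o0 -> a != o1 -> null_form * p^`M(a)^`M(a) - 'X_a * q^`M(a) = q.
  move=> a0 a1; have := congr1 (mderiv a) (E1 a a0 a1); rewrite !mderivM mderiv_null.
  rewrite (eq_sym o0) (eq_sym o1) (negbTE a0) (negbTE a1) mderiv_var eqxx /kron => e.
  apply/eqP; rewrite subr_eq; apply/eqP; move: e; rewrite mul1r => <-; ring.
have splitD (F : 'I_D -> P) :
    \sum_k F k = F o0 + F o1 + \sum_(k | (k != o0) && (k != o1)) F k.
  by rewrite (bigD1 o0) //= (bigD1 o1) ?o10 //= addrA.
have S : null_form * (- p^`M(o0)^`M(o0) - p^`M(o1)^`M(o1)) -
    (euler q - 'X_o0 * q^`M(o0) - 'X_o1 * q^`M(o1)) = (D - 2)%:R * q.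
  have -> : - p^`M(o0)^`M(o0) - p^`M(o1)^`M(o1) =
      \sum_(k | (k != o0) && (k != o1)) p^`M(k)^`M(k).
    move: lp; rewrite /laplace splitD => /eqP; rewrite addrC addr_eq0 => /eqP ->.
    by rewrite opprD.
  have -> : euler q - 'X_o0 * q^`M(o0) - 'X_o1 * q^`M(o1) =
      \sum_(k | (k != o0) && (k != o1)) 'X_k * q^`M(k).
    by rewrite /euler splitD; ring.
  rewrite mulr_sumr -sumrB (eq_bigr (fun=> q)); last first.
    by move=> k /andP[k0 k1]; apply: E2.
  rewrite sumr_const mulr_natl; congr (_ *+ _).
  have -> : #|[pred k | (k != o0) && (k != o1)]| = #|~: [set o0; o1]|.
    by apply: eq_card => k; rewrite !inE negb_or.
  by rewrite cardsCs finset.setCK cards2 card_ord o01.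
have eq_ : euler q + q = N%:R * q.
  have e k : p^`M(k) + euler p^`M(k) = N%:R * p^`M(k).
    by rewrite -mderiv_euler ep mderivZ -mul_mpolyC rmorph_nat.
  have ei : euler ii = 0 by rewrite /euler big1 // => k _; rewrite mderivC mulr0.
  rewrite /q eulerD eulerM ei mul0r add0r.
  have -> : euler p^`M(o0) = N%:R * p^`M(o0) - p^`M(o0) by rewrite -e; ring.
  have -> : euler p^`M(o1) = N%:R * p^`M(o1) - p^`M(o1) by rewrite -e; ring.
  by ring.
have Hq : - ii * ('X_o0 * q^`M(o1) - 'X_o1 * q^`M(o0)) = (mu%:MP + 1) * q.
  have h : - ii * ('X_o0 * p^`M(o1) - 'X_o1 * p^`M(o0)) = mu%:MP * p.
    by rewrite mul_mpolyC -Hp /cartan /rot_field scaleNr iiZ mulNr.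
  have h0 := congr1 (mderiv o0) h; have h1 := congr1 (mderiv o1) h.
  move: h0 h1; rewrite -mpolyCN !dE !mderivC !eqxx o10 (negbTE o01) /kron mpolyCN.
  rewrite ?(mderiv_comm o1 o0) => h0 h1.
  (* The weight equation of [q] is the derivative of [h] in [o0] plus [ii] times its derivative in
     [o1]. *)
  have comb (l0 r0 l1 r1 l r : P) : l0 = r0 -> l1 = r1 ->
      l - r = (l0 - r0) + ii * (l1 - r1) -> l = r.
    by move=> -> ->; rewrite !subrr mulr0 addr0 => /eqP; rewrite subr_eq0 => /eqP.
  by apply: (comb _ _ _ _ _ _ h0 h1); rewrite /q; ring: ii2.
have q0 : q = 0.
  have K0 : N%:R + mu + (D - 2)%:R != 0 :> C.
    rewrite gt_eqF // ltr_wpDl ?addr_ge0 ?ler0n // ltr0n subn_gt0 //.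
  have : (N%:R + mu + (D - 2)%:R)%:MP * q = 0.
    rewrite !rmorphD /= !rmorph_nat !mulrDl -S.
    have -> : mu%:MP * q = - ii * ('X_o0 * q^`M(o1) - 'X_o1 * q^`M(o0)) - q.
      by rewrite Hq; ring.
    rewrite -eq_ /q /null_form !dE !mderiv_ii (mderiv_comm o1 o0).
    ring: ii2.
  by move/eqP; rewrite mul_mpolyC scaler_eq0 (negbTE K0) => /eqP.
have pa a : a != o0 -> a != o1 -> p^`M(a) = 0.
  move=> a0 a1; move/eqP: (E1 a a0 a1); rewrite q0 mulr0 mulf_eq0.
  by rewrite (negbTE null_form_neq0) => /eqP.
have p1 : p^`M(o1) = ii * p^`M(o0).
  have -> : p^`M(o0) = q - ii * p^`M(o1) by rewrite /q; ring.
  rewrite q0; ring: ii2.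
apply: null_exp_unique => //.
rewrite -mpolyC_nat mul_mpolyC -ep /euler splitD big1 => [|k /andP[k0 k1]].
  by rewrite p1 /null_form; ring.
by rewrite pa // mulr0.
Qed.

(** A top vector exists in [Q], its weight is nonnegative because [2 mu] is natural, and
    [harmonic_top] identifies it. *)
Lemma harmonic_has_null_exp N (Q : P -> Prop) : (2 < D)%N ->
  submodule (@rot_field C D) Q -> (forall p, Q p -> harmonic N p) ->
  (exists2 p, Q p & p != 0) -> Q (null_form ^+ N).
Proof.
move=> D2 QX QH [p Qp p0]; have XM := rot_field_so_module C D.
have Qfin : finite_dim Q.
  have [n [f [fD fZ finj]]] := harmonic_finite_dim C D N.
  by exists n, f; split=> // x /QH; apply: finj.
have [mu [w [Qw wtop]]] := top_vector_exists XM o01 QX Qfin Qp p0.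
have [a /andP[a0 a1]] : exists a, (a != o0) && (a != o1).
  apply/existsP; rewrite -[X in is_true X]negbK negb_exists; apply/negP => /forallP H.
  have : (#|[set o0; o1]| < #|'I_D|)%N by rewrite cards2 o01 card_ord.
  rewrite ltnNge => /negP; apply; apply/subset_leq_card/fintype.subsetP => k _.
  by have := H k; rewrite !inE negb_and !negbK.
have [n mun] := top_weight_half_nat XM o01 QX Qfin Qw wtop a0 a1.
have mu0 : 0 <= mu by rewrite -(@pmulr_rge0 _ 2) ?ltr0n // mun ler0n.
have [c wE] := harmonic_top mu0 D2 (QH _ Qw) wtop.
have c0 : c != 0.
  by apply/eqP => c0; case: wtop => + _ _; rewrite wE c0 scale0r eqxx.
by have := subZ QX c^-1 Qw; rewrite wE scalerA mulVf // scale1r.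
Qed.

(** If a harmonic [p] were outside [Q], the orthogonal of [Q] among the harmonics would be a nonzero
    submodule, because [rot_field] is skew-adjoint. It would contain [null_form ^+ N], as [Q] does,
    and this power would be orthogonal to itself. *)
Theorem harmonic_irreducible N : (2 < D)%N ->
  irreducible_submodule (@rot_field C D) (harmonic N).
Proof.
move=> D2 Q QX QH Qnz p hp.
have Qz := harmonic_has_null_exp D2 QX QH Qnz.
have hom q : harmonic N q -> q \is N.-homog by case=> /eqP; rewrite homog_euler.
have HX := @harmonic_submodule C D N.
have [u Qu uorth] := fischer_proj N p (sub0 QX) (subD QX) (subZ QX).
have [e|pu] := eqVneq (p - u) 0; first by move/eqP: e; rewrite subr_eq0 => /eqP ->.
pose S r := harmonic N r /\ forall v, Q v -> fischer N.+1 r v = 0.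
have : S (null_form ^+ N).
  apply: (@harmonic_has_null_exp N S) => //.
  - split.
    + split=> [|v _]; first exact: (sub0 HX).
      by rewrite /fischer big1 // => m _; rewrite mcoeff0 !mul0r.
    + move=> x y [hx xo] [hy yo]; split=> [|v Qv]; first exact: (subD HX).
      by rewrite fischerDl xo // yo // addr0.
    + move=> t x [hx xo]; split=> [|v Qv]; first exact: (subZ HX).
      by rewrite fischerZl xo // mulr0.
    + move=> i j x [hx xo]; split=> [|v Qv]; first exact: (subX HX).
      rewrite fischer_rot_field ?hom //; last exact: QH.
      by rewrite xo ?oppr0 //; apply: (subX QX).
  - by move=> r [].
  - by exists (p - u) => //; split=> //; apply: (submoduleB HX hp (QH _ Qu)).
case=> _ /(_ _ Qz) z0; have := fischer_eq0 (hom _ (null_exp_harmonic N)) z0.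
by move/eqP; rewrite expf_eq0 (negbTE null_form_neq0) andbF.
Qed.

End HarmonicIrreducible.

(** * Derivatives of matrix-valued functions *)

Section RealDerivative.
Variable R : realType.
Implicit Types (f g : R -> R) (a l k t : R).

(** The difference quotient is cleared and [h = 0] is allowed, so estimates can be combined without
    dividing. *)
Lemma is_derive_eps f a l : is_derive a (1 : R) f l <->
  forall e, 0 < e -> exists2 d, 0 < d & forall h, `|h| < d ->
    `|f (a + h) - f a - h * l| <= e * `|h|.
Proof.
split=> [[df dl] e e0|H].
  have : ((fun h => h^-1 *: ((f \o shift a) (h *: 1) - f a)) @ 0^' --> l)%classic.
    by rewrite -dl; exact: df.
  move=> /cvgrPdist_le/(_ e e0); rewrite /dnbhs /within /= => /nbhs_ballP[d /= d0 dP].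
  exists d => // h hd; have [->|h0] := eqVneq h 0.
    by rewrite addr0 mul0r subrr subr0 normr0 mulr0.
  have := dP h; rewrite /ball /= sub0r normrN => /(_ hd h0).
  rewrite /GRing.scale /= mulr1 [h + a]addrC => le.
  have -> : f (a + h) - f a - h * l = - (h * (l - h^-1 * (f (a + h) - f a))).
    by field.
  by rewrite normrN normrM mulrC ler_wpM2r.
have cv : ((fun h => h^-1 *: ((f \o shift a) (h *: 1) - f a)) @ 0^' --> l)%classic.
  apply/cvgrPdist_le => e /H[d d0 dP]; rewrite /dnbhs /within /=.
  apply/nbhs_ballP; exists d => //= h; rewrite /ball /= sub0r normrN => hd h0.
  rewrite /GRing.scale /= mulr1 [h + a]addrC.
  have -> : l - h^-1 * (f (a + h) - f a) = - (h^-1 * (f (a + h) - f a - h * l)).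
    by field.
  rewrite normrN normrM normfV mulrC ler_pdivrMr ?normr_gt0 //; exact: dP.
split; last exact: cvg_lim cv.
by apply/cvg_ex; exists l.
Qed.

(** A local version, because the antiderivatives used later are controlled only near 0. *)
Lemma derive0_cst_near f (r : R) :
  (forall x, `|x| < r -> is_derive x (1 : R) f 0) -> forall s, `|s| < r -> f s = f 0.
Proof.
move=> df s sr.
have seg x y : x <= y -> `|x| < r -> `|y| < r -> f y = f x.
  move=> xy xr yr.
  have inr z : x <= z <= y -> `|z| < r.
    case/andP=> xz zy; move: xr yr; rewrite !ltr_norml => /andP[x1 x2] /andP[y1 y2].
    by rewrite (lt_le_trans x1 xz) (le_lt_trans zy y2).
  have [] := @MVT_segment R f (fun=> 0) x y xy.
  - by move=> z; rewrite in_itv /= => /andP[xz zy]; apply/df/inr; rewrite !ltW.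
  - apply: derivable_within_continuous => z; rewrite in_itv /= => zxy.
    by case: (df z (inr z zxy)).
  - by move=> c _; rewrite mul0r => /eqP; rewrite subr_eq0 => /eqP.
have r0 : `|0 : R| < r by rewrite normr0; apply: le_lt_trans sr.
by have [s0|/ltW s0] := leP 0 s; [apply: seg|rewrite [RHS](seg s 0)].
Qed.

Lemma antiderivative_near f : continuous f ->
  exists F : R -> R, forall x, `|x| < 1 -> is_derive x (1 : R) F (f x).
Proof.
move=> cf; exists (fun x => \int[lebesgue_measure]_(t in `[-1, x]) f t)%R => x.
rewrite ltr_norml => /andP[x1 x2].
have cw : {within `[-1, 1], continuous f}%classic by apply: continuous_subspaceT.
have intf := continuous_compact_integrable (@segment_compact R (-1) 1) cw.
have [dF eF] := continuous_FTC1_closed x2 intf x1 (cf x).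
by split; [exact: dF|rewrite -derive1E; exact: eF].
Qed.

Lemma derive_le0_le f (f' : R -> R) : (forall x, is_derive x (1 : R) f (f' x)) ->
  (forall x, f' x <= 0) -> forall t, 0 <= t -> f t <= f 0.
Proof.
move=> df f'0 t t0.
have cf : {within `[0, t], continuous f}%classic.
  by apply: derivable_within_continuous => z zt; case: (df z).
have [c _ e] := MVT_segment t0 (fun z _ => df z) cf.
by rewrite -subr_le0 e subr0 mulr_le0_ge0.
Qed.

Lemma is_derive_ext f g a l : f =1 g -> is_derive a (1 : R) f l -> is_derive a (1 : R) g l.
Proof. by move=> /funext ->. Qed.

Lemma is_derive_uniq f a l k : is_derive a (1 : R) f l -> is_derive a (1 : R) f k -> l = k.
Proof. by move=> [_ <-] [_ <-]. Qed.

Lemma is_derive_add f g a l k : is_derive a (1 : R) f l -> is_derive a (1 : R) g k ->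
  is_derive a (1 : R) (fun t => f t + g t) (l + k).
Proof. exact: is_deriveD. Qed.

Lemma is_derive_mul f g a l k : is_derive a (1 : R) f l -> is_derive a (1 : R) g k ->
  is_derive a (1 : R) (fun t => f t * g t) (l * g a + f a * k).
Proof.
move=> df dg; apply: (is_derive_eq (is_deriveM df dg)).
by rewrite /GRing.scale /= addrC mulrC.
Qed.

Lemma is_derive_bigsum (I : finType) (h : I -> R -> R) (dh : I -> R) a :
  (forall i, is_derive a (1 : R) (h i) (dh i)) ->
  is_derive a (1 : R) (fun t => \sum_i h i t) (\sum_i dh i).
Proof.
move=> dhi; elim: (index_enum I) => [|i s IH].
  apply: (@is_derive_ext (fun=> 0)); first by move=> t; rewrite big_nil.
  by rewrite big_nil; apply: is_derive_cst.
apply: (@is_derive_ext (fun t => h i t + \sum_(j <- s) h j t)).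
  by move=> t; rewrite big_cons.
by rewrite big_cons; apply: is_derive_add.
Qed.

Lemma is_derive_affine f a c b l : is_derive (c * a + b) (1 : R) f l ->
  is_derive a (1 : R) (fun t => f (c * t + b)) (c * l).
Proof.
move=> df; rewrite mulrC.
apply: (@is_derive1_comp _ f (fun t => c * t + b)) => //.
have d1 : is_derive a (1 : R) (fun t => c * t) (0 * a + c * 1).
  by apply: (@is_derive_mul (fun=> c) id).
have d2 : is_derive a (1 : R) (fun=> b) 0 by apply: is_derive_cst.
by apply: (is_derive_eq (is_derive_add d1 d2)); rewrite mul0r add0r mulr1 addr0.
Qed.

End RealDerivative.

Section MatrixDerivative.
Variable R : realType.

Definition mderivable_to m n (F : R -> 'M[R]_(m, n)) (a : R) (L : 'M[R]_(m, n)) : Prop :=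
  forall i j, is_derive a (1 : R) (fun t => F t i j) (L i j).

Local Notation mder := mderivable_to.

(** This norm dominates each entry and is submultiplicative with constant 1, which keeps all
    estimates elementary. *)
Definition mxl1 m n (A : 'M[R]_(m, n)) : R := \sum_i \sum_j `|A i j|.

Lemma mder_mul m n p (F : R -> 'M[R]_(m, n)) (G : R -> 'M[R]_(n, p)) a L K :
  mder F a L -> mder G a K -> mder (fun t => F t *m G t) a (L *m G a + F a *m K).
Proof.
move=> dF dG i j.
apply: (@is_derive_ext _ (fun t => \sum_k F t i k * G t k j)).
  by move=> t; rewrite mxE.
rewrite !mxE -big_split /=.
by apply: is_derive_bigsum => k; apply: is_derive_mul.
Qed.

Lemma mder_cst m n (A : 'M[R]_(m, n)) a : mder (fun=> A) a 0.
Proof. by move=> i j; rewrite mxE; apply: is_derive_cst. Qed.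

Lemma mder_add m n (F G : R -> 'M[R]_(m, n)) a L K :
  mder F a L -> mder G a K -> mder (fun t => F t + G t) a (L + K).
Proof.
move=> dF dG i j; rewrite mxE.
apply: (@is_derive_ext _ (fun t => F t i j + G t i j)); first by move=> t; rewrite mxE.
exact: is_derive_add.
Qed.

Lemma mder_opp m n (F : R -> 'M[R]_(m, n)) a L : mder F a L -> mder (fun t => - F t) a (- L).
Proof.
move=> dF i j; rewrite mxE.
apply: (@is_derive_ext _ (fun t => - F t i j)); first by move=> t; rewrite mxE.
exact: is_deriveN.
Qed.

Lemma mder_ext m n (F G : R -> 'M[R]_(m, n)) a L : F =1 G -> mder F a L -> mder G a L.
Proof. by move=> /funext ->. Qed.

Lemma mder_uniq m n (F : R -> 'M[R]_(m, n)) a L K : mder F a L -> mder F a K -> L = K.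
Proof. by move=> dL dK; apply/matrixP => i j; apply: is_derive_uniq (dL i j) (dK i j). Qed.

Lemma mder_affine m n (F : R -> 'M[R]_(m, n)) a c b L :
  mder F (c * a + b) L -> mder (fun t => F (c * t + b)) a (c *: L).
Proof.
by move=> dF i j; rewrite mxE; apply: (@is_derive_affine _ (fun t => F t i j)).
Qed.

Lemma mder_scale m n (f : R -> R) (A : 'M[R]_(m, n)) a l :
  is_derive a (1 : R) f l -> mder (fun t => f t *: A) a (l *: A).
Proof.
move=> df i j; apply: (@is_derive_ext _ (fun t => f t * A i j)).
  by move=> t; rewrite mxE.
have dA : is_derive a (1 : R) (fun=> A i j) 0 by apply: is_derive_cst.
by apply: (is_derive_eq (is_derive_mul df dA)); rewrite mulr0 addr0 mxE.
Qed.

Lemma mxl1_ge0 m n (A : 'M[R]_(m, n)) : 0 <= mxl1 A.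
Proof. by apply: sumr_ge0 => i _; apply: sumr_ge0. Qed.

Lemma mxl1_entry m n (A : 'M[R]_(m, n)) i j : `|A i j| <= mxl1 A.
Proof.
rewrite /mxl1 (bigD1 i) //= (bigD1 j) //= -addrA lerDl addr_ge0 //.
  exact: sumr_ge0.
by apply: sumr_ge0 => k _; apply: sumr_ge0.
Qed.

Lemma mxl1_bound m n (A : 'M[R]_(m, n)) c : (forall i j, `|A i j| <= c) ->
  mxl1 A <= (m * n)%:R * c.
Proof.
move=> Ac; apply: (@le_trans _ _ (\sum_(i < m) \sum_(j < n) c)).
  by apply: ler_sum => i _; apply: ler_sum.
by rewrite !sumr_const !card_ord -mulrnA mulnC mulr_natl.
Qed.

Lemma mxl1D m n (A B : 'M[R]_(m, n)) : mxl1 (A + B) <= mxl1 A + mxl1 B.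
Proof.
rewrite /mxl1 -big_split /=; apply: ler_sum => i _.
rewrite -big_split /=; apply: ler_sum => j _.
by rewrite mxE ler_normD.
Qed.

Lemma mxl1N m n (A : 'M[R]_(m, n)) : mxl1 (- A) = mxl1 A.
Proof. by apply: eq_bigr => i _; apply: eq_bigr => j _; rewrite mxE normrN. Qed.

Lemma mxl1B m n (A B : 'M[R]_(m, n)) : mxl1 (A - B) <= mxl1 A + mxl1 B.
Proof. by rewrite -(mxl1N B); apply: mxl1D. Qed.

Lemma mxl1Z m n (t : R) (A : 'M[R]_(m, n)) : mxl1 (t *: A) = `|t| * mxl1 A.
Proof.
rewrite mulr_sumr; apply: eq_bigr => i _; rewrite mulr_sumr; apply: eq_bigr => j _.
by rewrite mxE normrM.
Qed.

Lemma mxl10 m n : mxl1 (0 : 'M[R]_(m, n)) = 0.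
Proof. by rewrite -(scale0r 0) mxl1Z normr0 mul0r. Qed.

Lemma mxl1M m n p (A : 'M[R]_(m, n)) (B : 'M[R]_(n, p)) :
  mxl1 (A *m B) <= mxl1 A * mxl1 B.
Proof.
rewrite {1 2}/mxl1 mulr_suml; apply: ler_sum => i _.
apply: (@le_trans _ _ (\sum_j \sum_k `|A i k| * `|B k j|)).
  apply: ler_sum => j _; rewrite mxE; apply: le_trans (ler_norm_sum _ _ _) _.
  by apply: ler_sum => k _; rewrite normrM.
rewrite exchange_big mulr_suml /=; apply: ler_sum => k _.
rewrite -mulr_sumr; apply: ler_wpM2l => //.
rewrite /mxl1 [leRHS](bigD1 k) //= lerDl.
by apply: sumr_ge0 => l _; apply: sumr_ge0.
Qed.

Lemma mxl1_sum m n (I : finType) (F : I -> 'M[R]_(m, n)) :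
  mxl1 (\sum_i F i) <= \sum_i mxl1 (F i).
Proof.
apply: (big_ind2 (fun A c => mxl1 A <= c)) => [|A a B b ha hb|//].
  by rewrite mxl10.
by apply: le_trans (mxl1D _ _) _; apply: lerD.
Qed.

Lemma mder_eps m n (F : R -> 'M[R]_(m, n)) a L : mder F a L <->
  forall e, 0 < e -> exists2 d, 0 < d & forall h, `|h| < d ->
    mxl1 (F (a + h) - F a - h *: L) <= e * `|h|.
Proof.
split=> [dF e e0|H i j].
  (* The successor keeps the divisor positive for empty matrices. *)
  have c0 : 0 < (m * n).+1%:R :> R by rewrite ltr0n.
  have ec0 : 0 < e / (m * n).+1%:R by rewrite divr_gt0.
  have dd (x : 'I_m * 'I_n) : exists d, 0 < d /\ forall h, `|h| < d ->
      `|F (a + h) x.1 x.2 - F a x.1 x.2 - h * L x.1 x.2| <= e / (m * n).+1%:R * `|h|.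
    by have /is_derive_eps/(_ _ ec0)[d d0 dP] := dF x.1 x.2; exists d.
  have [d dP] := choice dd.
  exists (\big[Num.min/1]_x d x).
    by apply: (big_ind (fun z => 0 < z)) => [//|x y x0 y0|x _]; 
      [rewrite lt_min x0 y0|case: (dP x)].
  move=> h hd; apply: (@le_trans _ _ ((m * n)%:R * (e / (m * n).+1%:R * `|h|))).
    apply: mxl1_bound => i j; rewrite !mxE.
    apply: (dP (i, j)).2; apply: lt_le_trans hd _.
    by rewrite (bigD1 (i, j)) //= ge_min lexx.
  rewrite mulrA ler_wpM2r // mulrCA ler_piMr ?(ltW e0) //.
  by rewrite ler_pdivrMr // mul1r ler_nat.
apply/is_derive_eps => e /H[d d0 dP]; exists d => // h /dP; apply: le_trans.
by apply: le_trans (mxl1_entry _ i j); rewrite !mxE.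
Qed.

End MatrixDerivative.

(** * Rotations *)

Section Rotations.
Variables (R : realType) (D : nat).
Local Notation SO := (@Defs.SO R D).
Local Notation rot := (@Defs.rot R D).
Implicit Types (i j k l : 'I_D) (s t : R) (g h : 'M[R]_D).

Lemma SO1 : SO 1%:M.
Proof. by split; [rewrite trmx1 mulmx1|rewrite det1]. Qed.

Lemma SO_trK g : SO g -> g^T *m g = 1%:M.
Proof. by case=> gg _; apply: mulmx1C. Qed.

Lemma SO_mul g h : SO g -> SO h -> SO (g *m h).
Proof.
move=> [gg dg] [hh dh]; split; last by rewrite det_mulmx dg dh mulr1.
by rewrite trmx_mul mulmxA -(mulmxA g) hh mulmx1.
Qed.

Lemma SO_tr g : SO g -> SO g^T.
Proof. by move=> Sg; split; [rewrite trmxK SO_trK|rewrite det_tr; case: Sg]. Qed.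

Lemma SO_invmx g : SO g -> invmx g = g^T.
Proof.
move=> Sg; have [gg dg] := Sg.
have ug : g \in unitmx by rewrite unitmxE dg unitr1.
by rewrite -[LHS]mulmx1 -gg mulmxA mulVmx // mul1mx.
Qed.

Lemma SO_bound g : SO g -> mxl1 g <= (D * D)%:R.
Proof.
case=> gg _; rewrite -[leRHS]mulr1; apply: mxl1_bound => i j.
have := congr1 (fun A : 'M[R]_D => A i i) gg; rewrite !mxE eqxx => e.
rewrite -(@ler_pXn2r _ 2) ?nnegrE // expr1n -normrX ger0_norm ?sqr_ge0 // -[leRHS]e.
by rewrite (bigD1 j) //= mxE -expr2 lerDl sumr_ge0 // => k _; rewrite mxE -expr2 sqr_ge0.
Qed.

Definition gen i j : 'M[R]_D := delta_mx i j - delta_mx j i.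
(** The projection onto the [(i, j)]-plane, equal to [- gen i j *m gen i j]; it is 0 for [i = j] so
    that [rotE] also covers the constant rotation. *)
Definition plane i j : 'M[R]_D := if i == j then 0 else delta_mx i i + delta_mx j j.

Lemma gen_diag i : gen i i = 0.
Proof. exact: subrr. Qed.

Lemma gen_antisym i j : gen j i = - gen i j.
Proof. by rewrite /gen opprB. Qed.

Lemma rotE i j t : rot i j t = 1%:M + sin t *: gen i j + (cos t - 1) *: plane i j.
Proof.
apply/matrixP => a b; rewrite !mxE /gen /plane.
have [->|ij] := eqVneq i j; first by rewrite !mxE /=; ring.
rewrite !mxE; have [ai|ai] := eqVneq a i; have [bi|bi] := eqVneq b i;
  have [aj|aj] := eqVneq a j; have [bj|bj] := eqVneq b j;
  rewrite ?ai ?bi ?aj ?bj ?eqxx ?(negbTE ij) ?(eq_sym j) ?(negbTE ij) //=; 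
  try (by rewrite -ai -aj eqxx in ij); try (by rewrite -bi -bj eqxx in ij); 
  rewrite ?eqxx ?(negbTE ij) /=; try ring.
Qed.

Lemma delta_mul i j k l :
  delta_mx i j *m delta_mx k l = (j == k)%:R *: delta_mx i l :> 'M[R]_D.
Proof. by rewrite mul_delta_mx_cond; case: eqP => _; rewrite ?scale1r ?scale0r. Qed.

Local Ltac delta_simp :=
  rewrite /= ?(mulmxDl, mulmxDr, mulmxBl, mulmxBr, mulNmx, mulmxN, delta_mul).

Lemma gen_gen i j : gen i j *m gen i j = - plane i j.
Proof.
rewrite /plane; have [->|ij] := eqVneq i j; first by rewrite gen_diag mul0mx oppr0.
rewrite /gen; delta_simp; rewrite !eqxx [j == i]eq_sym (negbTE ij).
apply/matrixP => a b; rewrite !mxE /=; ring.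
Qed.

Lemma gen_plane i j : gen i j *m plane i j = gen i j.
Proof.
rewrite /plane; have [->|ij] := eqVneq i j; first by rewrite gen_diag mul0mx.
rewrite /gen; delta_simp; rewrite !eqxx [j == i]eq_sym (negbTE ij).
by apply/matrixP => a b; rewrite !mxE /=; ring.
Qed.

Lemma plane_gen i j : plane i j *m gen i j = gen i j.
Proof.
rewrite /plane; have [->|ij] := eqVneq i j; first by rewrite gen_diag mul0mx.
rewrite /gen; delta_simp; rewrite !eqxx [j == i]eq_sym (negbTE ij).
by apply/matrixP => a b; rewrite !mxE /=; ring.
Qed.

Lemma plane_plane i j : plane i j *m plane i j = plane i j.
Proof.
rewrite /plane; have [_|ij] := eqVneq i j; rewrite /= ?mul0mx //.
delta_simp; rewrite !eqxx [j == i]eq_sym (negbTE ij).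
by apply/matrixP => a b; rewrite !mxE /=; ring.
Qed.

Lemma rotD i j s t : rot i j (s + t) = rot i j s *m rot i j t.
Proof.
rewrite !rotE; set A := gen i j; set B := plane i j.
rewrite !(mulmxDl, mulmxDr) !mul1mx !mulmx1 -!scalemxAl -!scalemxAr.
rewrite gen_gen gen_plane plane_gen plane_plane -/A -/B sinD cosD.
by apply/matrixP => a b; rewrite !mxE /=; ring.
Qed.

Lemma rot0 i j : rot i j 0 = 1%:M.
Proof. by rewrite rotE sin0 cos0 subrr !scale0r !addr0. Qed.

Lemma rot_diag i t : rot i i t = 1%:M.
Proof. by rewrite rotE gen_diag /plane eqxx !scaler0 !addr0. Qed.

Lemma rot_antisym i j t : rot j i t = rot i j (- t).
Proof.
rewrite !rotE sinN cosN gen_antisym /plane eq_sym addrC scalerN scaleNr addrC.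
by rewrite [_ + delta_mx _ _]addrC.
Qed.

Lemma rot_tr i j t : (rot i j t)^T = rot i j (- t).
Proof.
have tA : (gen i j)^T = - gen i j.
  by rewrite /gen linearB /= !trmx_delta opprB.
have tB : (plane i j)^T = plane i j.
  by rewrite /plane; case: eqP => _; rewrite ?trmx0 // linearD /= !trmx_delta.
rewrite !rotE sinN cosN; move: (gen i j) (plane i j) tA tB => A B tA tB.
by rewrite !linearD !linearZ /= trmx1 tA tB scalerN scaleNr.
Qed.

(** [rot i j t] is the square of the orthogonal matrix [rot i j (t / 2)], so its determinant is
    1. *)
Lemma rot_SO i j t : SO (rot i j t).
Proof.
have o s : rot i j s *m (rot i j s)^T = 1%:M by rewrite rot_tr -rotD subrr rot0.
split=> //; have -> : t = t / 2 + t / 2 by rewrite -splitr.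
rewrite rotD det_mulmx; have := congr1 determinant (o (t / 2)).
by rewrite det_mulmx det_tr det1.
Qed.

Lemma rot_derive i j : mderivable_to (rot i j) 0 (gen i j).
Proof.
apply: (@mder_ext _ _ _ (fun t => 1%:M + sin t *: gen i j + (cos t - 1) *: plane i j)).
  by move=> t; rewrite rotE.
rewrite [X in mderivable_to _ _ X](_ : gen i j =
    0 + cos 0 *: gen i j + (- sin 0 + 0) *: plane i j); last first.
  by rewrite cos0 sin0 oppr0 addr0 scale0r scale1r add0r addr0.
apply: mder_add; first apply: mder_add.
- exact: mder_cst.
- by apply: mder_scale; apply: is_derive_sin.
- by apply: (@mder_scale _ _ _ (fun t => cos t - 1)); apply: (@is_derive_add _ cos (fun=> - 1)).
Qed.

Lemma rot_commute i j k l s t : i != k -> i != l -> j != k -> j != l ->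
  rot i j s *m rot k l t = rot k l t *m rot i j s.
Proof.
move=> ik il jk jl.
have AA : gen i j *m gen k l = 0 /\ gen k l *m gen i j = 0.
  rewrite /gen; split; delta_simp;
    by rewrite ?eqxx ?(eq_sym k) ?(eq_sym l) ?(negbTE ik, negbTE il, negbTE jk, negbTE jl)
       !scale0r ?(oppr0, subr0, addr0).
have AB : gen i j *m plane k l = 0 /\ plane k l *m gen i j = 0.
  rewrite /gen /plane; case: ifP => _; first by rewrite mulmx0 mul0mx.
  split; delta_simp;
    by rewrite ?eqxx ?(eq_sym k) ?(eq_sym l) ?(negbTE ik, negbTE il, negbTE jk, negbTE jl)
       !scale0r ?(oppr0, subr0, addr0).
have BA : plane i j *m gen k l = 0 /\ gen k l *m plane i j = 0.
  rewrite /gen /plane; case: ifP => _; first by rewrite mulmx0 mul0mx.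
  split; delta_simp;
    by rewrite ?eqxx ?(eq_sym k) ?(eq_sym l) ?(negbTE ik, negbTE il, negbTE jk, negbTE jl)
       !scale0r ?(oppr0, subr0, addr0).
have BB : plane i j *m plane k l = 0 /\ plane k l *m plane i j = 0.
  rewrite /plane; case: ifP => _; first by rewrite mulmx0 mul0mx.
  case: ifP => _; first by rewrite mulmx0 mul0mx.
  split; delta_simp;
    by rewrite ?eqxx ?(eq_sym k) ?(eq_sym l) ?(negbTE ik, negbTE il, negbTE jk, negbTE jl)
       !scale0r ?(oppr0, subr0, addr0).
case: AA AB BA BB => a1 a2 [b1 b2] [c1 c2] [d1 d2].
rewrite !rotE !(mulmxDl, mulmxDr) !mul1mx !mulmx1 -!scalemxAl -!scalemxAr.
rewrite a1 a2 b1 b2 c1 c2 d1 d2.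
by apply/matrixP => a b; rewrite !mxE /=; ring.
Qed.

Lemma gen_conj i j l s : i != j -> i != l -> j != l ->
  rot j l s *m gen i j *m rot j l (- s) = cos s *: gen i j - sin s *: gen i l.
Proof.
move=> ij il jl.
have e1 : gen j l *m gen i j = delta_mx l i.
  rewrite /gen; delta_simp.
  rewrite !eqxx !(eq_sym l) (eq_sym j i) (negbTE ij) (negbTE il) (negbTE jl).
  by apply/matrixP => a b; rewrite !mxE /=; ring.
have e2 : gen i j *m gen j l = delta_mx i l.
  rewrite /gen; delta_simp.
  rewrite !eqxx (negbTE ij) (negbTE il) (negbTE jl).
  by apply/matrixP => a b; rewrite !mxE /=; ring.
have e3 : plane j l *m gen i j = - delta_mx j i.
  rewrite /gen /plane (negbTE jl); delta_simp.
  rewrite !eqxx !(eq_sym l) (eq_sym j i) (negbTE ij) (negbTE il) (negbTE jl).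
  by apply/matrixP => a b; rewrite !mxE /=; ring.
have e4 : gen i j *m plane j l = delta_mx i j.
  rewrite /gen /plane (negbTE jl); delta_simp.
  rewrite !eqxx (negbTE ij) (negbTE il) (negbTE jl).
  by apply/matrixP => a b; rewrite !mxE /=; ring.
have z1 k : delta_mx k i *m gen j l = 0.
  rewrite /gen; delta_simp; rewrite (negbTE ij) (negbTE il).
  by apply/matrixP => a b; rewrite !mxE /=; ring.
have z2 k : delta_mx k i *m plane j l = 0.
  rewrite /plane (negbTE jl); delta_simp; rewrite (negbTE ij) (negbTE il).
  by apply/matrixP => a b; rewrite !mxE /=; ring.
have key (A B Q : 'M[R]_D) (c u v : R) : B *m A = delta_mx l i -> A *m B = delta_mx i l ->
    Q *m A = - delta_mx j i -> A *m Q = delta_mx i j ->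
    (forall k, delta_mx k i *m B = 0) -> (forall k, delta_mx k i *m Q = 0) ->
    (1%:M + u *: B + c *: Q) *m A *m (1%:M + v *: B + c *: Q) =
    A + u *: delta_mx l i + v *: delta_mx i l + c *: (delta_mx i j - delta_mx j i).
  move=> {}e1 {}e2 {}e3 {}e4 {}z1 {}z2.
  rewrite !(mulmxDl, mulmxDr) !mul1mx !mulmx1 -!scalemxAl -!scalemxAr.
  rewrite e1 e2 e3 e4 ?mulNmx !z1 !z2.
  by apply/matrixP => a b; rewrite !mxE /=; ring.
rewrite !rotE sinN cosN (key _ _ _ _ _ _ e1 e2 e3 e4 z1 z2) /gen.
by apply/matrixP => a b; rewrite !mxE /=; ring.
Qed.

(** Both curves start at the identity with the velocity computed in [gen_conj]. This first-order
    agreement is what [curve_derive] uses to compare their images. *)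
Lemma rot_conj_close i j l s : i != j -> i != l -> j != l ->
  forall e, 0 < e -> exists2 d, 0 < d & forall t, `|t| < d ->
    mxl1 (rot j l s *m rot i j t *m rot j l (- s)
          - rot i j (cos s * t) *m rot i l (- sin s * t)) <= e * `|t|.
Proof.
move=> ij il jl.
have d0 k m c : mderivable_to (fun t => rot k m (c * t)) 0 (c *: gen k m).
  apply: (@mder_ext _ _ _ (fun t => rot k m (c * t + 0))) => [t|]; first by rewrite addr0.
  by apply: mder_affine; rewrite mulr0 addr0; apply: rot_derive.
have d1 : mderivable_to (fun t => rot j l s *m rot i j t *m rot j l (- s)) 0
    (cos s *: gen i j - sin s *: gen i l).
  rewrite -gen_conj //.
  have := mder_mul (mder_mul (mder_cst (rot j l s) 0) (rot_derive i j))
    (mder_cst (rot j l (- s)) 0).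
  by rewrite mul0mx add0r mulmx0 addr0.
have d2 : mderivable_to (fun t => - (rot i j (cos s * t) *m rot i l (- sin s * t))) 0
    (- (cos s *: gen i j - sin s *: gen i l)).
  have := mder_mul (mder_cst (- 1%:M) 0) (mder_mul (d0 i j (cos s)) (d0 i l (- sin s))).
  rewrite !mulr0 !rot0 mulmx1 mul1mx mul0mx add0r mulNmx mul1mx scaleNr.
  by rewrite mulmx1; apply: mder_ext => t; rewrite mulNmx mul1mx.
have := mder_add d1 d2; rewrite subrr => /mder_eps H e /H[d dpos dP].
exists d => // t /dP; rewrite !add0r scaler0 subr0 !mulr0 !rot0 mulmx1.
by rewrite -rotD subrr rot0 mulmx1 subrr subr0.
Qed.

End Rotations.

(** * Differentiability of continuous representations *)

Section LieDerivative.
Variables (R : realType) (D m : nat) (sigma : 'M[R]_D -> 'M[R]_m).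
Local Notation SO := (@Defs.SO R D).
Local Notation rot := (@Defs.rot R D).
Local Notation mder := mderivable_to.
Hypothesis sigma1 : sigma 1%:M = 1%:M.
Hypothesis sigmaM : forall g h, SO g -> SO h -> sigma (g *m h) = sigma g *m sigma h.
Hypothesis sigma_cont1 : forall e, 0 < e -> exists2 d, 0 < d &
  forall g, SO g -> mxl1 (g - 1%:M) < d -> mxl1 (sigma g - 1%:M) < e.
Implicit Types (g h : 'M[R]_D).

(** Exceeds the norm of every matrix in [SO], by [SO_bound], and is positive whatever [D] is. *)
Let c0 : R := (D * D)%:R + 1.

(** Let [x] be the distance from [g] to 1 and [n] the integer part of [d / (2 c0 x)]. The first [n]
    powers of [g] stay within [d] of 1, so their images stay within [1/2] of 1 and the sum [S] of
    the images within [n / 2] of [n]. By telescoping [(sigma g - 1) S = sigma (g ^ n) - 1], so [n]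
    times the norm of [sigma g - 1] is at most 1, and [1 / n] is of order [x]. *)
Lemma sigma_lipschitz : exists C d, [/\ 0 < C, 0 < d &
  forall g, SO g -> mxl1 (g - 1%:M) < d -> mxl1 (sigma g - 1%:M) <= C * mxl1 (g - 1%:M)].
Proof.
have c0_gt0 : 0 < c0 by rewrite ltr_wpDl ?ler0n.
have h2 : 0 < (2^-1 : R) by rewrite invr_gt0 ltr0n.
have [d d0 dP] := sigma_cont1 h2.
exists (4 * c0 / d), (d / (2 * c0)); split; rewrite ?divr_gt0 ?mulr_gt0 ?ltr0n //.
move=> g Sg; set x := mxl1 (g - 1%:M) => xd.
have [x0|x0] := eqVneq x 0.
  have -> : g = 1%:M.
    apply/eqP; rewrite -subr_eq0; apply/eqP/matrixP => i j; rewrite [RHS]mxE.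
    by apply/eqP; rewrite -normr_le0; apply: le_trans (mxl1_entry _ i j) _; rewrite -/x x0.
  by rewrite sigma1 subrr mxl10 x0 mulr0.
have xgt0 : 0 < x by rewrite lt_def x0 mxl1_ge0.
pose gp k := iter k (mulmx g) 1%:M.
have Sgp k : SO (gp k).
  elim: k => [|k IH]; first exact: SO1.
  exact: (SO_mul Sg IH).
have gpx k : mxl1 (gp k - 1%:M) <= k%:R * (c0 * x).
  elim: k => [|k IH]; first by rewrite /= subrr mxl10 mul0r.
  have -> : gp k.+1 - 1%:M = (g - 1%:M) *m gp k + (gp k - 1%:M).
    by rewrite mulmxBl mul1mx /gp /= addrA subrK.
  apply: le_trans (mxl1D _ _) _; rewrite -natr1 mulrDl mul1r addrC lerD //.
  apply: le_trans (mxl1M _ _) _; rewrite -/x mulrC ler_wpM2r ?(ltW xgt0) //.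
  by apply: le_trans (SO_bound (Sgp k)) _; rewrite lerDl.
pose sp k := iter k (mulmx (sigma g)) 1%:M.
have spE k : sp k = sigma (gp k).
  elim: k => [|k IH]; first by rewrite sigma1.
  by rewrite /sp iterS -/(sp k) IH -(sigmaM Sg (Sgp k)).
have cx0 : 0 < 2 * (c0 * x) by rewrite !mulr_gt0 ?ltr0n.
pose q := d / (2 * (c0 * x)).
have q1 : 1 <= q.
  rewrite ler_pdivlMr // mul1r mulrA mulrC.
  by move: xd; rewrite ltr_pdivlMr ?mulr_gt0 ?ltr0n // => /ltW.
have /andP[nq qn] : (Num.truncn q)%:R <= q < (Num.truncn q).+1%:R.
  by apply: truncn_itv; apply: le_trans q1.
set n := Num.truncn q in nq qn.
have n1 : (0 < n)%N by rewrite -ltnS -(ltr_nat R); apply: le_lt_trans qn.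
have small k : (k <= n)%N -> mxl1 (sp k - 1%:M) < 2^-1.
  move=> kn; rewrite spE; apply: dP => //; apply: le_lt_trans (gpx k) _.
  apply: (@le_lt_trans _ _ (q * (c0 * x))).
    apply: ler_wpM2r; first by rewrite mulr_ge0 // ltW.
    by apply: le_trans _ nq; rewrite ler_nat.
  have -> : q * (c0 * x) = d / 2 by rewrite /q; field; rewrite x0 gt_eqF.
  by rewrite ltr_pdivrMr ?ltr0n // ltr_pMr // ltr1n.
pose B := sigma g - 1%:M; pose S := \sum_(k < n) sp k.
have BS : B *m S = sp n - 1%:M.
  rewrite /B mulmxBl mul1mx mulmx_sumr /S.
  elim: (n) => [|p IH]; first by rewrite !big_ord0 subrr /sp /= subrr.
  rewrite !big_ord_recr /= opprD addrACA IH.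
  by rewrite addrC addrA subrK.
have Sn : mxl1 (S - n%:R%:M) <= n%:R / 2.
  have -> : S - n%:R%:M = \sum_(k < n) (sp k - 1%:M).
    by rewrite sumrB sumr_const card_ord -[1%:M *+ n]scaler_nat scalemx1.
  apply: le_trans (mxl1_sum _) _.
  apply: (@le_trans _ _ (\sum_(k < n) 2^-1)); last by rewrite sumr_const card_ord mulr_natl.
  by apply: ler_sum => k _; apply/ltW/small/ltnW.
have key : n%:R * mxl1 B <= 2^-1 + mxl1 B * (n%:R / 2).
  rewrite -[n%:R in leLHS]ger0_norm ?ler0n // -mxl1Z.
  have -> : n%:R *: B = B *m S - B *m (S - n%:R%:M).
    by rewrite -mulmxBr opprB addrC subrK mul_mx_scalar.
  apply: le_trans (mxl1B _ _) _; apply: lerD; first by rewrite BS ltW ?small.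
  by apply: le_trans (mxl1M _ _) _; rewrite ler_wpM2l ?mxl1_ge0.
have nB : n%:R * mxl1 B <= 1 by lra.
have n0 : 0 < n%:R :> R by rewrite ltr0n.
have : mxl1 B <= n%:R^-1 by rewrite -[_^-1]mulr1 ler_pdivlMl.
move/le_trans; apply.
(* Since [1 <= q], taking the integer part loses at most a factor 2, which is why the constant is
   [4 * c0 / d]. *)
have qn2 : q <= 2 * n%:R.
  apply: (le_trans (ltW qn)); rewrite -natr1 mulr_natl mulr2n lerD2l.
  by rewrite ler1n.
rewrite -[_^-1]mulr1 ler_pdivrMl //.
have -> : n%:R * (4 * c0 / d * x) = (2 * n%:R) / q.
  by rewrite /q; field; rewrite ?(gt_eqF d0) ?x0 ?(gt_eqF c0_gt0).
by rewrite ler_pdivlMr ?mul1r // (lt_le_trans ltr01).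
Qed.

Lemma rot_continuous0 i j : forall e, 0 < e -> exists2 d, 0 < d &
  forall t, `|t| < d -> mxl1 (rot i j t - 1%:M) < e.
Proof.
move=> e e0; have /mder_eps/(_ _ ltr01)[d d0 dP] := @rot_derive R D i j.
pose K := 1 + mxl1 (gen R i j).
have K0 : 0 < K by rewrite ltr_pwDl ?mxl1_ge0.
exists (Num.min d (e / K)); first by rewrite lt_min d0 divr_gt0.
move=> t; rewrite lt_min => /andP[/dP le1 te].
have -> : rot i j t - 1%:M = (rot i j (0 + t) - rot i j 0 - t *: gen R i j) + t *: gen R i j.
  by rewrite subrK add0r rot0.
apply: le_lt_trans (mxl1D _ _) _; rewrite mxl1Z.
apply: (@le_lt_trans _ _ (K * `|t|)); last by rewrite mulrC -ltr_pdivlMr.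
by rewrite /K mulrDl [mxl1 _ * _]mulrC lerD2r.
Qed.

Definition sigma_rot i j t := sigma (rot i j t).

Lemma sigma_rotD i j s t : sigma_rot i j (s + t) = sigma_rot i j s *m sigma_rot i j t.
Proof. by rewrite /sigma_rot rotD sigmaM //; apply: rot_SO. Qed.

Lemma sigma_rot0 i j : sigma_rot i j 0 = 1%:M.
Proof. by rewrite /sigma_rot rot0. Qed.

Lemma sigma_rot_continuous i j a b : continuous (fun t => sigma_rot i j t a b).
Proof.
move=> t; apply/cvgrPdist_lt => e e0.
pose K := mxl1 (sigma_rot i j t) + 1.
have K0 : 0 < K by rewrite ltr_wpDl ?mxl1_ge0.
have eK : 0 < e / K by rewrite divr_gt0.
have [d d0 dP] := sigma_cont1 eK.
have [d' d'0 d'P] := rot_continuous0 i j d0.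
apply/nbhs_ballP; exists d' => //= s; rewrite /ball /= distrC => st.
have -> : sigma_rot i j t a b - sigma_rot i j s a b =
    - ((sigma_rot i j t *m (sigma_rot i j (s - t) - 1%:M)) a b).
  by rewrite mulmxBr mulmx1 -sigma_rotD [t + _]addrC subrK !mxE opprB.
rewrite normrN; apply: le_lt_trans (mxl1_entry _ _ _) _.
apply: le_lt_trans (mxl1M _ _) _.
apply: (@le_lt_trans _ _ (K * mxl1 (sigma_rot i j (s - t) - 1%:M))).
  by rewrite ler_wpM2r ?mxl1_ge0 // lerDl.
rewrite mulrC -ltr_pdivlMr //; apply: dP; first exact: rot_SO.
exact: d'P.
Qed.

(** A row [v] killed by [A] equals [- v *m (A - 1)], whose norm is at most half that of [v]. *)
Lemma unitmx_near1 n (A : 'M[R]_n) : mxl1 (A - 1%:M) <= 2^-1 -> A \in unitmx.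
Proof.
move=> A1; rewrite -row_free_unit -kermx_eq0; apply/rowV0P => v /sub_kermxP vA.
have ve : v = - (v *m (A - 1%:M)) by rewrite mulmxBr vA mulmx1 sub0r opprK.
have le : mxl1 v <= mxl1 v * 2^-1.
  rewrite {1}ve mxl1N; apply: le_trans (mxl1M _ _) _.
  by rewrite ler_wpM2l ?mxl1_ge0.
have v0 : mxl1 v <= 0 by have := mxl1_ge0 v; lra.
apply/rowP => i; rewrite mxE; apply/eqP; rewrite -normr_le0.
exact: le_trans (mxl1_entry _ _ _) v0.
Qed.

(* If [P] is an antiderivative of the one-parameter group [F], then
   [(P s - P 0) *m F a = P (s + a) - P a] exhibits [F] as a derivable function. *)
Lemma sigma_rot_derivable i j : exists L, mder (sigma_rot i j) 0 L.
Proof.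
have anti (x : 'I_m * 'I_m) : exists P : R -> R,
    forall t, `|t| < 1 -> is_derive t (1 : R) P (sigma_rot i j t x.1 x.2).
  exact: (antiderivative_near (@sigma_rot_continuous i j x.1 x.2)).
have [p pP] := choice anti.
pose P t : 'M[R]_m := \matrix_(a, b) p (a, b) t.
have dP t : `|t| < 1 -> mder P t (sigma_rot i j t).
  move=> t1 a b; apply: (@is_derive_ext _ (p (a, b))); first by move=> u; rewrite mxE.
  exact: (pP (a, b)).
have h1 : `|0 : R| < 1 by rewrite normr0.
have half_gt0 : 0 < (2^-1 : R) by rewrite invr_gt0 ltr0n.
have [d d0 dd] := proj1 (mder_eps _ _ _) (dP 0 h1) _ half_gt0.
(* With [|s| < d] the matrix [Q] below is [s] times a matrix within [1/2] of 1, hence invertible;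
   [1/4] ensures [|s| < 1/2], so that [key] only visits points where [P] is an antiderivative. *)
pose s := Num.min (d / 2) (4^-1 : R).
have s0 : 0 < s by rewrite lt_min divr_gt0 ?invr_gt0 ?ltr0n.
have sd : `|s| < d.
  rewrite gtr0_norm // gt_min ltr_pdivrMr ?ltr0n // ltr_pMr // ltr1n //.
have s2 : `|s| < 2^-1.
  by rewrite gtr0_norm // gt_min; apply/orP; right; lra.
pose Q := P s - P 0.
have uQ : Q \in unitmx.
  have -> : Q = s *: (s^-1 *: Q) by rewrite scalerA divff ?scale1r // gt_eqF.
  rewrite unitmxZ ?unitfE ?gt_eqF //; apply: unitmx_near1.
  have -> : s^-1 *: Q - 1%:M = s^-1 *: (P (0 + s) - P 0 - s *: sigma_rot i j 0).
    by rewrite add0r sigma_rot0 [RHS]scalerBr [s^-1 *: (s *: _)]scalerA mulVf ?scale1r // gt_eqF.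
  rewrite mxl1Z normfV ler_pdivrMl ?normr_gt0 ?gt_eqF // mulrC; exact: dd.
have key a : `|a| < 2^-1 -> sigma_rot i j a = invmx Q *m (P (s + a) - P a).
  move=> a2; suff e : Q *m sigma_rot i j a = P (s + a) - P a by rewrite -e mulKmx.
  (* Its derivative in [u] is the difference of the two sides of the group law [sigma_rotD], hence
     0. *)
  pose g u := P (1 * u + a) - P a - (P u - P 0) *m sigma_rot i j a.
  have dg u : `|u| < 2^-1 -> mder g u 0.
    move=> u2; have u1 : `|u| < 1 by lra.
    have ua1 : `|1 * u + a| < 1 by rewrite mul1r (le_lt_trans (ler_normD _ _)) //; lra.
    rewrite [X in mder _ _ X](_ : 0 = 1 *: sigma_rot i j (1 * u + a) + 0
      - (((sigma_rot i j u + 0) *m sigma_rot i j a) + (P u - P 0) *m 0)); last first.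
      by rewrite scale1r mul1r !addr0 mulmx0 addr0 -sigma_rotD subrr.
    rewrite /g; apply: mder_add; first apply: mder_add.
    - exact: (mder_affine (dP _ ua1)).
    - exact: mder_cst.
    - apply: mder_opp; apply: mder_mul; last exact: mder_cst.
      exact: (mder_add (dP _ u1) (mder_cst (- P 0) u)).
  have gs : g s = g 0.
    apply/matrixP => x y; apply: (@derive0_cst_near _ (fun u => g u x y) 2^-1) => // u u2.
    by have := dg u u2 x y; rewrite mxE.
  move: gs; rewrite /g mul1r mulr0 add0r !subrr mul0mx subrr => /eqP.
  by rewrite subr_eq0 => /eqP.
exists (invmx Q *m (sigma_rot i j s - sigma_rot i j 0)).
have dG : mder (fun a => invmx Q *m (P (1 * a + s) - P a)) 0
    (invmx Q *m (sigma_rot i j s - sigma_rot i j 0)).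
  have dPs : mder (fun a => P (1 * a + s)) 0 (1 *: sigma_rot i j s).
    by apply: mder_affine; rewrite mulr0 add0r; apply: dP; lra.
  have := mder_mul (mder_cst (invmx Q) 0) (mder_add dPs (mder_opp (dP 0 h1))).
  by rewrite mul0mx add0r scale1r.
apply/mder_eps => e e0; have [r r0 rP] := proj1 (mder_eps _ _ _) dG _ e0.
exists (Num.min r 2^-1); first by rewrite lt_min r0.
move=> h; rewrite lt_min => /andP[/rP le hh].
move: le; rewrite !mul1r !add0r [h + s]addrC => le.
by rewrite (key h) // [X in _ - X - _]key ?normr0 // addr0.
Qed.

End LieDerivative.

(** * Bracket relations for the derived action *)

Section LieBracket.
Variables (R : realType) (D m : nat) (sigma : 'M[R]_D -> 'M[R]_m).
Local Notation SO := (@Defs.SO R D).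
Local Notation rot := (@Defs.rot R D).
Local Notation mder := mderivable_to.
Local Notation srot := (sigma_rot sigma).
Hypothesis sigma1 : sigma 1%:M = 1%:M.
Hypothesis sigmaM : forall g h, SO g -> SO h -> sigma (g *m h) = sigma g *m sigma h.
Hypothesis sigma_cont1 : forall e, 0 < e -> exists2 d, 0 < d &
  forall g, SO g -> mxl1 (g - 1%:M) < d -> mxl1 (sigma g - 1%:M) < e.
Variable X : 'I_D -> 'I_D -> 'M[R]_m.
Hypothesis dX : forall i j, mder (srot i j) 0 (X i j).

Lemma srot_derive i j t : mder (srot i j) t (srot i j t *m X i j).
Proof.
have d1 : mder (fun u => srot i j (1 * u + - t)) t (1 *: X i j).
  by apply: mder_affine; rewrite mul1r subrr; apply: dX.
have := mder_mul (mder_cst (srot i j t) t) d1.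
rewrite mul0mx add0r scale1r; apply: mder_ext => u.
by rewrite -sigma_rotD // mul1r addrCA subrr addr0.
Qed.

Lemma lie_antisym i j : X j i = - X i j.
Proof.
have d1 : mder (fun t => srot i j (-1 * t + 0)) 0 (-1 *: X i j).
  by apply: mder_affine; rewrite mulr0 addr0; apply: dX.
apply: (mder_uniq (dX j i)); rewrite -scaleN1r; apply: mder_ext d1 => t.
by rewrite /sigma_rot [RHS](congr1 sigma (rot_antisym i j t)) mulN1r addr0.
Qed.

Lemma lie_diag i : X i i = 0.
Proof.
apply: (mder_uniq (dX i i)); apply: mder_ext (mder_cst 1%:M 0) => t.
by rewrite /sigma_rot rot_diag sigma1.
Qed.

(** Write [sigma (g t) = sigma (h t) *m sigma ((h t)^T *m g t)]. By [sigma_lipschitz] the last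
    factor differs from 1 by at most a constant times the distance between [g t] and [h t], that is
    by [o(t)], so it does not affect the derivative. *)
Lemma curve_derive (g h : R -> 'M[R]_D) L : (forall t, SO (g t)) -> (forall t, SO (h t)) ->
  g 0 = h 0 ->
  (forall e, 0 < e -> exists2 d, 0 < d & forall t, `|t| < d -> mxl1 (g t - h t) <= e * `|t|) ->
  mder (fun t => sigma (h t)) 0 L -> mder (fun t => sigma (g t)) 0 L.
Proof.
move=> Sg Sh gh0 close dh.
have [C [r [C0 r0 lip]]] := sigma_lipschitz sigma1 sigmaM sigma_cont1.
have [d1 d10 d1P] := proj1 (mder_eps _ _ _) dh _ ltr01.
pose K := mxl1 (sigma (h 0)) + (1 + mxl1 L) + 1.
have K0 : 0 < K by rewrite ltr_wpDl ?addr_ge0 ?mxl1_ge0.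
have hK t : `|t| < Num.min d1 1 -> mxl1 (sigma (h t)) <= K.
  rewrite lt_min => /andP[/d1P]; rewrite add0r => le1 t1.
  have -> : sigma (h t) = (sigma (h t) - sigma (h 0) - t *: L) + (sigma (h 0) + t *: L).
    by rewrite -[X in X + _]addrA -opprD subrK.
  have l1 := mxl1D (sigma (h t) - sigma (h 0) - t *: L) (sigma (h 0) + t *: L).
  have l2 := mxl1D (sigma (h 0)) (t *: L); rewrite mxl1Z in l2.
  have l3 : `|t| * mxl1 L <= 1 * mxl1 L by rewrite ler_wpM2r ?mxl1_ge0 // ltW.
  by rewrite /K; lra.
pose c0 : R := (D * D)%:R + 1.
have c00 : 0 < c0 by rewrite ltr_wpDl ?ler0n.
apply/mder_eps => e e0.
have e2 : 0 < e / 2 by rewrite divr_gt0.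
have [d2 d20 d2P] := proj1 (mder_eps _ _ _) dh _ e2.
(* Chosen so that the bound [K] of [sigma (h t)], the Lipschitz constant [C] and the factor [c0] of
   the transpose multiply it back to [e / 2]. *)
pose e' := e / 2 / (K * C * c0).
have e'0 : 0 < e' by rewrite divr_gt0 ?mulr_gt0.
have [d3 d30 d3P] := close _ e'0.
have [d4 d40 d4P] := close _ ltr01.
exists (Num.min (Num.min d1 1) (Num.min d2 (Num.min d3 (Num.min d4 (r / (2 * c0)))))).
  by rewrite !lt_min d10 d20 d30 d40 ltr01 !divr_gt0 ?mulr_gt0.
move=> t; rewrite lt_min => /andP[/hK hKt]; rewrite !lt_min => /and4P[/d2P + /d3P g3 /d4P g4 tr].
rewrite !add0r gh0 => h2.
have tau : SO ((h t)^T *m g t) by apply: SO_mul => //; apply: SO_tr.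
have tauE : (h t)^T *m g t - 1%:M = (h t)^T *m (g t - h t).
  by rewrite mulmxBr SO_trK.
have taul : mxl1 ((h t)^T *m g t - 1%:M) <= c0 * mxl1 (g t - h t).
  rewrite tauE; apply: le_trans (mxl1M _ _) _; rewrite ler_wpM2r ?mxl1_ge0 //.
  by apply: le_trans (SO_bound (SO_tr (Sh t))) _; rewrite lerDl.
have taur : mxl1 ((h t)^T *m g t - 1%:M) < r.
  apply: (le_lt_trans taul); apply: (@le_lt_trans _ _ (c0 * (1 * `|t|))).
    by rewrite ler_wpM2l // ltW.
  move: tr; rewrite ltr_pdivlMr ?mulr_gt0 // => tr; apply: le_lt_trans tr.
  have := normr_ge0 t; nra.
have lipt := lip _ tau taur.
have -> : sigma (g t) - sigma (h 0) - t *: L =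
    sigma (h t) *m (sigma ((h t)^T *m g t) - 1%:M) + (sigma (h t) - sigma (h 0) - t *: L).
  rewrite mulmxBr mulmx1 -sigmaM // mulmxA; have [-> _] := Sh t.
  by rewrite mul1mx !addrA subrK.
apply: le_trans (mxl1D _ _) _.
have -> : e * `|t| = e / 2 * `|t| + e / 2 * `|t| by field.
apply: lerD => //; apply: le_trans (mxl1M _ _) _.
apply: (@le_trans _ _ (K * (C * (c0 * (e' * `|t|))))); last first.
  rewrite le_eqVlt; apply/orP; left; apply/eqP; rewrite /e'.
  by field; rewrite !gt_eqF.
apply: ler_pM; rewrite ?mxl1_ge0 //.
apply: (le_trans lipt); rewrite ler_pM2l //; apply: (le_trans taul).
by rewrite ler_pM2l.
Qed.

Lemma lie_conj i j l s : i != j -> i != l -> j != l ->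
  srot j l s *m X i j *m srot j l (- s) = cos s *: X i j - sin s *: X i l.
Proof.
move=> ij il jl.
have d1 : mder (fun t => sigma (rot j l s *m rot i j t *m rot j l (- s))) 0
    (srot j l s *m X i j *m srot j l (- s)).
  have := mder_mul (mder_mul (mder_cst (srot j l s) 0) (dX i j)) (mder_cst (srot j l (- s)) 0).
  rewrite mul0mx add0r mulmx0 addr0; apply: mder_ext => t.
  by rewrite /sigma_rot !sigmaM //; do ?apply: SO_mul; apply: rot_SO.
have d0 k n c : mder (fun t => srot k n (c * t)) 0 (c *: X k n).
  apply: (@mder_ext _ _ _ (fun t => srot k n (c * t + 0))) => [t|]; first by rewrite addr0.
  by apply: mder_affine; rewrite mulr0 addr0; apply: dX.
apply: (mder_uniq d1).
apply: (@curve_derive _ (fun t => rot i j (cos s * t) *m rot i l (- sin s * t))).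
- by move=> t; do ?apply: SO_mul; apply: rot_SO.
- by move=> t; apply: SO_mul; apply: rot_SO.
- by rewrite /= !mulr0 !rot0 !mulmx1 -rotD subrr rot0.
- exact: rot_conj_close.
have := mder_mul (d0 i j (cos s)) (d0 i l (- sin s)).
rewrite !mulr0 !sigma_rot0 // mulmx1 mul1mx scaleNr; apply: mder_ext => t.
by rewrite /sigma_rot sigmaM //; apply: rot_SO.
Qed.

(** Both sides of [lie_conj] differentiated at [s = 0]. *)
Lemma lie_bracket_adj i j l : i != j -> i != l -> j != l ->
  X i j *m X j l - X j l *m X i j = X i l.
Proof.
move=> ij il jl.
have d1 : mder (fun s => srot j l s *m X i j *m srot j l (- s)) 0
    (X j l *m X i j - X i j *m X j l).
  have dN : mder (fun s => srot j l (-1 * s + 0)) 0 (-1 *: X j l).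
    by apply: mder_affine; rewrite mulr0 addr0; apply: dX.
  have := mder_mul (mder_mul (dX j l) (mder_cst (X i j) 0)) dN.
  rewrite mulr0 addr0 !sigma_rot0 // mulmx0 addr0 mulmx1 mul1mx scaleN1r mulmxN.
  by apply: mder_ext => s; rewrite mulN1r addr0.
have d2 : mder (fun s => srot j l s *m X i j *m srot j l (- s)) 0 (- X i l).
  apply: (@mder_ext _ _ _ (fun s => cos s *: X i j + - (sin s *: X i l))).
    by move=> s; rewrite lie_conj.
  rewrite [X in mder _ _ X](_ : - X i l = - sin 0 *: X i j + - (cos 0 *: X i l)); last first.
    by rewrite sin0 cos0 oppr0 scale0r add0r scale1r.
  apply: mder_add; first by apply: mder_scale; apply: is_derive_cos.
  by apply: mder_opp; apply: mder_scale; apply: is_derive_sin.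
by rewrite -[RHS]opprK -(mder_uniq d1 d2) opprB.
Qed.

(** [rot_commute] differentiated at 0 in each of its two parameters. *)
Lemma lie_bracket_disjoint i j k l : i != k -> i != l -> j != k -> j != l ->
  X i j *m X k l = X k l *m X i j.
Proof.
move=> ik il jk jl.
have e1 s : srot i j s *m X k l = X k l *m srot i j s.
  have d1 := mder_mul (mder_cst (srot i j s) 0) (dX k l).
  have d2 := mder_mul (dX k l) (mder_cst (srot i j s) 0).
  rewrite mul0mx add0r in d1; rewrite mulmx0 addr0 in d2.
  apply: (mder_uniq d1); apply: mder_ext d2 => t.
  rewrite /sigma_rot -!sigmaM; try exact: rot_SO.
  by congr sigma; rewrite (rot_commute s t ik il jk jl).
have d1 := mder_mul (dX i j) (mder_cst (X k l) 0).
have d2 := mder_mul (mder_cst (X k l) 0) (dX i j).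
rewrite mulmx0 addr0 in d1; rewrite mul0mx add0r in d2.
by apply: (mder_uniq d1); apply: mder_ext d2 => t; rewrite e1.
Qed.

(** When exactly one index is shared, antisymmetry puts it in the middle and [lie_bracket_adj]
    applies; the other coincidence patterns are disjoint, equal or degenerate pairs. *)
Lemma lie_bracket i j k l : X i j *m X k l = X k l *m X i j +
  ((j == k)%:R *: X i l - (i == k)%:R *: X j l - (j == l)%:R *: X i k + (i == l)%:R *: X j k).
Proof.
have shared a b c : a != b -> a != c -> b != c -> X a b *m X b c = X b c *m X a b + X a c.
  by move=> ab ac bc; rewrite -(lie_bracket_adj ab ac bc) addrC subrK.
have as_ := lie_antisym.
have [<-|ij] := eqVneq i j.
  by rewrite lie_diag mul0mx mulmx0 add0r; apply/matrixP => a b; rewrite !mxE /=; ring.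
have [<-|kl] := eqVneq k l.
  by rewrite lie_diag mul0mx mulmx0 add0r; apply/matrixP => a b; rewrite !mxE /=; ring.
have ji : j != i by rewrite eq_sym.
have lk : l != k by rewrite eq_sym.
have [jk|jk] := eqVneq j k.
  rewrite -jk in kl lk *; rewrite (negbTE ij) (negbTE kl).
  have [<-|il] := eqVneq i l.
    by rewrite !lie_diag (as_ i j) mulmxN mulNmx !scaler0 !scale0r /= !(subr0, addr0).
  by rewrite (shared i j l) // !scale0r scale1r !(subr0, addr0).
have [ik|ik] := eqVneq i k.
  rewrite -ik in kl lk *; rewrite (negbTE kl).
  have [<-|jl] := eqVneq j l.
    by rewrite !lie_diag !scaler0 !scale0r !(subr0, addr0).
  rewrite -[X i j]opprK -(as_ i j) mulNmx (shared j i l) // mulmxN opprD.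
  by rewrite !scale0r scale1r sub0r !(subr0, addr0).
have [jl|jl] := eqVneq j l.
  rewrite -jl in kl lk *; rewrite (negbTE ij) -[X k j]opprK -(as_ k j) mulmxN.
  rewrite (shared i j k) // mulNmx opprD.
  by rewrite !scale0r scale1r !(subr0, addr0, sub0r).
have [il|il] := eqVneq i l.
  rewrite -il in kl lk *; rewrite -[X k i]opprK -(as_ k i) -[X i j]opprK -(as_ i j).
  rewrite !mulmxN !mulNmx !opprK (shared j i k) //.
  by rewrite !scale0r scale1r !(subr0, addr0, sub0r, add0r).
by rewrite lie_bracket_disjoint // !scale0r !(subr0, addr0).
Qed.

End LieBracket.

(** * Uniqueness for linear differential equations *)

Section LinearODE.
Variable R : realType.

(** Gronwall's argument for the sum [h] of the squared entries: [h' <= c h], so [h] times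
    [expR (- c * t)] does not increase from its value 0, while [h] is nonnegative. *)
Lemma linear_ode_ge0 p m (G : R -> 'M[R]_(p, m)) (Y : 'M[R]_m) :
  (forall t, mderivable_to G t (G t *m Y)) -> G 0 = 0 -> forall t, 0 <= t -> G t = 0.
Proof.
move=> dG G0 t t0.
pose h s := \sum_i \sum_j G s i j * G s i j.
pose h' s := \sum_i \sum_j ((G s *m Y) i j * G s i j + G s i j * (G s *m Y) i j).
have dh s : is_derive s (1 : R) h (h' s).
  apply: is_derive_bigsum => i; apply: is_derive_bigsum => j.
  by apply: is_derive_mul; apply: dG.
(* From [2 x y <= x ^ 2 + y ^ 2] and a sum over pairs of columns, in which each square occurs [2 m]
   times. *)
pose c := 2 * (m%:R * mxl1 Y).
have hc s : h' s <= c * h s.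
  rewrite /h' /h mulr_sumr; apply: ler_sum => i _.
  have row (a b : 'I_m) : G s i a * Y a b * G s i b + G s i b * (G s i a * Y a b) <=
      mxl1 Y * (G s i a * G s i a + G s i b * G s i b).
    have := mxl1_entry Y a b; move: (G s i a) (G s i b) (Y a b) (mxl1 Y) => x y z w.
    rewrite ler_norml => /andP[z1 z2].
    have := sqr_ge0 (x + y); have := sqr_ge0 (x - y); nra.
  apply: (@le_trans _ _ (\sum_b \sum_a mxl1 Y * (G s i a * G s i a + G s i b * G s i b))).
    apply: ler_sum => b _; rewrite !mxE mulr_suml mulr_sumr -big_split /=.
    by apply: ler_sum => a _; apply: row.
  rewrite le_eqVlt; apply/orP; left; apply/eqP.
  under eq_bigr do rewrite -mulr_sumr big_split /= sumr_const card_ord -mulr_natl.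
  rewrite -mulr_sumr big_split /= sumr_const card_ord -mulr_natl -mulr_sumr /c.
  ring.
pose E s := expR (- c * s).
have dE s : is_derive s (1 : R) E (- c * expR (- c * s)).
  apply: (@is_derive_ext _ (fun u => expR (- c * u + 0))) => [u|]; first by rewrite addr0.
  have := @is_derive_affine R expR s (- c) 0 (expR (- c * s)); apply.
  by rewrite addr0; apply: is_derive_expR.
have := @derive_le0_le R (fun s => h s * E s) (fun s => h' s * E s + h s * (- c * E s))
  (fun s => is_derive_mul (dh s) (dE s)).
have neg s : h' s * E s + h s * (- c * E s) <= 0.
  have := expR_gt0 (- c * s); have := hc s; rewrite -/(E s); nra.
move=> /(_ neg t t0).
have -> : h 0 = 0 by rewrite /h G0 big1 // => i _; rewrite big1 // => j _; rewrite mxE mul0r.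
rewrite mul0r pmulr_lle0 ?expR_gt0 // => ht.
have sq0 i j : 0 <= G t i j * G t i j by rewrite -expr2 sqr_ge0.
apply/matrixP => i j; rewrite mxE; apply/eqP.
have : h t == 0 by rewrite eq_le ht sumr_ge0 // => k _; rewrite sumr_ge0.
rewrite psumr_eq0 => [/allP/(_ i (mem_index_enum _))|k _]; last by rewrite sumr_ge0.
rewrite psumr_eq0 //= => /allP/(_ j (mem_index_enum _)) /=.
by rewrite mulf_eq0 orbb.
Qed.

(** Negative times follow by reversing time, which replaces [Y] by [- Y]. *)
Lemma linear_ode_unique p m (G : R -> 'M[R]_(p, m)) (Y : 'M[R]_m) :
  (forall t, mderivable_to G t (G t *m Y)) -> G 0 = 0 -> forall t, G t = 0.
Proof.
move=> dG G0 t; have [t0|/ltW t0] := leP 0 t; first exact: (linear_ode_ge0 dG).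
have := @linear_ode_ge0 _ _ (fun s => G (-1 * s + 0)) (- Y).
rewrite mulr0 addr0 => /(_ _ G0 (- t)).
rewrite mulrN mulN1r opprK addr0; apply; last by rewrite oppr_ge0.
move=> s; rewrite mulmxN -[- (_ *m _)]scaleN1r; apply: mder_affine; exact: dG.
Qed.

End LinearODE.

(** * Generation by plane rotations *)

Section Givens.
Variables (R : realType) (D : nat).
Local Notation SO := (@Defs.SO R D).
Local Notation rot := (@Defs.rot R D).

(** The polar angle of [(x, y)]: [acos] gives it up to a sign, which is that of [y]. *)
Lemma rotation_angle (x y : R) :
  exists t, - sin t * x + cos t * y = 0 /\ 0 <= cos t * x + sin t * y.
Proof.
pose r := Num.sqrt (x ^+ 2 + y ^+ 2).
have r2 : r ^+ 2 = x ^+ 2 + y ^+ 2 by rewrite sqr_sqrtr // addr_ge0 // sqr_ge0.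
have r0 : 0 <= r by apply: sqrtr_ge0.
have [r00|rn0] := eqVneq r 0.
  have : x ^+ 2 + y ^+ 2 == 0 by rewrite -r2 r00 expr0n.
  rewrite paddr_eq0 ?sqr_ge0 // !sqrf_eq0 => /andP[/eqP -> /eqP ->].
  by exists 0; rewrite !mulr0 addr0.
have rgt : 0 < r by rewrite lt_def rn0.
have xr : -1 <= x / r <= 1.
  rewrite -ler_norml normrM normfV (ger0_norm r0) ler_pdivrMr // mul1r.
  by rewrite -(@ler_pXn2r _ 2) ?nnegrE // -normrX ger0_norm ?sqr_ge0 // r2 lerDl sqr_ge0.
have ct : cos (acos (x / r)) = x / r by rewrite acosK // in_itv.
have st : sin (acos (x / r)) = `|y| / r.
  rewrite sin_acos //; have -> : 1 - (x / r) ^+ 2 = (`|y| / r) ^+ 2.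
    by rewrite !exprMn -normrX (ger0_norm (sqr_ge0 y)); apply: (mulIf (expf_neq0 2 rn0));
      rewrite mulrBl mul1r !exprVn !divfK ?expf_neq0 // r2 addrC addKr.
  by rewrite sqrtr_sqr ger0_norm // divr_ge0.
have fin t : cos t = x / r -> sin t = y / r ->
    - sin t * x + cos t * y = 0 /\ 0 <= cos t * x + sin t * y.
  move=> -> ->; split; first by field.
  have -> : x / r * x + y / r * y = (x ^+ 2 + y ^+ 2) / r by field.
  by rewrite -r2 divr_ge0 // sqr_ge0.
have [y0|/ltW y0] := leP 0 y.
  by exists (acos (x / r)); apply: fin => //; rewrite st ger0_norm.
exists (- acos (x / r)); apply: fin; first by rewrite cosN.
by rewrite sinN st ler0_norm // mulNr opprK.
Qed.

Lemma delta_mulE (i j a b : 'I_D) (g : 'M[R]_D) :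
  (delta_mx i j *m g) a b = (a == i)%:R * g j b.
Proof.
rewrite mxE (bigD1 j) //= mxE eqxx andbT big1 ?addr0 // => k kj.
by rewrite mxE (negbTE kj) andbF mul0r.
Qed.

Lemma rot_mulE (i j a b : 'I_D) (t : R) (g : 'M[R]_D) : i != j ->
  (rot i j t *m g) a b =
    if a == i then cos t * g i b + sin t * g j b
    else if a == j then - sin t * g i b + cos t * g j b else g a b.
Proof.
move=> ij; rewrite rotE /gen /plane (negbTE ij) !mulmxDl mul1mx -!scalemxAl mulmxDl mulmxBl.
have mD (A B : 'M[R]_D) : (A + B) a b = A a b + B a b by rewrite mxE.
have mN (A : 'M[R]_D) : (- A) a b = - A a b by rewrite mxE.
have mZ c (A : 'M[R]_D) : (c *: A) a b = c * A a b by rewrite mxE.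
rewrite !(mD, mZ, mN) !delta_mulE; have [->|ai] := eqVneq a i.
  by rewrite (negbTE ij) /=; ring.
by have [->|aj] := eqVneq a j; rewrite /=; ring.
Qed.

(** Givens elimination by columns: [good c g] says that the first [c] columns are those of the
    identity. Orthogonality makes the first [c] rows trivial as well, so clearing the next column
    below its diagonal leaves [1] or [-1] on the diagonal. *)
Lemma givens_ind (Q : 'M[R]_D -> Prop) : Q 1%:M ->
  (forall i j t g, SO g -> Q g -> Q (rot i j t *m g)) -> forall g, SO g -> Q g.
Proof.
move=> Q1 Qrot.
have back i j t g : SO g -> Q (rot i j t *m g) -> Q g.
  move=> Sg Qg; have -> : g = rot i j (- t) *m (rot i j t *m g).
    by rewrite mulmxA -rotD addNr rot0 mul1mx.
  by apply: Qrot => //; apply: SO_mul => //; apply: rot_SO.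
pose good (c : nat) (g : 'M[R]_D) := forall a b : 'I_D, (b < c)%N -> g a b = (a == b)%:R.
have good_row c g : SO g -> good c g ->
    forall a b : 'I_D, (b < c)%N -> g b a = (a == b)%:R.
  move=> Sg gg a b bc; have := congr1 (fun A : 'M[R]_D => A b a) (SO_trK Sg).
  rewrite !mxE (bigD1 b) //= mxE gg // eqxx mul1r big1 ?addr0 => [->|k kb].
    by rewrite eq_sym.
  by rewrite mxE gg // (negbTE kb) mul0r.
suff step : forall c, (c <= D)%N -> forall g, SO g -> good (D - c)%N g -> Q g.
  by move=> g Sg; apply: (step D) => // a b; rewrite subnn.
elim=> [|c IH] cD g Sg gg.
  suff -> : g = 1%:M by [].
  by apply/matrixP => a b; rewrite mxE gg // subn0.
pose C := (D - c.+1)%N; have CD : (C < D)%N by rewrite /C; lia.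
have CE : (D - c)%N = C.+1 by rewrite /C; lia.
pose oc := Ordinal CD.
have fin h : SO h -> good C h -> (forall r : 'I_D, (C < r)%N -> h r oc = 0) ->
    (c = 0%N \/ 0 <= h oc oc) -> Q h.
  move=> Sh gh h0 hpos; apply: IH => //; first exact: ltnW.
  have col a : a != oc -> h a oc = 0.
    move=> ac; have : (a : nat) != C by apply: contra ac => /eqP e; apply/eqP/val_inj.
    rewrite neq_ltn => /orP[lt|]; last exact: h0.
    by rewrite (good_row C h Sh gh _ _ lt) eq_sym (negbTE ac).
  have h1 : h oc oc = 1.
    (* In the last column nothing lies below the diagonal and no rotation fixes the sign; the matrix
       is then triangular and its determinant does. *)
    case: hpos => [c0|hpos].
      have [_ dh] := Sh; rewrite -dh det_trig.
        rewrite (bigD1 oc) //= big1 ?mulr1 // => k kc; rewrite gh ?eqxx //.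
        have : (k : nat) != C by apply: contra kc => /eqP e; apply/eqP/val_inj.
        by have := ltn_ord k; rewrite /C c0; lia.
      apply/is_trig_mxP => a b ab; have [boc|boc] := eqVneq b oc.
        by rewrite boc col //; apply: contraTneq ab => ->; rewrite boc ltnn.
      rewrite gh; first by case: eqP => // e; rewrite e ltnn in ab.
      have : (b : nat) != C by apply: contra boc => /eqP e; apply/eqP/val_inj.
      by have := ltn_ord b; rewrite /C c0; lia.
    have := congr1 (fun A : 'M[R]_D => A oc oc) (SO_trK Sh).
    rewrite !mxE (bigD1 oc) //= mxE big1 ?addr0 ?eqxx => [/eqP|k kc]; last by rewrite col // mulr0.
    rewrite -expr2 sqrf_eq1 => /orP[/eqP //|/eqP e].
    by move: hpos; rewrite e oppr_ge0 ler10.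
  move=> a b; rewrite CE ltnS leq_eqVlt => /orP[/eqP bC|]; last exact: gh.
  have -> : b = oc by apply: val_inj.
  by have [->|ac] := eqVneq a oc; rewrite ?h1 ?eqxx // col.
(* Entries are cleared from the bottom row up, and each rotation leaves a nonnegative diagonal
   entry. The disjunction records that when none is left to do, either one has been done or the
   column is the last. *)
suff clear : forall k, (C + k < D)%N -> forall h, SO h -> good C h ->
    (forall r : 'I_D, (C + k < r)%N -> h r oc = 0) -> c = 0%N \/ (0 < k)%N \/ 0 <= h oc oc -> Q h.
  apply: (clear c) => //.
  - by rewrite /C; lia.
  - by move=> r; have := ltn_ord r; rewrite /C; lia.
  - by case: (c); [left|right; left].
elim=> [|k IHk] kD h Sh gh h0 hpos.
  by apply: fin => // [r Cr|]; [apply: h0; rewrite addn0|case: hpos => [|[]]; [left| |right]].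
pose r := Ordinal kD.
have cr : oc != r by apply/eqP => /(congr1 val) /=; lia.
have [t [t1 t2]] := rotation_angle (h oc oc) (h r oc).
apply: (back oc r t) => //; apply: IHk.
- lia.
- by apply: SO_mul => //; apply: rot_SO.
- move=> a b bC; rewrite rot_mulE //; case: ifP => [/eqP ->|_].
    rewrite !gh //; have -> : (oc == b) = false by apply/eqP => /(congr1 val) /=; lia.
    have -> : (r == b) = false by apply/eqP => /(congr1 val) /=; lia.
    by rewrite !mulr0 addr0.
  case: ifP => [/eqP ->|_]; last exact: gh.
  rewrite !gh //; have -> : (oc == b) = false by apply/eqP => /(congr1 val) /=; lia.
  have -> : (r == b) = false by apply/eqP => /(congr1 val) /=; lia.
  by rewrite !mulr0 addr0.
- move=> a Ca; rewrite rot_mulE //.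
  have -> : (a == oc) = false by apply/eqP => /(congr1 val) /=; lia.
  case: ifP => [/eqP ar|/eqP ar] //; apply: h0.
  have : (a : nat) <> (C + k.+1)%N by move=> e; apply: ar; apply: val_inj.
  lia.
- by right; right; rewrite rot_mulE // eqxx.
Qed.

End Givens.

(** * The Lie algebra action of a representation *)

Section Realify.
Variables (R : realType).
Local Notation C := (complex R).
Local Notation cRe := (@complex.Re R).
Local Notation cIm := (@complex.Im R).

Lemma cReD (x y : C) : cRe (x + y) = cRe x + cRe y.
Proof. by case: x; case: y. Qed.

Lemma cImD (x y : C) : cIm (x + y) = cIm x + cIm y.
Proof. by case: x; case: y. Qed.

Lemma cReM (x y : C) : cRe (x * y) = cRe x * cRe y - cIm x * cIm y.
Proof. by case: x; case: y. Qed.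

Lemma cImM (x y : C) : cIm (x * y) = cRe x * cIm y + cIm x * cRe y.
Proof. by case: x => a b; case: y => c d. Qed.

Lemma cReN (x : C) : cRe (- x) = - cRe x.
Proof. by case: x. Qed.

Lemma cImN (x : C) : cIm (- x) = - cIm x.
Proof. by case: x. Qed.

Lemma cRe_sum (I : finType) (F : I -> C) : cRe (\sum_i F i) = \sum_i cRe (F i).
Proof. by apply: (big_morph cRe) => //; apply: cReD. Qed.

Lemma cIm_sum (I : finType) (F : I -> C) : cIm (\sum_i F i) = \sum_i cIm (F i).
Proof. by apply: (big_morph cIm) => //; apply: cImD. Qed.

Lemma complex_eq (x y : C) : cRe x = cRe y -> cIm x = cIm y -> x = y.
Proof. by case: x => a b; case: y => c d /= -> ->. Qed.

(** An injective ring morphism to real matrices of twice the size, so that identities between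
    complex matrices can be proved with real derivatives. *)
Definition realify n (A : 'M[C]_n) : 'M[R]_(n + n) :=
  block_mx (map_mx cRe A) (- map_mx cIm A) (map_mx cIm A) (map_mx cRe A).

Lemma realify_inj n : injective (@realify n).
Proof.
move=> A B /eq_block_mx[/matrixP eR _ /matrixP eI _]; apply/matrixP => i j.
by apply: complex_eq; [have := eR i j|have := eI i j]; rewrite !mxE.
Qed.

Lemma realify_mul n (A B : 'M[C]_n) : realify (A *m B) = realify A *m realify B.
Proof.
have re : map_mx cRe (A *m B) = map_mx cRe A *m map_mx cRe B - map_mx cIm A *m map_mx cIm B.
  apply/matrixP => i j; rewrite !mxE cRe_sum -sumrB; apply: eq_bigr => k _.
  by rewrite !mxE cReM.
have im : map_mx cIm (A *m B) = map_mx cRe A *m map_mx cIm B + map_mx cIm A *m map_mx cRe B.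
  apply/matrixP => i j; rewrite !mxE cIm_sum -big_split; apply: eq_bigr => k _ /=.
  by rewrite !mxE cImM.
rewrite /realify mulmx_block re im !mulmxN !mulNmx opprD.
by congr block_mx; rewrite addrC.
Qed.

Lemma realify1 n : realify (1%:M : 'M[C]_n) = 1%:M.
Proof.
have re : map_mx cRe 1%:M = 1%:M :> 'M[R]_n.
  by apply/matrixP => i j; rewrite !mxE; case: eqP.
have im : map_mx cIm 1%:M = 0 :> 'M[R]_n.
  by apply/matrixP => i j; rewrite !mxE; case: eqP.
by rewrite /realify re im oppr0 -scalar_mx_block.
Qed.

Lemma realify_add n (A B : 'M[C]_n) : realify (A + B) = realify A + realify B.
Proof.
rewrite /realify add_block_mx -opprD; congr block_mx; try congr (- _);
  by apply/matrixP => i j; rewrite !mxE ?cReD ?cImD.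
Qed.

Lemma realify_opp n (A : 'M[C]_n) : realify (- A) = - realify A.
Proof.
rewrite /realify opp_block_mx; congr block_mx; try congr (- _);
  by apply/matrixP => i j; rewrite !mxE ?cReN ?cImN.
Qed.

Lemma realify0 n : realify (0 : 'M[C]_n) = 0.
Proof. by rewrite -(subrr 0) realify_add realify_opp subrr. Qed.

Lemma realify_bool n (b : bool) (A : 'M[C]_n) : realify (b%:R *: A) = b%:R *: realify A.
Proof. by case: b; rewrite /= ?scale1r ?scale0r ?realify0. Qed.

End Realify.

Section Representation.
Variables (R : realType) (D n : nat) (rho : 'M[R]_D -> 'M[complex R]_n).
Local Notation C := (complex R).
Local Notation SO := (@Defs.SO R D).
Local Notation rot := (@Defs.rot R D).
Local Notation mder := mderivable_to.
Hypothesis rep : is_rep rho.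

Let sigma g := realify (rho g).
Local Notation srot := (sigma_rot sigma).

Let sigma1 : sigma 1%:M = 1%:M.
Proof. by rewrite /sigma; have [-> _] := rep; apply: realify1. Qed.

Let sigmaM g h : SO g -> SO h -> sigma (g *m h) = sigma g *m sigma h.
Proof. by move=> Sg Sh; rewrite /sigma; have [_ [-> // _]] := rep; apply: realify_mul. Qed.

Lemma within_SO_eps (f : 'M[R]_D -> R) : {within @Defs.SO R D, continuous f}%classic ->
  forall e, 0 < e -> exists2 d, 0 < d &
  forall g, SO g -> mxl1 (g - 1%:M) < d -> `|f g - f 1%:M| < e.
Proof.
move=> /subspace_continuousP/(_ _ (@SO1 R D)) cf e e0.
move/cvgrPdist_lt: cf => /(_ e e0).
rewrite /within /= => /nbhs_ballP[d /= d0 dP]; exists d => // g Sg gd.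
rewrite distrC; apply: dP => //; split=> // i j.
rewrite /ball /= distrC; apply: le_lt_trans gd.
by apply: le_trans (mxl1_entry _ i j); rewrite !mxE.
Qed.

Let sigma_cont1 : forall e, 0 < e -> exists2 d, 0 < d &
  forall g, SO g -> mxl1 (g - 1%:M) < d -> mxl1 (sigma g - 1%:M) < e.
Proof.
move=> e e0.
have ent (x : 'I_(n + n) * 'I_(n + n)) e' : 0 < e' -> exists d, 0 < d /\
    forall g, SO g -> mxl1 (g - 1%:M) < d -> `|sigma g x.1 x.2 - sigma 1%:M x.1 x.2| < e'.
  move=> e'0; case: x => i j /=; have [_ [_ cts]] := rep.
  have cR a b := within_SO_eps (cts a b).1 e'0.
  have cI a b := within_SO_eps (cts a b).2 e'0.
  rewrite -(splitK i) -(splitK j) /sigma /realify.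
  case: (fintype.split i) => a; case: (fintype.split j) => b /=.
  - by have [d d0 dP] := cR a b; exists d; split=> // g Sg gd;
    rewrite !block_mxEul !mxE; apply: dP.
  - have [d d0 dP] := cI a b; exists d; split=> // g Sg gd;
    rewrite !block_mxEur !mxE.
    by rewrite -opprD normrN; apply: dP.
  - by have [d d0 dP] := cI a b; exists d; split=> // g Sg gd;
    rewrite !block_mxEdl !mxE; apply: dP.
  - by have [d d0 dP] := cR a b; exists d; split=> // g Sg gd;
    rewrite !block_mxEdr !mxE; apply: dP.
pose K := ((n + n) * (n + n)).+1%:R : R.
have K0 : 0 < K by rewrite ltr0n.
have [d dP] := choice (fun x => ent x (e / K) (divr_gt0 e0 K0)).
exists (\big[Num.min/1]_x d x).
  by apply: (big_ind (fun z => 0 < z)) => [//|x y x0 y0|x _];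
    [rewrite lt_min x0 y0|case: (dP x)].
move=> g Sg gd; apply: (@le_lt_trans _ _ (((n + n) * (n + n))%:R * (e / K))).
  apply: mxl1_bound => i j.
  have -> : (sigma g - 1%:M) i j = sigma g i j - sigma 1%:M i j.
    by rewrite sigma1 [LHS]mxE [X in _ + X]mxE.
  apply/ltW; apply: ((dP (i, j)).2 g Sg); apply: lt_le_trans gd _.
  by rewrite (bigD1 (i, j)) //= ge_min lexx.
by rewrite mulrCA gtr_pMr // ltr_pdivrMr // mul1r ltr_nat.
Qed.

(** [lie_act] acquires a meaning from [sigma_rot_derivable]; uniqueness of derivatives then shows
    that the four blocks of the derivative have the shape produced by [realify]. *)
Lemma realify_lie_act i j : mder (srot i j) 0 (realify (lie_act rho i j)).
Proof.
have [L dL] := sigma_rot_derivable sigma1 sigmaM sigma_cont1 i j.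
suff -> : realify (lie_act rho i j) = L by [].
have eR a b : is_derive 0 (1 : R) (fun t => complex.Re (rho (rot i j t) a b))
    (L (lshift n a) (lshift n b)).
  apply: is_derive_ext (dL _ _) => t.
  by rewrite /sigma_rot /sigma /realify block_mxEul mxE.
have eI a b : is_derive 0 (1 : R) (fun t => complex.Im (rho (rot i j t) a b))
    (L (rshift n a) (lshift n b)).
  apply: is_derive_ext (dL _ _) => t.
  by rewrite /sigma_rot /sigma /realify block_mxEdl mxE.
have eI' a b : is_derive 0 (1 : R) (fun t => - complex.Im (rho (rot i j t) a b))
    (L (lshift n a) (rshift n b)).
  apply: is_derive_ext (dL _ _) => t.
  by rewrite /sigma_rot /sigma /realify block_mxEur !mxE.
have eR' a b : is_derive 0 (1 : R) (fun t => complex.Re (rho (rot i j t) a b))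
    (L (rshift n a) (rshift n b)).
  apply: is_derive_ext (dL _ _) => t.
  by rewrite /sigma_rot /sigma /realify block_mxEdr mxE.
have lR a b : complex.Re (lie_act rho i j a b) = L (lshift n a) (lshift n b).
  by rewrite mxE /= derive1E; case: (eR a b).
have lI a b : complex.Im (lie_act rho i j a b) = L (rshift n a) (lshift n b).
  by rewrite mxE /= derive1E; case: (eI a b).
apply/matrixP => x y; rewrite -(splitK x) -(splitK y) /realify.
case: (fintype.split x) => a; case: (fintype.split y) => b /=.
- by rewrite block_mxEul mxE lR.
- rewrite block_mxEur [LHS]mxE [X in - X]mxE lI.
  exact: is_derive_uniq (is_deriveN (eI a b)) (eI' a b).
- by rewrite block_mxEdl mxE lI.
- by rewrite block_mxEdr mxE lR; apply: is_derive_uniq (eR a b) (eR' a b).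
Qed.

Lemma rho_rot_comm i j t :
  lie_act rho i j *m rho (rot i j t) = rho (rot i j t) *m lie_act rho i j.
Proof.
apply: realify_inj; rewrite !realify_mul.
have d1 := mder_mul (realify_lie_act i j) (mder_cst (srot i j t) 0).
have d2 := mder_mul (mder_cst (srot i j t) 0) (realify_lie_act i j).
rewrite mulmx0 addr0 in d1; rewrite mul0mx add0r in d2.
apply: (mder_uniq d1); apply: mder_ext d2 => s.
by rewrite -!(sigma_rotD sigmaM) addrC.
Qed.

Lemma rho_rot_derive i j t :
  mder (fun s => realify (rho (rot i j s))) t (realify (rho (rot i j t) *m lie_act rho i j)).
Proof.
rewrite realify_mul.
exact: (srot_derive sigmaM realify_lie_act).
Qed.

Lemma lie_act_so_module : so_module (fun i j (v : 'cV[C]_n) => lie_act rho i j *m v).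
Proof.
split.
- move=> u v uv; apply/matrixP => a b; rewrite (ord1 b).
  apply: (uv (fun v => v a 0)); first by move=> x y; rewrite mxE.
  by move=> t x; rewrite mxE.
- by move=> i j u v; rewrite mulmxDr.
- by move=> i j t u; rewrite scalemxAr.
- move=> i j u; rewrite -mulNmx; congr (_ *m _); apply: realify_inj.
  by rewrite realify_opp; apply: (lie_antisym realify_lie_act).
- move=> i j k l u; rewrite !scalemxAl -!mulmxBl -!mulmxDl !mulmxA -mulmxDl.
  congr (_ *m _); apply: realify_inj.
  rewrite !(realify_add, realify_opp, realify_mul, realify_bool).
  exact: (lie_bracket sigma1 sigmaM sigma_cont1 realify_lie_act).
Qed.

(** By [givens_ind] one rotation is enough. [P] is both the column space of [A^T] and the kernel of
    [K = (cokermx A)^T]. Stability under [X] reads [X *m A^T = A^T *m Z], so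
    [K *m rho (rot i j s) *m A^T] solves [G' = G *m Z] with value 0 at 0, and vanishes. *)
Lemma submodule_invariant (P : 'cV[C]_n -> Prop) :
  submodule (fun i j (v : 'cV[C]_n) => lie_act rho i j *m v) P -> invariant_subspace rho P.
Proof.
move=> PX; have PD := subD PX; have PZ := subZ PX.
split; [exact: (sub0 PX)|split=> //; split=> // g v Sg Pv].
have [] := @subspace_rowspace C n (fun v => P v^T).
- by rewrite trmx0; apply: (sub0 PX).
- by move=> x y Px Py; rewrite linearD; apply: PD.
- by move=> t x Px; rewrite linearZ; apply: PZ.
move=> A PA.
have PK x : P x <-> (cokermx A)^T *m x = 0.
  have -> : P x <-> (x^T <= A)%MS by rewrite -[x in P x]trmxK; exact: PA.
  rewrite submxE; split=> [/eqP e|e].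
    by apply: trmx_inj; rewrite trmx_mul trmxK e trmx0.
  by apply/eqP; apply: trmx_inj; rewrite trmx_mul trmxK e trmx0.
move: g Sg v Pv; apply: givens_ind => [v|i j t g Sg IH v Pv].
  by have [-> _] := rep; rewrite mul1mx.
have [_ [rM _]] := rep; rewrite rM //; last exact: rot_SO.
rewrite -mulmxA; move: (rho g *m v) (IH v Pv) => u Pu; apply/PK.
pose X := lie_act rho i j.
have [Z XZ] : exists Z, X *m A^T = A^T *m Z.
  have /submxP[Z e] : (A *m X^T <= A)%MS.
    apply/row_subP => k; rewrite row_mul; apply/PA.
    rewrite trmx_mul trmxK; apply: (subX PX); apply/PA; exact: row_sub.
  by exists Z^T; apply: trmx_inj; rewrite !trmx_mul !trmxK e.
pose K := (cokermx A)^T.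
have ode : forall s, realify K *m realify (rho (rot i j s)) *m realify A^T = 0.
  apply: (linear_ode_unique (Y := realify Z)) => [s|].
    have := mder_mul (mder_mul (mder_cst (realify K) s) (rho_rot_derive i j s))
      (mder_cst (realify A^T) s).
    rewrite mul0mx add0r mulmx0 addr0 -!realify_mul.
    by rewrite -!mulmxA XZ !mulmxA.
  rewrite rot0; have [-> _] := rep; rewrite -!realify_mul mulmx1 -trmx_mul.
  by rewrite mulmx_coker trmx0 realify0.
have /submxP[w ue] : (u^T <= A)%MS by apply/PA; rewrite trmxK.
have -> : u = A^T *m w^T by apply: trmx_inj; rewrite trmx_mul !trmxK.
rewrite !mulmxA.
have -> : K *m rho (rot i j t) *m A^T = 0.
  by apply: realify_inj; rewrite !realify_mul ode realify0.
by rewrite mul0mx.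
Qed.

End Representation.

(** * Derivatives of polynomial functions *)

Lemma mpoly_ring_ind (A : comNzRingType) D (S : {mpoly A[D]} -> Prop) :
  (forall c, S c%:MP) -> (forall i, S 'X_i) -> (forall p q, S p -> S q -> S (p + q)) ->
  (forall p q, S p -> S q -> S (p * q)) -> forall p, S p.
Proof.
move=> SC SX SD SM p.
have S1 : S 1 by rewrite -mpolyC1.
have Sm m : S 'X_[m].
  rewrite mpolyXE_id; elim/big_ind: _ => // i _.
  by elim: (m i) => [|k IH]; [rewrite expr0|rewrite exprS; apply: SM].
rewrite [p]mpolyE; elim/big_ind: _ => // [|m _]; first by rewrite -mpolyC0.
by rewrite -mul_mpolyC; apply: SM.
Qed.

Section ComplexDerivative.
Variables (R : realType) (D : nat).
Local Notation C := (complex R).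
Local Notation P := {mpoly C[D]}.
Implicit Types (p q : P) (f g : R -> C).

Definition cderivable_to f (a : R) (l : C) : Prop :=
  is_derive a (1 : R) (fun t => complex.Re (f t)) (complex.Re l) /\
  is_derive a (1 : R) (fun t => complex.Im (f t)) (complex.Im l).

Local Notation cder := cderivable_to.

Lemma cder_ext f g a l : f =1 g -> cder f a l -> cder g a l.
Proof. by move=> /funext ->. Qed.

Lemma cder_uniq f a l k : cder f a l -> cder f a k -> l = k.
Proof.
move=> [lR lI] [kR kI]; apply: complex_eq; first exact: is_derive_uniq lR kR.
exact: is_derive_uniq lI kI.
Qed.

Lemma cder_cst (c : C) a : cder (fun=> c) a 0.
Proof. by split; apply: is_derive_cst. Qed.

Lemma cder_add f g a l k : cder f a l -> cder g a k -> cder (fun t => f t + g t) a (l + k).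
Proof.
move=> [fR fI] [gR gI]; split.
  rewrite cReD; apply: is_derive_ext (is_derive_add fR gR) => t.
  by rewrite cReD.
rewrite cImD; apply: is_derive_ext (is_derive_add fI gI) => t.
by rewrite cImD.
Qed.

Lemma cder_mul f g a l k : cder f a l -> cder g a k ->
  cder (fun t => f t * g t) a (l * g a + f a * k).
Proof.
move=> [fR fI] [gR gI]; split.
  have d := is_derive_add (is_derive_mul fR gR) (is_deriveN (is_derive_mul fI gI)).
  rewrite cReD !cReM; apply: (is_derive_eq (is_derive_ext _ d)); last by ring.
  by move=> t; rewrite cReM.
have d := is_derive_add (is_derive_mul fR gI) (is_derive_mul fI gR).
rewrite cImD !cImM; apply: (is_derive_eq (is_derive_ext _ d)); last by ring.
by move=> t; rewrite cImM.
Qed.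

Lemma cder_sum (I : finType) (h : I -> R -> C) (dh : I -> C) a :
  (forall i, cder (h i) a (dh i)) -> cder (fun t => \sum_i h i t) a (\sum_i dh i).
Proof.
move=> dhi; elim: (index_enum I) => [|i s IH].
  apply: (@cder_ext (fun=> 0)); first by move=> t; rewrite big_nil.
  by rewrite big_nil; apply: cder_cst.
apply: (@cder_ext (fun t => h i t + \sum_(j <- s) h j t)).
  by move=> t; rewrite big_cons.
by rewrite big_cons; apply: cder_add.
Qed.

Lemma cder_meval p (x : 'I_D -> R -> C) (dx : 'I_D -> C) a :
  (forall k, cder (x k) a (dx k)) ->
  cder (fun t => p.@[fun k => x k t]) a (\sum_k (p^`M(k)).@[fun k => x k a] * dx k).
Proof.
move=> dxk; pose S q := cder (fun t => q.@[fun k => x k t]) a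
  (\sum_k (q^`M(k)).@[fun k => x k a] * dx k).
have SC c : S c%:MP.
  rewrite /S; apply: (@cder_ext (fun=> c)); first by move=> t; rewrite mevalC.
  rewrite big1 => [|k _]; first exact: cder_cst.
  by rewrite mderivC meval0 mul0r.
have SD q r : S q -> S r -> S (q + r).
  move=> Sq Sr; rewrite /S.
  apply: (@cder_ext (fun t => q.@[fun k => x k t] + r.@[fun k => x k t])).
    by move=> t; rewrite mevalD.
  under eq_bigr do rewrite mderivD mevalD mulrDl.
  by rewrite big_split /=; apply: cder_add.
have SM q r : S q -> S r -> S (q * r).
  move=> Sq Sr; rewrite /S.
  apply: (@cder_ext (fun t => q.@[fun k => x k t] * r.@[fun k => x k t])).
    by move=> t; rewrite mevalM.
  have -> : \sum_k (q * r)^`M(k).@[fun k => x k a] * dx k =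
      (\sum_k (q^`M(k)).@[fun k => x k a] * dx k) * r.@[fun k => x k a] +
      q.@[fun k => x k a] * \sum_k (r^`M(k)).@[fun k => x k a] * dx k.
    rewrite mulr_suml mulr_sumr -big_split; apply: eq_bigr => k _ /=.
    by rewrite mderivM mevalD !mevalM; ring.
  exact: cder_mul.
have SX i : S 'X_i.
  rewrite /S; apply: (@cder_ext (x i)); first by move=> t; rewrite mevalXU.
  rewrite (bigD1 i) //= mderiv_var eqxx /kron meval1 mul1r big1 ?addr0 // => k ki.
  by rewrite mderiv_var eq_sym (negbTE ki) meval0 mul0r.
exact: (mpoly_ring_ind SC SX SD SM).
Qed.

Lemma meval_at0 p : p.@[fun=> 0] = p@_0.
Proof.
elim/mpolyind: p => [|c m p _ _ IH]; first by rewrite meval0 mcoeff0.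
rewrite mevalD mevalZ IH mcoeffD mcoeffZ mevalX mcoeffX; congr (_ * _ + _).
have [->|m0] := eqVneq m 0%MM; first by rewrite big1 // => i _; rewrite mnm0E expr0.
have /existsP[i mi] : [exists i, m i != 0%N].
  rewrite -[X in is_true X]negbK negb_exists; apply: contra m0 => /forallP mi.
  by apply/eqP/mnmP => i; have := mi i; rewrite negbK mnm0E => /eqP.
by rewrite (bigD1 i) //= expr0n (negbTE mi) mul0r.
Qed.

(** If a polynomial vanishes at all real points, so do its partial derivatives, being derivatives
    along real lines. Iterating, every derivative vanishes at 0, where it is a nonzero multiple of a
    coefficient. *)
Lemma peval_inj p q : (forall x : 'cV[R]_D, peval p x = peval q x) -> p = q.
Proof.
move=> pq; apply/eqP; rewrite -subr_eq0; apply/eqP.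
pose Z r := forall x : 'cV[R]_D, peval r x = 0.
have Zd i r : Z r -> Z r^`M(i).
  move=> Zr x.
  pose X k (t : R) : C := Complex (x k 0 + t * (k == i)%:R) 0.
  (* [(kron C 0 (k == i))@_0] is the Kronecker delta as a complex number: the constant coefficient
     of a polynomial in no variables. *)
  have dX k : cder (X k) 0 (kron C 0 (k == i))@_0.
    split=> /=.
      have -> : complex.Re (kron C 0 (k == i))@_0 = 0 + 1 * (k == i)%:R.
        by rewrite /kron; case: (k == i); rewrite ?mcoeff1 ?mcoeff0 ?eqxx /=; ring.
      have d1 := is_derive_mul (is_derive_id (0 : R) 1) (is_derive_cst ((k == i)%:R : R) (0 : R) 1).
      apply: (is_derive_eq (is_derive_add (is_derive_cst (x k 0) (0 : R) 1) d1)).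
      by rewrite mulr0 addr0.
    have -> : complex.Im (kron C 0 (k == i))@_0 = 0.
      by rewrite /kron; case: (k == i); rewrite ?mcoeff1 ?mcoeff0 ?eqxx.
    exact: is_derive_cst.
  have d1 := cder_meval r dX.
  have d2 : cder (fun t => r.@[fun k => X k t]) 0 0.
    apply: (@cder_ext (fun=> 0)); last exact: cder_cst.
    move=> t; rewrite -(Zr (\col_k (x k 0 + t * (k == i)%:R))).
    by apply: meval_eq => k; rewrite /X mxE.
  have := cder_uniq d1 d2; rewrite (bigD1 i) //= eqxx /kron mcoeff1 eqxx mulr1.
  rewrite big1 => [|k ki]; last by rewrite (negbTE ki) mcoeff0 mulr0.
  by rewrite addr0 => <-; apply: meval_eq => k; rewrite /X mul0r addr0.
have Zm m r : Z r -> Z r^`M[m].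
  rewrite mderivm_foldr => Zr.
  by elim: (flatten _) => //= i s; apply: Zd.
have Zpq : Z (p - q) by move=> x; rewrite /peval mevalB -/(peval p x) pq subrr.
apply/mpolyP => m; rewrite mcoeff0.
have := Zm m _ Zpq 0; rewrite /peval (@meval_eq _ _ _ (fun=> 0)); last by move=> k; rewrite mxE.
rewrite meval_at0 mcoeff_mderivm addm0 => /eqP; rewrite mulrn_eq0 => /orP[|/eqP //].
rewrite eqn0Ngt prodn_gt0 // => i.
by rewrite ffactnn fact_gt0.
Qed.

End ComplexDerivative.

Section LinearIntoPolynomials.
Variables (R : realType) (D n : nat).
Local Notation C := (complex R).
Local Notation P := {mpoly C[D]}.
Variable T : 'cV[C]_n -> P.
Hypothesis Tlin : forall (c : C) u v, T (c *: u + v) = c *: T u + T v.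

Lemma lin_add u v : T (u + v) = T u + T v.
Proof. by have := Tlin 1 u v; rewrite !scale1r. Qed.

Lemma lin_zero : T 0 = 0.
Proof. by apply: (addrI (T 0)); rewrite -lin_add !addr0. Qed.

Lemma lin_scale (c : C) u : T (c *: u) = c *: T u.
Proof. by rewrite -[c *: u]addr0 Tlin lin_zero addr0. Qed.

Lemma lin_sub u v : T (u - v) = T u - T v.
Proof. by rewrite -scaleN1r lin_add lin_scale scaleN1r. Qed.

Lemma lin_coord v : T v = \sum_a v a 0 *: T (delta_mx a 0).
Proof.
rewrite {1}[v]matrix_sum_delta (big_morph T lin_add lin_zero).
by apply: eq_bigr => a _; rewrite big_ord1 lin_scale.
Qed.

Lemma lin_meval v (x : 'I_D -> C) : (T v).@[x] = \sum_a v a 0 * (T (delta_mx a 0)).@[x].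
Proof.
by rewrite lin_coord raddf_sum /=; apply: eq_bigr => a _; rewrite mevalZ.
Qed.

End LinearIntoPolynomials.

(** * Passage between Lie algebra and group equivariance *)

Section Equivariance.
Variables (R : realType) (D n : nat) (rho : 'M[R]_D -> 'M[complex R]_n).
Local Notation C := (complex R).
Local Notation P := {mpoly C[D]}.
Local Notation SO := (@Defs.SO R D).
Local Notation rot := (@Defs.rot R D).
Local Notation cder := cderivable_to.
Hypothesis rep : is_rep rho.
Variable T : 'cV[C]_n -> P.
Hypothesis Tlin : forall (c : C) u v, T (c *: u + v) = c *: T u + T v.

Lemma rho_vec_derive i j t (v : 'cV[C]_n) a :
  cder (fun s => (rho (rot i j s) *m v) a 0) t
       ((rho (rot i j t) *m lie_act rho i j *m v) a 0).
Proof.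
have ent b : cder (fun s => rho (rot i j s) a b) t ((rho (rot i j t) *m lie_act rho i j) a b).
  have d := rho_rot_derive rep i j t; split.
    have := d (lshift n a) (lshift n b); rewrite /realify block_mxEul mxE.
    by apply: is_derive_ext => s; rewrite block_mxEul mxE.
  have := d (rshift n a) (lshift n b); rewrite /realify block_mxEdl mxE.
  by apply: is_derive_ext => s; rewrite block_mxEdl mxE.
apply: (@cder_ext _ (fun s => \sum_b rho (rot i j s) a b * v b 0)).
  by move=> s; rewrite mxE.
rewrite mxE; apply: cder_sum => b.
have := cder_mul (ent b) (cder_cst (v b 0) t).
by rewrite mulr0 addr0.
Qed.

Lemma rot_vec_derive i j t (y : 'cV[R]_D) k :
  is_derive t (1 : R) (fun s => (rot i j s *m y) k 0) ((gen R i j *m (rot i j t *m y)) k 0).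
Proof.
have dr : mderivable_to (rot i j) t (gen R i j *m rot i j t).
  have d1 : mderivable_to (fun u => rot i j (1 * u + - t)) t (1 *: gen R i j).
    by apply: mder_affine; rewrite mul1r subrr; apply: rot_derive.
  have := mder_mul d1 (mder_cst (rot i j t) t).
  rewrite mulmx0 addr0 scale1r; apply: mder_ext => u.
  by rewrite -rotD mul1r subrK.
have := mder_mul dr (mder_cst y t); rewrite mulmx0 addr0 -mulmxA; exact.
Qed.

(** The sign reflects the action [P (g^-1 x)]: moving the point along [gen i j] amounts to acting on
    the polynomial by [- X_ij]. *)
Lemma meval_gen i j (p : P) (x : 'cV[R]_D) :
  \sum_k (p^`M(k)).@[fun k => Complex (x k 0) 0] * Complex ((gen R i j *m x) k 0) 0 =
  - peval (rot_field i j p) x.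
Proof.
have gE k : Complex ((gen R i j *m x) k 0) 0 =
    (k == i)%:R * Complex (x j 0) 0 - (k == j)%:R * Complex (x i 0) 0 :> C.
  have dE2 a b : (delta_mx a b *m x) k 0 = (k == a)%:R * x b 0.
    rewrite mxE (bigD1 b) //= mxE eqxx andbT big1 ?addr0 // => l lb.
    by rewrite mxE (negbTE lb) andbF mul0r.
  rewrite /gen mulmxBl [in LHS]mxE [X in _ + X]mxE !dE2.
  by apply: complex_eq; rewrite /= !(cReD, cImD, cReN, cImN, cReM, cImM) /=;
    case: (k == i); case: (k == j) => /=; ring.
under eq_bigr do rewrite gE mulrBr.
rewrite sumrB (bigD1 i) //= eqxx mul1r big1 => [|k /negbTE ->]; last by rewrite mul0r mulr0.
rewrite (bigD1 j) //= eqxx mul1r big1 => [|k /negbTE ->]; last by rewrite mul0r mulr0.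
rewrite /peval /rot_field mevalB !mevalM !mevalXU; ring.
Qed.

(** Polynomial and point move together along the rotation; their contributions [rot_field i j] and
    [- rot_field i j] to the derivative cancel, so the value is that at [t = 0]. *)
Lemma lie_equivariant_rot :
  (forall i j v, T (lie_act rho i j *m v) = rot_field i j (T v)) ->
  forall i j t v y, peval (T (rho (rot i j t) *m v)) (rot i j t *m y) = peval (T v) y.
Proof.
move=> TX i j t v y.
pose X (s : R) k : C := Complex ((rot i j s *m y) k 0) 0.
pose f s := (T (rho (rot i j s) *m v)).@[X s].
have df s : cder f s 0.
  apply: (@cder_ext _ (fun u => \sum_a (rho (rot i j u) *m v) a 0 * (T (delta_mx a 0)).@[X u])).
    by move=> u; rewrite /f lin_meval.
  have dX k : cder (fun u => X u k) s (Complex ((gen R i j *m (rot i j s *m y)) k 0) 0).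
    by split; [exact: rot_vec_derive|exact: is_derive_cst].
  have d := cder_sum (fun a => cder_mul (rho_vec_derive i j s v a)
    (cder_meval (T (delta_mx a 0)) dX)).
  suff e : \sum_a ((rho (rot i j s) *m lie_act rho i j *m v) a 0 *
      (T (delta_mx a 0)).@[fun k => X s k] + (rho (rot i j s) *m v) a 0 *
      \sum_k (T (delta_mx a 0))^`M(k).@[fun k => X s k] *
        Complex ((gen R i j *m (rot i j s *m y)) k 0) 0) = 0 by move: d; rewrite e.
  rewrite big_split /= -(lin_meval Tlin) -(rho_rot_comm rep) -mulmxA TX.
  have -> : \sum_a (rho (rot i j s) *m v) a 0 *
      (\sum_k (T (delta_mx a 0))^`M(k).@[fun k => X s k] *
        Complex ((gen R i j *m (rot i j s *m y)) k 0) 0) =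
      - peval (rot_field i j (T (rho (rot i j s) *m v))) (rot i j s *m y).
    set u := rho (rot i j s) *m v.
    have TL c w z : rot_field i j (T (c *: w + z)) =
        c *: rot_field i j (T w) + rot_field i j (T z).
      by rewrite Tlin rot_fieldD rot_fieldZ.
    rewrite /peval (lin_meval TL) -sumrN; apply: eq_bigr => a _.
    by rewrite meval_gen mulrN.
  by rewrite /peval subrr.
have fR : complex.Re (f t) = complex.Re (f 0).
  by apply: (@is_derive_0_is_cst R (fun s => complex.Re (f s)) t 0) => s; case: (df s).
have fI : complex.Im (f t) = complex.Im (f 0).
  by apply: (@is_derive_0_is_cst R (fun s => complex.Im (f s)) t 0) => s; case: (df s).
have := complex_eq fR fI; rewrite /f /X rot0; have [-> _] := rep; rewrite !mul1mx.
exact.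
Qed.

Lemma lie_equivariant :
  (forall i j v, T (lie_act rho i j *m v) = rot_field i j (T v)) ->
  forall g v x, SO g -> peval (T (rho g *m v)) x = peval (T v) (invmx g *m x).
Proof.
move=> TX g v x Sg.
have : forall v y, peval (T (rho g *m v)) (g *m y) = peval (T v) y.
  move: g Sg {v x}; apply: givens_ind => [v y|i j t g Sg IH v y].
    by have [-> _] := rep; rewrite !mul1mx.
  have [_ [rM _]] := rep; rewrite rM //; last exact: rot_SO.
  by rewrite -!mulmxA lie_equivariant_rot.
move=> e; rewrite -(e v (invmx g *m x)) mulmxA mulmxV ?mul1mx // unitmxE.
by have [_ ->] := Sg; rewrite unitr1.
Qed.

(* Differentiating the equivariance along [rot i j]; polynomials are determined
   by their values at real points. *)
Lemma equivariant_lie :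
  (forall g v x, SO g -> peval (T (rho g *m v)) x = peval (T v) (invmx g *m x)) ->
  forall i j v, T (lie_act rho i j *m v) = rot_field i j (T v).
Proof.
move=> Teq i j v; apply: peval_inj => y.
have d1 : cder (fun t => peval (T (rho (rot i j t) *m v)) y) 0 (peval (T (lie_act rho i j *m v)) y).
  apply: (@cder_ext _ (fun t => \sum_a (rho (rot i j t) *m v) a 0 * peval (T (delta_mx a 0)) y)).
    by move=> t; rewrite /peval [RHS]lin_meval.
  rewrite /peval lin_meval //; apply: cder_sum => a.
  have := cder_mul (rho_vec_derive i j 0 v a) (cder_cst (peval (T (delta_mx a 0)) y) 0).
  by rewrite mulr0 addr0 rot0; have [-> _] := rep; rewrite mul1mx.
apply: (cder_uniq d1).
(* [rot j i s] is the inverse of [rot i j s], through which the equivariance moves the point. *)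
pose X (s : R) k : C := Complex ((rot j i s *m y) k 0) 0.
have dX k : cder (fun u => X u k) 0 (Complex ((gen R j i *m (rot j i 0 *m y)) k 0) 0).
  by split; [exact: rot_vec_derive|exact: is_derive_cst].
have := cder_meval (T v) dX; rewrite rot0 mul1mx.
have -> : (fun k => X 0 k) = (fun k => Complex (y k 0) 0).
  by apply/funext => k; rewrite /X rot0 mul1mx.
rewrite meval_gen; have -> : - peval (rot_field j i (T v)) y = peval (rot_field i j (T v)) y.
  by rewrite /peval -mevalN /rot_field opprB.
apply: cder_ext => t; rewrite Teq; last exact: rot_SO.
by rewrite SO_invmx ?rot_tr -?rot_antisym //; apply: rot_SO.
Qed.

End Equivariance.

(** * Antisymmetrisation over four indices *)

(** Permutations are sorted by the image [j] of 0, and lifting one of [n] letters multiplies its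
    sign by [(-1) ^ j]. Iterated, this unfolds a sum over ['S_4] into nested sums over ordinals. *)
Lemma alternating_sum_lift (C : numClosedFieldType) (V : lmodType C) n (G : 'S_n.+1 -> V) :
  \sum_(s : 'S_n.+1) (-1) ^+ s *: G s =
  \sum_(j < n.+1) (-1) ^+ j *: \sum_(t : 'S_n) (-1) ^+ t *: G (lift_perm ord0 j t).
Proof.
rewrite (partition_big (fun s : 'S_n.+1 => s ord0) xpredT) //=.
apply: eq_bigr => j _; rewrite scaler_sumr.
rewrite (reindex (lift_perm ord0 j)) /=.
  apply: eq_big => [t|t _]; first by rewrite lift_perm_id eqxx.
  by rewrite odd_lift_perm scalerA /= signr_addb signr_odd.
(* [ulsf i s] removes [i] from the source of [s] and [s i] from its target, which inverts
   [lift_perm]. *)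
pose ulsf i (s : 'S_n.+1) k := odflt k (unlift (s i) (s (lift i k))).
have ulsfK i (s : 'S_n.+1) k : lift (s i) (ulsf i s k) = s (lift i k).
  rewrite /ulsf; have:= neq_lift i k.
  by rewrite -(can_eq (permK s)) => /unlift_some[] ? ? ->.
have inj_ulsf : injective (ulsf ord0 _).
  move=> s; apply: can_inj (ulsf (s ord0) s^-1%g) _ => k'.
  by rewrite {1}/ulsf ulsfK !permK liftK.
exists (fun s => perm (inj_ulsf s)) => [s _ | s].
  by apply/permP=> k'; rewrite permE /ulsf lift_perm_lift lift_perm_id liftK.
move/(s _ =P _) => si0; apply/permP=> k.
case: (unliftP ord0 k) => [k'|] ->; rewrite ?lift_perm_id //.
by rewrite lift_perm_lift permE -si0 ulsfK.
Qed.

Section AlternatingSum.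
Variables (C : numClosedFieldType) (D : nat) (M : lmodType C).
Variables (X : 'I_D -> 'I_D -> M -> M).
Hypothesis (XM : so_module X).

Definition quad_index (i j k l : 'I_D) (m : 'I_4) : 'I_D := nth i [:: i; j; k; l] m.

Definition quad_term i j k l v (s : 'S_4) : M :=
  let idx := quad_index i j k l in
  X (idx (s ord0)) (idx (s (inord 1))) (X (idx (s (inord 2))) (idx (s (inord 3))) v).

(** The 24 terms fall into three groups of 8, one for each splitting of the indices into two pairs.
    Swapping the indices of a pair changes the sign of the permutation and that of [X]; exchanging
    the pairs is an even permutation of commuting factors. *)
Lemma quad_sum i j k l v : i != j -> i != k -> i != l -> j != k -> j != l -> k != l ->
  \sum_(s : 'S_4) (-1) ^+ s *: quad_term i j k l v s =
  8 *: (X i j (X k l v) - X i k (X j l v) + X i l (X j k v)).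
Proof.
move=> ij ik il jk jl kl.
have e1 : inord 1 = lift ord0 ord0 :> 'I_4 by apply: val_inj; rewrite /= inordK.
have e2 : inord 2 = lift ord0 (lift ord0 ord0) :> 'I_4 by apply: val_inj; rewrite /= inordK.
have e3 : inord 3 = lift ord0 (lift ord0 (lift ord0 ord0)) :> 'I_4.
  by apply: val_inj; rewrite /= inordK.
rewrite alternating_sum_lift.
under eq_bigr => a _ do (rewrite alternating_sum_lift;
  under eq_bigr => b _ do (rewrite alternating_sum_lift;
    under eq_bigr => c _ do rewrite alternating_sum_lift)).
have S0 (G : 'S_0 -> M) : \sum_(t : 'S_0) (-1) ^+ t *: G t = G 1%g.
  rewrite (big_pred1 1%g) ?odd_perm1 ?scale1r // => t.
  by apply/esym/eqP/permP => -[].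
pose g (a : 'I_4) (b : 'I_3) (c : 'I_2) : M :=
  X (quad_index i j k l a) (quad_index i j k l (lift a b))
    (X (quad_index i j k l (lift a (lift b c))) (quad_index i j k l (lift a (lift b (lift c ord0)))) v).
have gE a b c : \sum_(d < 1) (-1) ^+ d *: \sum_(t : 'S_0) (-1) ^+ t *: quad_term i j k l v
    (lift_perm ord0 a (lift_perm ord0 b (lift_perm ord0 c (lift_perm ord0 d t)))) = g a b c.
  rewrite big_ord1 scale1r S0 /quad_term e1 e2 e3.
  by rewrite !(lift_perm_lift, lift_perm_id).
under eq_bigr => a _ do under eq_bigr => b _ do under eq_bigr => c _ do rewrite gE.
have step n (h : 'I_n.+1 -> M) : \sum_(a < n.+1) (-1) ^+ a *: h a =
    h ord0 - \sum_(a < n) (-1) ^+ a *: h (lift ord0 a).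
  rewrite big_ord_recl scale1r -sumrN; congr (_ + _); apply: eq_bigr => a _.
  by rewrite /= exprS mulN1r scaleNr.
have done0 (h : 'I_0 -> M) : \sum_(a < 0) (-1) ^+ a *: h a = 0 by rewrite big_ord0.
rewrite !step !done0 !subr0 /g /quad_index /=.
rewrite !(so_antisym XM i j) !(so_antisym XM i k) !(so_antisym XM i l).
rewrite !(so_antisym XM j k) !(so_antisym XM j l) !(so_antisym XM k l).
have comm a b c d : a != c -> a != d -> b != c -> b != d ->
    X a b (X c d v) = X c d (X a b v).
  move=> ac ad bc bd; rewrite (so_bracket XM a b c d).
  rewrite (negbTE ac) (negbTE ad) (negbTE bc) (negbTE bd) !scale0r.
  by rewrite !subr0 !addr0.
have [ji ki li] : [/\ j != i, k != i & l != i] by rewrite ![_ == i]eq_sym.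
have [kj lj lk] : [/\ k != j, l != j & l != k] by rewrite ![_ == j]eq_sym (eq_sym l).
rewrite !(so_linN XM) (comm k l i j) // (comm j l i k) // (comm j k i l) //.
by apply: (so_ext XM) => f fD fZ fN f0; rewrite !(fD, fZ, fN); ring.
Qed.

(** Composing with the transposition of the two positions changes every sign and no term. *)
Lemma quad_sum_repeated i j k l v (a b : 'I_4) : a != b ->
  quad_index i j k l a = quad_index i j k l b ->
  \sum_(s : 'S_4) (-1) ^+ s *: quad_term i j k l v s = 0.
Proof.
move=> ab iab; set S := \sum_(s : 'S_4) _.
have SN : S = - S.
  rewrite {1}/S (reindex_inj (mulIg (tperm a b))) /= -sumrN; apply: eq_bigr => s _.
  rewrite odd_permM odd_tperm ab addbT signrN scaleNr; congr (- (_ *: _)).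
  have e x : quad_index i j k l ((s * tperm a b)%g x) = quad_index i j k l (s x).
    by rewrite permM; case: tpermP => [->|->|].
  by rewrite /quad_term !e.
have : 2 *: S = 0 by rewrite scaler_nat mulr2n {1}SN addNr.
by move/eqP; rewrite scaler_eq0 pnatr_eq0 /= => /eqP.
Qed.

Lemma so_simple_quad : so_simple X <->
  forall i j k l v, \sum_(s : 'S_4) (-1) ^+ s *: quad_term i j k l v s = 0.
Proof.
split=> [Xs i j k l v|H i j k l ij ik il jk jl kl v]; last first.
  have := H i j k l v; rewrite quad_sum // => /eqP.
  by rewrite scaler_eq0 pnatr_eq0 /= => /eqP.
pose o (m : nat) (m4 : (m < 4)%N) : 'I_4 := Ordinal m4.
have [e|ij] := eqVneq i j; first exact: (@quad_sum_repeated _ _ _ _ _ (@o 0 isT) (@o 1 isT)).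
have [e|ik] := eqVneq i k; first exact: (@quad_sum_repeated _ _ _ _ _ (@o 0 isT) (@o 2 isT)).
have [e|il] := eqVneq i l; first exact: (@quad_sum_repeated _ _ _ _ _ (@o 0 isT) (@o 3 isT)).
have [e|jk] := eqVneq j k; first exact: (@quad_sum_repeated _ _ _ _ _ (@o 1 isT) (@o 2 isT)).
have [e|jl] := eqVneq j l; first exact: (@quad_sum_repeated _ _ _ _ _ (@o 1 isT) (@o 3 isT)).
have [e|kl] := eqVneq k l; first exact: (@quad_sum_repeated _ _ _ _ _ (@o 2 isT) (@o 3 isT)).
by rewrite quad_sum // Xs // scaler0.
Qed.

End AlternatingSum.

Lemma rot_field_simple (C : numClosedFieldType) (D : nat) : so_simple (@rot_field C D).
Proof.
move=> i j k l ij ik il jk jl kl p; rewrite /rot_field !dE.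
have d a b : a != b -> kron C D (a == b) = 0 by move=> /negbTE ->.
rewrite !d // ?(eq_sym k) ?(eq_sym l) //; last by rewrite eq_sym.
rewrite (mderiv_comm l j) (mderiv_comm k j) (mderiv_comm l k); ring.
Qed.

(** * The two implications *)

Lemma simple_repE (R : realType) (D n : nat) (rho : 'M[R]_D -> 'M[complex R]_n) :
  is_rep rho -> (simple_rep rho <->
    so_simple (fun i j (v : 'cV[complex R]_n) => lie_act rho i j *m v)).
Proof.
move=> rep; have XM := lie_act_so_module rep.
have Q i j k l (v : 'cV[complex R]_n) :
    \sum_(s : 'S_4) (-1) ^+ s *: quad_term (fun i j v => lie_act rho i j *m v) i j k l v s =
    (let idx (m : 'I_4) : 'I_D := nth i [:: i; j; k; l] m in
    \sum_(s : 'S_4)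
       ((-1) ^+ s) *: (lie_act rho (idx (s ord0)) (idx (s (inord 1)))
                       *m lie_act rho (idx (s (inord 2))) (idx (s (inord 3))))) *m v.
  by rewrite /= mulmx_suml; apply: eq_bigr => s _; rewrite -scalemxAl -mulmxA.
rewrite (so_simple_quad XM); split=> [H i j k l v|H i j k l].
  by rewrite Q; move: (H i j k l) => /= ->; rewrite mul0mx.
rewrite /=; set S := (X in X = 0).
have Sv (v : 'cV[complex R]_n) : S *m v = 0 by rewrite -[RHS](H i j k l v) Q.
apply/matrixP => a b; have := congr1 (fun w : 'cV[complex R]_n => w a 0) (Sv (delta_mx b 0)).
move=> e; transitivity ((S *m (delta_mx b 0 : 'cV[complex R]_n)) a 0); last by rewrite e !mxE.
rewrite mxE (bigD1 b) //= [delta_mx _ _ _ _]mxE !eqxx mulr1 big1 ?addr0 // => c cb.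
by rewrite [delta_mx _ _ _ _]mxE (negbTE cb) mulr0.
Qed.

Lemma harmonic_homogE (R : realType) (D N : nat) (p : {mpoly (complex R)[D]}) :
  harmonic_homog N p <-> harmonic N p.
Proof.
by split=> [[hp lp]|[/eqP ep lp]]; split=> //; [apply/eqP; rewrite -homog_euler|rewrite homog_euler].
Qed.

Lemma finite_dim_col (C : numClosedFieldType) n (P : 'cV[C]_n -> Prop) : finite_dim P.
Proof.
exists n, (fun v => v^T); split=> [x y|t x|x _ x0].
- by rewrite linearD.
- by rewrite linearZ.
- by apply: trmx_inj; rewrite x0 trmx0.
Qed.

Lemma simple_rep_harmonic (R : realType) (D n : nat) (rho : 'M[R]_D -> 'M[complex R]_n) :
  (4 <= D)%N -> is_rep rho -> irreducible_rep rho -> simple_rep rho ->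
  exists N : nat, equiv_to_harmonic rho N.
Proof.
move=> hD rep [n0 irr] simp.
have XM := lie_act_so_module rep; have Xs := proj1 (simple_repE rep) simp.
set X := fun i j (v : 'cV[complex R]_n) => lie_act rho i j *m v in XM Xs.
pose o (m : nat) (m4 : (m < 4)%N) : 'I_D := Ordinal (leq_trans m4 hD).
pose o0 := @o 0 isT; pose o1 := @o 1 isT; pose o2 := @o 2 isT; pose o3 := @o 3 isT.
have o01 : o0 != o1 by [].
have full : submodule X (fun _ => True) by [].
(* Lie-stable subspaces are invariant under the group, so irreducibility passes from the group to
   the Lie algebra. *)
have irrX : irreducible_submodule X (fun _ => True).
  move=> Q QX _ [v Qv v0] u _; have [Q0|QT] := irr Q (submodule_invariant rep QX).
    by move: Qv v0; rewrite Q0 => ->; rewrite eqxx.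
  by rewrite QT.
have v0 : delta_mx (Ordinal n0) 0 != 0 :> 'cV[complex R]_n.
  apply/eqP => /matrixP/(_ (Ordinal n0) 0); rewrite !mxE !eqxx => /eqP.
  by rewrite oner_eq0.
have fin := @finite_dim_col (complex R) n (fun _ => True).
have [mu [w [_ wtop]]] := top_vector_exists XM o01 full fin I v0.
have [N muN] : exists N : nat, mu = N%:R.
  exact: (@top_weight_nat _ _ _ _ _ _ XM o01 _ _ _ full fin I wtop Xs o2 o3).
have hw : highest_vector X o0 o1 N%:R w.
  rewrite -muN; split=> // a b; exact: (top_perp XM o01 full fin I wtop Xs).
have D2 : (2 < D)%N by apply: leq_trans (hD).
have [T [Tlin Tinj Tharm Tsurj TX]] :=
  so_intertwiner XM (rot_field_so_module (complex R) D) o01 hw (null_exp_highest (complex R) o01 N)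
    irrX (@harmonic_submodule (complex R) D N) (null_exp_harmonic (complex R) o01 N)
    (harmonic_irreducible o01 D2).
exists N, T; split=> //; split=> //; split; last exact: (lie_equivariant rep Tlin TX).
apply/seteqP; split=> [_ [v _ <-]|p /harmonic_homogE/Tsurj[v <-]]; last by exists v.
exact/harmonic_homogE.
Qed.

(** The relation holds on polynomials by [rot_field_simple], and the injective [T], which
    intertwines the Lie actions, pulls it back. *)
Lemma equiv_harmonic_simple (R : realType) (D n N : nat) (rho : 'M[R]_D -> 'M[complex R]_n) :
  is_rep rho -> equiv_to_harmonic rho N -> simple_rep rho.
Proof.
move=> rep [T [Tlin [Tinj [_ Teq]]]]; apply/(simple_repE rep).
move=> i j k l ij ik il jk jl kl v; have TX := equivariant_lie rep Tlin Teq.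
apply: Tinj; rewrite (lin_zero Tlin) -[RHS](rot_field_simple ij ik il jk jl kl (T v)).
by rewrite (lin_add Tlin) (lin_sub Tlin) !TX.
Qed.

Theorem theorem2 (R : realType) (D : nat) (hD : (4 <= D)%N) (n : nat)
    (rho : 'M[R]_D -> 'M[complex R]_n) :
  is_rep rho -> irreducible_rep rho ->
  (simple_rep rho <-> exists N : nat, equiv_to_harmonic rho N).
Proof.
move=> rep irr; split; first exact: simple_rep_harmonic.
by case=> N; apply: equiv_harmonic_simple.
Qed.
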